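(* Let $\mathcal M_{a,b,-1}$ denote the space of solutions of the $-1$-flow on $\mathcal S(\mathbb R,\mathcal U_a^\perp)$ defined by $b$: $$\begin{cases}u_t=[a,g^{-1}bg],\\ g^{-1}g_x=u,\quad\lim_{x\to-\infty}g(x,t)=I.\end{cases}$$ Then the group $G_-^m$ acts on the space $\mathcal M_{a,b,-1}$. Moreover, let $u\in\mathcal M_{a,b,-1}$ (with associated $g$), $E$ the trivialization of $u$, and $g_{z,\pi}$ a simple element of $G_-^m$. Then: (i) $g_{z,\pi}*u=u+(z-\bar z)[\tilde\pi,a]$, where $\tilde\pi(x,t)$ is the Hermitian projection of $\mathbb C^n$ onto $E(x,t,z)^*(\pi(\mathbb C^n))$; (ii) $\tilde\pi$ is the solution of $$\begin{cases}\tilde\pi_x+[az+u,\tilde\pi]=(\bar z-z)[\tilde\pi,a]\tilde\pi,\\ \tilde\pi_t=\frac1{|z|^2}\left((z-\bar z)\tilde\pi g^{-1}bg\tilde\pi-zg^{-1}bg\tilde\pi+\bar z\tilde\pi g^{-1}bg\right),\\ \tilde\pi^*=\tilde\pi,\quad\tilde\pi^2=\tilde\pi,\quad\tilde\pi(0,0)=\pi.\end{cases}$$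
   Context: Fix a diagonal $a\in u(n)$ and $b\in u(n)$ with $[a,b]=0$. $\mathcal U_a=\{y\in u(n):[a,y]=0\}$, $\mathcal U_a^\perp$ is its orthogonal complement in $u(n)$ for the trace form, and $\mathcal S(\mathbb R,\mathcal U_a^\perp)$ is the Schwartz class. Elements of $\mathcal M_{a,b,-1}$ are smooth $u:\mathbb R^2\to\mathcal U_a^\perp$ with $u(\cdot,t)$ Schwartz for every $t$. The trivialization of $u$ is the solution $E(x,t,\lambda)$, holomorphic in $\lambda\in\mathbb C\setminus\{0\}$, of $E_x=E(a\lambda+u)$, $E_t=E\lambda^{-1}g^{-1}bg$, $E(0,0,\lambda)=I$; write $E(x,t)(\lambda)=E(x,t,\lambda)$. $G_-^m$ is the group of rational maps $f$ from $S^2=\mathbb C\cup\{\infty\}$ to $GL(n,\mathbb C)$ (invertible off a finite set) with $f(\infty)=I$ and $f(\bar\lambda)^*f(\lambda)=I$. Its simple elements are $g_{z,\pi}(\lambda)=\pi+\frac{\lambda-z}{\lambda-\bar z}(I-\pi)$, $z\in\mathbb C\setminus\mathbb R$, $\pi$ a Hermitian projection ($\pi^*=\pi=\pi^2$). $\hat G_+$ is the group of holomorphic maps $f:\mathbb C\setminus\{0\}\to GL(n,\mathbb C)$ with $f(\bar\lambda)^*f(\lambda)=I$. The action is defined by factoring, for $f\in G_-^m$, $fE(x,t)=\tilde E(x,t)\tilde f(x,t)$ with $\tilde E(x,t)\in\hat G_+$, $\tilde f(x,t)\in G_-^m$; then $f*u=\tilde u$ where $\tilde E^{-1}\tilde E_x=a\lambda+\tilde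 u$.
   Formalization: The claim that G_-^m acts on M_{a,b,-1} is made only when a is scalar or b commutes with all of U_a (automatic if a has distinct eigenvalues); otherwise dressing u=0 by a simple element can leave the space. (i) and (ii) are stated without this condition. *)

(* Defs.v *)
From mathcomp Require Import all_boot all_order all_algebra.
From mathcomp Require Import all_classical all_reals all_analysis.
From mathcomp Require Export complex.

Set Implicit Arguments.
Unset Strict Implicit.
Unset Printing Implicit Defensive.

Import Order.TTheory GRing.Theory Num.Theory.
Import numFieldNormedType.Exports.

Local Open Scope classical_set_scope.
Local Open Scope ring_scope.
Local Open Scope sesquilinear_scope.

Section Derivatives.
Context {R : realType} {n : nat}.

(* R[i] carries no normed R-module structure, so differentiation with respect
   to a real variable is expressed on the real and imaginary parts of the
   entries. *)
Definition re_entry (T : Type) (F : T -> 'M[R[i]]_n) (i j : 'I_n) : T -> R :=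
  fun s => complex.Re (F s i j).
Definition im_entry (T : Type) (F : T -> 'M[R[i]]_n) (i j : 'I_n) : T -> R :=
  fun s => complex.Im (F s i j).

Definition mx_derivable (F : R -> 'M[R[i]]_n) (x : R) : Prop :=
  forall i j, derivable (re_entry F i j) x 1 /\ derivable (im_entry F i j) x 1.

Definition mx_derive (F : R -> 'M[R[i]]_n) (x : R) : 'M[R[i]]_n :=
  \matrix_(i, j) (derive1 (re_entry F i j) x +i* derive1 (im_entry F i j) x)%C.

Definition dx (F : R -> R -> 'M[R[i]]_n) (x t : R) : 'M[R[i]]_n :=
  mx_derive (F ^~ t) x.
Definition dt (F : R -> R -> 'M[R[i]]_n) (x t : R) : 'M[R[i]]_n :=
  mx_derive (F x) t.

Definition differentiable_xt (F : R -> R -> 'M[R[i]]_n) : Prop :=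
  forall x t, mx_derivable (F ^~ t) x /\ mx_derivable (F x) t.

Fixpoint Ck (k : nat) (f : R * R -> R) : Prop :=
  if k is k'.+1 then
    [/\ forall p, derivable f p (1, 0), forall p, derivable f p (0, 1),
        Ck k' (fun p => 'D_(1, 0) f p) & Ck k' (fun p => 'D_(0, 1) f p)]
  else continuous f.

Definition smooth (F : R -> R -> 'M[R[i]]_n) : Prop :=
  forall i j k, Ck k (re_entry (fun p : R * R => F p.1 p.2) i j) /\
                Ck k (im_entry (fun p : R * R => F p.1 p.2) i j).

Definition mx_cvg (T : Type) (F : T -> 'M[R[i]]_n) (G : set_system T)
    (L : 'M[R[i]]_n) : Prop :=
  forall i j, (F s i j : R[i]^o) @[s --> G] --> (L i j : R[i]^o).

Definition schwartz_fun (f : R -> R) : Prop :=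
  (forall m x, derivable (derive1n m f) x 1) /\
  (forall k m, exists K : R, forall x, `|x ^+ k * derive1n m f x| <= K).

Definition schwartz (F : R -> 'M[R[i]]_n) : Prop :=
  forall i j, schwartz_fun (re_entry F i j) /\ schwartz_fun (im_entry F i j).

End Derivatives.

Section Flow.
Context {R : realType} {n : nat}.
Implicit Types (a b y v : 'M[R[i]]_n) (u g : R -> R -> 'M[R[i]]_n).

Definition comm y v : 'M[R[i]]_n := y *m v - v *m y.

Definition in_u y : Prop := y ^t* = - y.

Definition in_Ua a y : Prop := in_u y /\ comm a y = 0.

Definition in_Ua_perp a y : Prop :=
  in_u y /\ forall v, in_Ua a v -> \tr (v *m y) = 0.

Definition conj_by b (h : 'M[R[i]]_n) : 'M[R[i]]_n := invmx h *m b *m h.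

Definition is_frame u g : Prop :=
  [/\ smooth g,
      forall x t, g x t \in unitmx,
      forall x t, invmx (g x t) *m dx g x t = u x t
    & forall t, mx_cvg (g ^~ t) -oo%R 1%:M].

Definition flow_solution a b u g : Prop :=
  is_frame u g /\ forall x t, dt u x t = comm a (conj_by b (g x t)).

Definition flow_space a b u : Prop :=
  [/\ forall x t, in_Ua_perp a (u x t),
      smooth u,
      forall t, schwartz (u ^~ t)
    & exists g, flow_solution a b u g].

(* Holds in particular when the diagonal entries of a are distinct, because
   [a, b] = 0.  Without it dressing can leave flow_space: with u = 0,
   a = diag(i, i, -i) and b = diag(ib1, ib2, ib3) with b1 <> b2, dressing by a
   suitable simple element normalizes the new frame at x = -oo by a constant
   that does not commute with b. *)
Definition b_compatible a b : Prop :=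
  is_scalar_mx a \/ forall y, in_Ua a y -> comm b y = 0.

(* Holomorphy on the punctured plane; the value at 0 is irrelevant. *)
Definition mx_holomorphic (f : R[i] -> 'M[R[i]]_n) : Prop :=
  forall l : R[i], l != 0 -> forall i j,
    derivable (fun w : R[i]^o => f w i j : R[i]^o) l 1.

Definition trivialization a b u g (E : R -> R -> R[i] -> 'M[R[i]]_n) : Prop :=
  [/\ forall x t, mx_holomorphic (E x t),
      forall l : R[i], l != 0 -> differentiable_xt (fun x t => E x t l),
      forall (l : R[i]) (x t : R), l != 0 ->
        dx (fun x t => E x t l) x t = E x t l *m (l *: a + u x t),
      forall (l : R[i]) (x t : R), l != 0 ->
        dt (fun x t => E x t l) x t
        = E x t l *m (l^-1 *: conj_by b (g x t))
    & forall l : R[i], l != 0 -> E 0 0 l = 1%:M].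

End Flow.

Section LoopGroups.
Context {R : realType} {n : nat}.
Implicit Types (f : R[i] -> 'M[R[i]]_n).

Definition off_finite (P : R[i] -> Prop) : Prop := finite_set [set l | ~ P l].

Definition rational_map f : Prop :=
  exists (P : 'M[{poly R[i]}]_n) (q : {poly R[i]}), q != 0 /\
    off_finite (fun l => f l = (q.[l])^-1 *: map_mx (fun p => p.[l]) P).

(* A rational map is represented by a function on the affine line whose values
   at finitely many points are irrelevant; two such functions are the same
   element of the group when they agree off a finite set.  The value at
   infinity is read in the chart w = 1 / lambda. *)
Definition Gminus f : Prop :=
  [/\ rational_map f,
      off_finite (fun l => f l \in unitmx),
      mx_cvg (fun w : R[i]^o => f w^-1) 0^' 1%:M
    & off_finite (fun l => (f l^*) ^t* *m f l = 1%:M)].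

Definition hermitian_projection (p : 'M[R[i]]_n) : Prop :=
  p ^t* = p /\ p *m p = p.

Definition simple_element (z : R[i]) (p : 'M[R[i]]_n) (l : R[i]) :
    'M[R[i]]_n :=
  p + ((l - z) / (l - z^*)) *: (1%:M - p).

Definition Gplus f : Prop :=
  [/\ mx_holomorphic f,
      forall l : R[i], l != 0 -> f l \in unitmx
    & forall l : R[i], l != 0 -> (f l^*) ^t* *m f l = 1%:M].

Definition factorization f (E Et ft : R -> R -> R[i] -> 'M[R[i]]_n) : Prop :=
  forall x t,
    [/\ Gplus (Et x t), Gminus (ft x t)
      & off_finite (fun l => f l *m E x t l = Et x t l *m ft x t l)].

Definition dressing (a b : 'M[R[i]]_n) f (u ut : R -> R -> 'M[R[i]]_n) : Prop :=
  exists g E Et ft,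
    [/\ flow_solution a b u g, trivialization a b u g E,
        factorization f E Et ft
      & forall (l : R[i]) (x t : R), l != 0 ->
          mx_derivable (fun s => Et s t l) x /\
          invmx (Et x t l) *m dx (fun x t => Et x t l) x t = l *: a + ut x t].

Definition projection_system (a b : 'M[R[i]]_n) (z : R[i])
    (u g : R -> R -> 'M[R[i]]_n) (p : 'M[R[i]]_n)
    (pt : R -> R -> 'M[R[i]]_n) : Prop :=
  [/\ differentiable_xt pt,
      forall x t, dx pt x t + comm (z *: a + u x t) (pt x t)
        = (z^* - z) *: (comm (pt x t) a *m pt x t),
      forall x t, dt pt x t = (`|z| ^+ 2)^-1 *:
        (let B := conj_by b (g x t) in
         (z - z^*) *: (pt x t *m B *m pt x t)
         - z *: (B *m pt x t) + z^* *: (pt x t *m B)),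
      forall x t, hermitian_projection (pt x t)
    & pt 0 0 = p].

End LoopGroups.

(* Main.v *)
Require Import Defs.
From mathcomp Require Import all_boot all_order all_algebra all_fingroup.
From mathcomp Require Import all_classical all_reals all_analysis complex.
From mathcomp Require Import measurable_realfun.
From mathcomp Require Import ring lra.

Set Implicit Arguments.
Unset Strict Implicit.
Unset Printing Implicit Defensive.

Import Order.TTheory GRing.Theory Num.Theory.
Import numFieldNormedType.Exports.

Local Open Scope classical_set_scope.
Local Open Scope ring_scope.
Local Open Scope sesquilinear_scope.


(** For every nonzero [l] the flow is the zero-curvature condition of the
   connection with [x]-part [l *: a + u] and [t]-part [l^-1 *: B], where
   [B = g^-1 b g]; [lax] is this condition and [wave] is its trivialization, which
   exists, is unique and is unitary on the real axis ([wave_exists],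
   [wave_unique], [wave_unitary]).

   One simple element [g_{z,p}] acts by an explicit formula. The projection [pt]
   onto the image of the range of [p] under the adjoint of [E x t z] solves the
   system of the statement ([image_proj_mder], [projection_systemP]). Up to a
   scalar, [g_{z,pt}] is an affine function of [l], and it intertwines the
   connection of [u] with that of [u + (z - z^* ) [pt, a]] ([dress_lax]). As both
   wave functions are [1] at the origin, this gives the factorization
   [g_{z,p} E = E' g_{z,pt}] ([simple_num_intertwine]).

   The factorization is unique: the quotient of two factorizations is rational,
   holomorphic off [0] and bounded near [0] and infinity along the positive axis,
   hence constant by a Liouville theorem ([factorization_unique]). So dressing is
   single-valued, and it is compatible with products, because
   factorizations compose. It is total because the rational loop group is
   generated by simple elements with projections of rank at most one
   ([Gminus_ind]), and a property of loops that is stable under products need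
   only be checked on generators.

   It remains to see that one simple element of rank at most one preserves the
   analytic conditions on [u]. At fixed time the diagonal entries of [pt] satisfy,
   up to a rapidly decreasing error, the replicator equation whose fitnesses are
   the eigenvalues of [a] up to a factor. Hence the product of two diagonal
   entries that belong to different eigenvalues decays rapidly on both sides
   ([replicator_rapid]). By rank one it is the square modulus of the entry joining
   them, so the commutator [[pt, a]] is rapidly decreasing ([comm_proj_rapid]), and
   the equation of [pt] extends this to all derivatives ([dress_schwartz]).
   Consequently [pt] has a limit as [x] tends to minus infinity: a projection
   commuting with [a], hence, under the assumption on [b], with [b]. By dominated
   convergence it does not depend on [t]. Normalizing the value of [g_{z,pt}] at
   [0] by this constant gives the new frame ([dress_frame]).

   If [a] is scalar, all commutators with [a] vanish and dressing is the
   identity. *)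

(** * Derivatives of real functions *)

Section RealDerivatives.
Context {R : realType}.
Implicit Types (f g : R -> R) (x a b : R).

Lemma rder_eq f x a b : is_derive x 1 f a -> a = b -> is_derive x 1 f b.
Proof. by move=> ? <-. Qed.

Lemma rder_cst c x : is_derive x (1 : R) (fun=> c : R) 0.
Proof. exact: is_derive_cst. Qed.

Lemma rder_id x : is_derive x (1 : R) (fun s => s : R) 1.
Proof. exact: is_derive_id. Qed.

Lemma rderD f g x a b : is_derive x 1 f a -> is_derive x 1 g b ->
  is_derive x 1 (fun s => f s + g s) (a + b).
Proof. by move=> hf hg; exact: (is_deriveD hf hg). Qed.

Lemma rderN f x a : is_derive x 1 f a -> is_derive x 1 (fun s => - f s) (- a).
Proof. by move=> hf; exact: (is_deriveN hf). Qed.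

Lemma rderB f g x a b : is_derive x 1 f a -> is_derive x 1 g b ->
  is_derive x 1 (fun s => f s - g s) (a - b).
Proof. by move=> hf hg; exact: (is_deriveB hf hg). Qed.

Lemma rderM f g x a b : is_derive x 1 f a -> is_derive x 1 g b ->
  is_derive x 1 (fun s => f s * g s) (a * g x + f x * b).
Proof.
move=> hf hg; apply: rder_eq (is_deriveM hf hg) _.
by rewrite /GRing.scale /=; ring.
Qed.

Lemma rderV f x a : f x != 0 -> is_derive x 1 f a ->
  is_derive x 1 (fun s => (f s)^-1) (- (f x ^- 2 * a)).
Proof.
by move=> f0 hf; apply: rder_eq (is_deriveV f0 hf) _; rewrite /GRing.scale /= mulNr.
Qed.

Lemma rder_comp f g x a b : is_derive (g x) 1 f a -> is_derive x 1 g b ->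
  is_derive x 1 (fun s => f (g s)) (a * b).
Proof. by move=> hf hg; exact: (is_derive1_comp hf hg). Qed.

Lemma rder_reflect f x a : is_derive (- x) 1 f a ->
  is_derive x 1 (fun s => f (- s)) (- a).
Proof.
move=> hf; have h := @rder_comp f (fun s => - s) x a (- 1) hf (rderN (rder_id x)).
by apply: rder_eq h _; rewrite mulrN1.
Qed.

Lemma rder_cts f x a : is_derive x 1 f a -> {for x, continuous f}.
Proof.
by case=> h _; apply: differentiable_continuous; exact/derivable1_diffP.
Qed.

Lemma rder_expM (k x : R) :
  is_derive x 1 (fun s => expR (k * s)) (k * expR (k * x)).
Proof.
have h := @rder_comp expR (fun s => k * s) x _ _ (is_derive_expR (k * x))
  (rderM (rder_cst k x) (rder_id x)).
by apply: rder_eq h _; rewrite mul0r add0r mulr1 mulrC.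
Qed.

Lemma cts_within f (A : set R) : (forall x, {for x, continuous f}) ->
  {within A, continuous f}.
Proof. by move=> h; apply: continuous_subspaceT. Qed.

Lemma rder_ndecr f f' (a b : R) : a <= b ->
  (forall x, a <= x <= b -> is_derive x 1 f (f' x)) ->
  (forall x, a <= x <= b -> 0 <= f' x) -> f a <= f b.
Proof.
move=> ab df f0.
have [||c cab] := @MVT_segment R f f' a b ab.
- move=> x xab; apply: df; move: xab; rewrite in_itv /= => /andP[? ?].
  by apply/andP; split; exact: ltW.
- apply/derivable_within_continuous => x; rewrite in_itv /= => xab.
  by have [] := df _ xab.
move=> e; rewrite -subr_ge0 e mulr_ge0 ?subr_ge0// f0//.
Qed.

Lemma rder_dominated f f' h h' (a b : R) : a <= b ->
  (forall x, a <= x <= b -> is_derive x 1 f (f' x)) ->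
  (forall x, a <= x <= b -> is_derive x 1 h (h' x)) ->
  (forall x, a <= x <= b -> `|f' x| <= h' x) -> `|f b - f a| <= h b - h a.
Proof.
move=> ab df dh fh.
have p : h a - f a <= h b - f b.
  apply: (@rder_ndecr (fun s => h s - f s) (fun s => h' s - f' s)) => // x xab.
    by apply: rderB; [exact: dh|exact: df].
  by rewrite subr_ge0 (le_trans (ler_norm _) (fh _ xab)).
have q : h a + f a <= h b + f b.
  apply: (@rder_ndecr (fun s => h s + f s) (fun s => h' s + f' s)) => // x xab.
    by apply: rderD; [exact: dh|exact: df].
  by rewrite -[f' x]opprK subr_ge0 (le_trans (ler_norm _))// normrN fh.
by rewrite ler_norml; apply/andP; split; lra.
Qed.

Lemma cts_bounded f (L : R) : (forall x, {for x, continuous f}) ->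
  exists2 K, 0 <= K & forall x, `|x| <= L -> `|f x| <= K.
Proof.
move=> cf; have [L0|L0] := ltP L 0.
  by exists 0 => // x xL; have := le_lt_trans xL L0; rewrite normr_lt0.
have LL : - L <= L by rewrite lerNl -subr_ge0 opprK addr_ge0.
have cn x : {for x, continuous (fun x => `|f x|)} by exact: (cvg_norm (cf x)).
have [c _ hc] := @EVT_max R (fun x => `|f x|) (- L) L LL (cts_within cn).
by exists `|f c| => // x; rewrite ler_norml => xL; apply: hc; rewrite in_itv.
Qed.

End RealDerivatives.

(** * Derivatives and norms of complex matrices *)

Section ComplexCalculus.
Context {R : realType}.
Local Notation C := R[i].

Definition cder (f : R -> C) (x : R) (d : C) : Prop :=
  is_derive x 1 (fun s => complex.Re (f s)) (complex.Re d) /\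
  is_derive x 1 (fun s => complex.Im (f s)) (complex.Im d).

Lemma ReD (z w : C) : complex.Re (z + w) = complex.Re z + complex.Re w.
Proof. by case: z w => ? ? []. Qed.

Lemma ImD (z w : C) : complex.Im (z + w) = complex.Im z + complex.Im w.
Proof. by case: z w => ? ? []. Qed.

Lemma ReN (z : C) : complex.Re (- z) = - complex.Re z.
Proof. by case: z. Qed.

Lemma ImN (z : C) : complex.Im (- z) = - complex.Im z.
Proof. by case: z. Qed.

Lemma ReM (z w : C) : complex.Re (z * w) =
  complex.Re z * complex.Re w - complex.Im z * complex.Im w.
Proof. by case: z w => ? ? []. Qed.

Lemma ImM (z w : C) : complex.Im (z * w) =
  complex.Re z * complex.Im w + complex.Im z * complex.Re w.
Proof. by case: z w => ? ? []. Qed.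

Lemma Re_conj (z : C) : complex.Re (z^*) = complex.Re z.
Proof. by case: z. Qed.

Lemma Im_conj (z : C) : complex.Im (z^*) = - complex.Im z.
Proof. by case: z. Qed.

Lemma cplxP (z w : C) :
  complex.Re z = complex.Re w -> complex.Im z = complex.Im w -> z = w.
Proof. by case: z w => ? ? [? ?] /= -> ->. Qed.

Lemma cder_eq f x d d' : cder f x d -> d = d' -> cder f x d'.
Proof. by move=> ? <-. Qed.

Lemma cder_uniq f x d d' : cder f x d -> cder f x d' -> d = d'.
Proof.
move=> [[_ r1] [_ i1]] [[_ r2] [_ i2]]; apply: cplxP.
  by rewrite -r1 -r2.
by rewrite -i1 -i2.
Qed.

Lemma cder_cst (c : C) x : cder (fun=> c) x 0.
Proof. by split; exact: is_derive_cst. Qed.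

Lemma cderD f g x df dg : cder f x df -> cder g x dg ->
  cder (fun s => f s + g s) x (df + dg).
Proof.
move=> [rf jf] [rg jg]; split.
  by rewrite ReD; under eq_fun do rewrite ReD; exact: rderD.
by rewrite ImD; under eq_fun do rewrite ImD; exact: rderD.
Qed.

Lemma cderM f g x df dg : cder f x df -> cder g x dg ->
  cder (fun s => f s * g s) x (df * g x + f x * dg).
Proof.
move=> [rf jf] [rg jg]; split.
  under eq_fun do rewrite ReM.
  by apply: rder_eq (rderB (rderM rf rg) (rderM jf jg)) _; rewrite !(ReD, ReM); ring.
under eq_fun do rewrite ImM.
by apply: rder_eq (rderD (rderM rf jg) (rderM jf rg)) _; rewrite !(ImD, ImM); ring.
Qed.

Lemma cder_conj f x df : cder f x df -> cder (fun s => (f s)^*) x (df^*).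
Proof.
move=> [rf jf]; split.
  by rewrite Re_conj; under eq_fun do rewrite Re_conj.
by rewrite Im_conj; under eq_fun do rewrite Im_conj; exact: rderN.
Qed.

Lemma cder_sum (I : Type) (r : seq I) (P : pred I) (f : I -> R -> C) x df :
  (forall i, P i -> cder (f i) x (df i)) ->
  cder (fun s => \sum_(i <- r | P i) f i s) x (\sum_(i <- r | P i) df i).
Proof.
move=> fdf; elim: r => [|i r ih].
  rewrite big_nil; under eq_fun do rewrite big_nil; exact: cder_cst.
rewrite big_cons; under eq_fun do rewrite big_cons.
by case: ifPn => // Pi; apply: cderD => //; exact: fdf.
Qed.

Lemma cder_prod (I : Type) (r : seq I) (f : I -> R -> C) x :
  (forall i, exists d, cder (f i) x d) ->
  exists d, cder (fun s => \prod_(i <- r) f i s) x d.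
Proof.
move=> fdf; elim: r => [|i r [d ih]].
  exists 0; under eq_fun do rewrite big_nil; exact: cder_cst.
have [e fe] := fdf i.
eexists; under eq_fun do rewrite big_cons; exact: cderM fe ih.
Qed.

Lemma cder_inv f x df : f x != 0 -> cder f x df ->
  exists d, cder (fun s => (f s)^-1) x d.
Proof.
move=> fx0 [rf jf].
pose N s := complex.Re (f s) ^+ 2 + complex.Im (f s) ^+ 2.
have N0 : N x != 0.
  apply: contra fx0; rewrite /N paddr_eq0 ?sqr_ge0// !sqrf_eq0.
  by move=> /andP[/eqP a /eqP b]; apply/eqP; exact: cplxP.
have [dN NdN] : exists dN, is_derive x 1 N dN.
  by eexists; apply: rderD; apply: rderM.
have ReE s : complex.Re ((f s)^-1) = complex.Re (f s) * (N s)^-1.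
  by rewrite /N; case: (f s).
have ImE s : complex.Im ((f s)^-1) = - (complex.Im (f s) * (N s)^-1).
  by rewrite /N; case: (f s).
have NV := rderV N0 NdN.
eexists (_ +i* _)%C; split.
  by under eq_fun do rewrite ReE; exact: rderM.
by under eq_fun do rewrite ImE; apply: rderN; exact: rderM.
Qed.

Lemma cder_cts f x df : cder f x df ->
  {for x, continuous (fun s => complex.Re (f s))} /\
  {for x, continuous (fun s => complex.Im (f s))}.
Proof.
by move=> [rf jf]; split; [exact: rder_cts rf|exact: rder_cts jf].
Qed.

(** A norm on the complex numbers with values in [R]; unlike the modulus it is
   linear in the real and imaginary parts, which are what gets differentiated
   and integrated. *)
Definition l1 (z : C) : R := `|complex.Re z| + `|complex.Im z|.

Lemma l1_ge0 z : 0 <= l1 z. Proof. by rewrite addr_ge0. Qed.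
Hint Extern 0 (is_true (0 <= l1 _)) => exact: l1_ge0 : core.

Lemma l10 : l1 0 = 0. Proof. by rewrite /l1 !normr0 addr0. Qed.

Lemma l1_eq0 z : l1 z = 0 -> z = 0.
Proof.
move=> /eqP; rewrite paddr_eq0// !normr_eq0 => /andP[/eqP a /eqP b].
exact: cplxP.
Qed.

Lemma l1D z w : l1 (z + w) <= l1 z + l1 w.
Proof.
rewrite /l1 ReD ImD.
have := ler_normD (complex.Re z) (complex.Re w).
have := ler_normD (complex.Im z) (complex.Im w); lra.
Qed.

Lemma l1N z : l1 (- z) = l1 z.
Proof. by rewrite /l1 ReN ImN !normrN. Qed.

Lemma l1B z w : l1 (z - w) = l1 (w - z).
Proof. by rewrite -l1N opprB. Qed.

Lemma l1M z w : l1 (z * w) <= l1 z * l1 w.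
Proof.
rewrite /l1 ReM ImM.
have := ler_normB (complex.Re z * complex.Re w) (complex.Im z * complex.Im w).
have := ler_normD (complex.Re z * complex.Im w) (complex.Im z * complex.Re w).
rewrite !normrM; nra.
Qed.

Lemma l1J z : l1 (z^*) = l1 z.
Proof. by rewrite /l1 Re_conj Im_conj normrN. Qed.

Lemma l1_real (r : R) : l1 (r%:C)%C = `|r|.
Proof. by rewrite /l1 /= normr0 addr0. Qed.

Lemma l1_sum (I : Type) (r : seq I) (P : pred I) (f : I -> C) :
  l1 (\sum_(i <- r | P i) f i) <= \sum_(i <- r | P i) l1 (f i).
Proof.
elim/big_ind2 : _ => [|a b c d ac bd|//]; first by rewrite l10.
by apply: le_trans (l1D _ _) _; exact: lerD.
Qed.

Lemma Re_le_l1 z : `|complex.Re z| <= l1 z. Proof. by rewrite lerDl. Qed.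
Lemma Im_le_l1 z : `|complex.Im z| <= l1 z. Proof. by rewrite lerDr. Qed.

Lemma norm_le_l1 (z : C) : `|z| <= (l1 z)%:C%C.
Proof.
rewrite {1}(complexE z); apply: le_trans (ler_normD _ _) _.
rewrite /l1 rmorphD /= lerD//.
  by rewrite normc_def /= expr0n /= addr0 sqrtr_sqr.
rewrite normrM normc_def /= !expr0n /= expr1n add0r sqrtr1 mul1r.
by rewrite normc_def /= expr0n /= addr0 sqrtr_sqr.
Qed.

Lemma l1_le_norm (z : C) (r : R) : `|z| <= r%:C%C -> l1 z <= r + r.
Proof.
rewrite normc_def lecR => zr; rewrite lerD//; apply: le_trans zr.
  by rewrite -sqrtr_sqr ler_wsqrtr// lerDl sqr_ge0.
by rewrite -sqrtr_sqr ler_wsqrtr// lerDr sqr_ge0.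
Qed.

End ComplexCalculus.

#[global] Hint Extern 0 (is_true (0 <= l1 _)) => exact: l1_ge0 : core.

Section MatrixCalculus.
Context {R : realType}.
Local Notation C := R[i].

(** The relational form of [mx_derive], for rectangular matrices as well. *)
Definition mder (m n : nat) (F : R -> 'M[C]_(m, n)) (x : R) (D : 'M[C]_(m, n)) :=
  forall i j, cder (fun s => F s i j) x (D i j).

Lemma mder_eq m n (F : R -> 'M[C]_(m, n)) x D D' :
  mder F x D -> D = D' -> mder F x D'.
Proof. by move=> ? <-. Qed.

Lemma mder_ext m n (F G : R -> 'M[C]_(m, n)) x D :
  (forall s, F s = G s) -> mder F x D -> mder G x D.
Proof. by move=> /funext ->. Qed.

Lemma mder_uniq m n (F : R -> 'M[C]_(m, n)) x D D' :
  mder F x D -> mder F x D' -> D = D'.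
Proof. by move=> h h'; apply/matrixP => i j; exact: cder_uniq (h i j) (h' i j). Qed.

Lemma mder_cst m n (A : 'M[C]_(m, n)) x : mder (fun=> A) x 0.
Proof. by move=> i j; rewrite mxE; exact: cder_cst. Qed.

Lemma mderD m n (F G : R -> 'M[C]_(m, n)) x DF DG : mder F x DF -> mder G x DG ->
  mder (fun s => F s + G s) x (DF + DG).
Proof.
move=> hF hG i j; rewrite mxE; under eq_fun do rewrite mxE; exact: cderD.
Qed.

Lemma mderZ m n (c : C) (F : R -> 'M[C]_(m, n)) x DF : mder F x DF ->
  mder (fun s => c *: F s) x (c *: DF).
Proof.
move=> hF i j; rewrite mxE; under eq_fun do rewrite mxE.
by apply: cder_eq; [apply: cderM (hF i j); exact: cder_cst | rewrite mul0r add0r].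
Qed.

Lemma mderN m n (F : R -> 'M[C]_(m, n)) x DF : mder F x DF ->
  mder (fun s => - F s) x (- DF).
Proof.
move=> /(mderZ (-1)); rewrite scaleN1r; under eq_fun do rewrite scaleN1r.
by [].
Qed.

Lemma mderB m n (F G : R -> 'M[C]_(m, n)) x DF DG : mder F x DF -> mder G x DG ->
  mder (fun s => F s - G s) x (DF - DG).
Proof. by move=> ? ?; apply: mderD => //; exact: mderN. Qed.

Lemma mderM m n k (F : R -> 'M[C]_(m, n)) (G : R -> 'M[C]_(n, k)) x DF DG :
  mder F x DF -> mder G x DG ->
  mder (fun s => F s *m G s) x (DF *m G x + F x *m DG).
Proof.
move=> hF hG i j; rewrite !mxE -big_split /=; under eq_fun do rewrite mxE.
by apply: cder_sum => l _; exact: cderM.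
Qed.

Lemma mderMl m n k (A : 'M[C]_(m, n)) (G : R -> 'M[C]_(n, k)) x DG :
  mder G x DG -> mder (fun s => A *m G s) x (A *m DG).
Proof.
move=> hG; apply: mder_eq; first exact: mderM (mder_cst A x) hG.
by rewrite mul0mx add0r.
Qed.

Lemma mderMr m n k (F : R -> 'M[C]_(m, n)) (A : 'M[C]_(n, k)) x DF :
  mder F x DF -> mder (fun s => F s *m A) x (DF *m A).
Proof.
move=> hF; apply: mder_eq; first exact: mderM hF (mder_cst A x).
by rewrite mulmx0 addr0.
Qed.

Lemma mder_adj m n (F : R -> 'M[C]_(m, n)) x DF :
  mder F x DF -> mder (fun s => (F s) ^t*) x (DF ^t*).
Proof.
move=> hF i j; rewrite !mxE; under eq_fun do rewrite !mxE; exact: cder_conj.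
Qed.

Lemma mderE n (F : R -> 'M[C]_n) x D :
  mder F x D <-> mx_derivable F x /\ mx_derive F x = D.
Proof.
split=> [h|[h <-] i j].
  split.
    by move=> i j; have [[? _] [? _]] := h i j.
  apply/matrixP => i j; rewrite mxE; have [[_ a] [_ b]] := h i j.
  by apply: cplxP => /=; rewrite derive1E.
have [a b] := h i j; rewrite mxE; split => /=; rewrite derive1E;
  exact: derivableP.
Qed.

Lemma mderW n (F : R -> 'M[C]_n) x : mx_derivable F x ->
  mder F x (mx_derive F x).
Proof. by move=> h; apply/mderE. Qed.

(** Existence of the derivative of an inverse comes from Cramer's rule; its
   value is then forced by the product rule. *)
Lemma mder_inv n (F : R -> 'M[C]_n) x D : (forall s, F s \in unitmx) ->
  mder F x D -> mder (fun s => invmx (F s)) x (- (invmx (F x) *m D *m invmx (F x))).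
Proof.
move=> uF hF.
have dF i j : exists d, cder (fun s => F s i j) x d by exists (D i j).
have ddet k (G : R -> 'M[C]_k) : (forall i j, exists d, cder (fun s => G s i j) x d) ->
    exists d, cder (fun s => \det (G s)) x d.
  move=> dG; have h (s : {perm 'I_k}) : exists d,
      cder (fun r => (-1) ^+ s * \prod_i G r i (s i)) x d.
    have [d hd] := @cder_prod _ _ (index_enum 'I_k) (fun i r => G r i (s i)) x
      (fun i => dG i (s i)).
    by eexists; apply: cderM hd; exact: cder_cst.
  have [d hd] := choice h.
  by eexists; rewrite /determinant; apply: cder_sum => s _; exact: hd.
have [d hd] := ddet _ _ dF.
have dN0 : \det (F x) != 0 by rewrite -unitfE -unitmxE.
have [e he] := cder_inv dN0 hd.
have hI : exists E, mder (fun s => invmx (F s)) x E.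
  have h i j : exists d, cder (fun s => invmx (F s) i j) x d.
    have [c hc] : exists d, cder (fun s => (\adj (F s)) i j) x d.
      have [|d' hd'] := ddet _ (fun s => row' j (col' i (F s))).
        move=> i' j' /=; exists (D (lift j i') (lift i j')).
        by under eq_fun do rewrite !mxE; exact: hF.
      eexists; under eq_fun do rewrite mxE /cofactor.
      by apply: cderM hd'; exact: cder_cst.
    eexists; rewrite (_ : (fun s => _) =
      fun s => (\det (F s))^-1 * (\adj (F s)) i j); first exact: cderM he hc.
    by apply/funext => s; rewrite /invmx uF !mxE.
  have [E hE] := choice (fun ij : 'I_n * 'I_n => h ij.1 ij.2).
  by exists (\matrix_(i, j) E (i, j)) => i j; rewrite mxE; exact: (hE (i, j)).
have [E hE] := hI.
have := mderM hF hE; under eq_fun do rewrite mulmxV//.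
move=> /(mder_uniq (mder_cst _ _)) /esym /eqP.
rewrite addrC addr_eq0 => /eqP /(congr1 (mulmx (invmx (F x)))).
by rewrite mulmxA mulVmx// mul1mx mulmxN mulmxA => <-.
Qed.

(** A submultiplicative norm with values in [R]. *)
Definition nm (m n : nat) (A : 'M[C]_(m, n)) : R := \sum_i \sum_j l1 (A i j).

Lemma nm_ge0 m n (A : 'M[C]_(m, n)) : 0 <= nm A.
Proof. by apply: sumr_ge0 => i _; apply: sumr_ge0. Qed.
Hint Extern 0 (is_true (0 <= nm _)) => exact: nm_ge0 : core.

Lemma nm0 m n : nm (0 : 'M[C]_(m, n)) = 0.
Proof. by rewrite /nm big1// => i _; rewrite big1// => j _; rewrite mxE l10. Qed.

Lemma l1_le_nm m n (A : 'M[C]_(m, n)) i j : l1 (A i j) <= nm A.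
Proof.
rewrite /nm (bigD1 i)//= (bigD1 j)//= -addrA lerDl addr_ge0//.
  by apply: sumr_ge0.
by apply: sumr_ge0 => ? _; apply: sumr_ge0.
Qed.

Lemma nm_le m n (A : 'M[C]_(m, n)) c : (forall i j, l1 (A i j) <= c) ->
  nm A <= (m * n)%:R * c.
Proof.
move=> h; apply: (@le_trans _ _ (\sum_(i < m) \sum_(j < n) c)).
  by apply: ler_sum => i _; exact: ler_sum.
rewrite sumr_const sumr_const !card_ord -mulrnA -[leLHS]mulr_natl.
by rewrite mulnC.
Qed.

Lemma nm_eq0 m n (A : 'M[C]_(m, n)) : nm A <= 0 -> A = 0.
Proof.
move=> h; apply/matrixP => i j; rewrite mxE; apply: l1_eq0; apply/eqP.
by rewrite eq_le l1_ge0 andbT (le_trans (l1_le_nm _ _ _)).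
Qed.

Lemma nmD m n (A B : 'M[C]_(m, n)) : nm (A + B) <= nm A + nm B.
Proof.
rewrite /nm -big_split; apply: ler_sum => i _ /=; rewrite -big_split.
by apply: ler_sum => j _ /=; rewrite mxE l1D.
Qed.

Lemma nmN m n (A : 'M[C]_(m, n)) : nm (- A) = nm A.
Proof. by apply: eq_bigr => i _; apply: eq_bigr => j _; rewrite mxE l1N. Qed.

Lemma nmB m n (A B : 'M[C]_(m, n)) : nm (A - B) <= nm A + nm B.
Proof. by rewrite -(nmN B) nmD. Qed.

Lemma nmZ m n c (A : 'M[C]_(m, n)) : nm (c *: A) <= l1 c * nm A.
Proof.
rewrite /nm mulr_sumr; apply: ler_sum => i _; rewrite mulr_sumr.
by apply: ler_sum => j _; rewrite mxE l1M.
Qed.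

Lemma nm_adj m n (A : 'M[C]_(m, n)) : nm (A ^t*) = nm A.
Proof.
rewrite /nm exchange_big; apply: eq_bigr => i _; apply: eq_bigr => j _.
by rewrite !mxE l1J.
Qed.

Lemma nmM m n k (A : 'M[C]_(m, n)) (B : 'M[C]_(n, k)) :
  nm (A *m B) <= nm A * nm B.
Proof.
rewrite /nm mulr_suml; apply: ler_sum => i _.
apply: (@le_trans _ _ (\sum_j \sum_l l1 (A i l) * l1 (B l j))).
  apply: ler_sum => j _; rewrite mxE; apply: le_trans (l1_sum _ _ _) _.
  by apply: ler_sum => l _; exact: l1M.
rewrite exchange_big mulr_suml; apply: ler_sum => l _.
rewrite -mulr_sumr ler_wpM2l// [leRHS](bigD1 l)//= lerDl.
by apply: sumr_ge0 => ? _; apply: sumr_ge0.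
Qed.

Lemma nm_sub_le m n (A B : 'M[C]_(m, n)) : nm A <= nm B + nm (A - B).
Proof. by rewrite -{1}(subrK B A) addrC nmD. Qed.

End MatrixCalculus.

#[global] Hint Extern 0 (is_true (0 <= nm _)) => exact: nm_ge0 : core.

(** * Antiderivatives *)

Section Antiderivative.
Context {R : realType}.

(** An integral over [[a, x]] is differentiable in [x] only to the right of [a].
   Two base points give the same value once both are corrected to vanish at [0],
   so the base point can be chosen to the left of [x]. *)
Lemma antiderivative (f : R -> R) : (forall x, {for x, continuous f}) ->
  exists2 F : R -> R, F 0 = 0 & forall x : R, is_derive x 1 F (f x).
Proof.
move=> cf.
pose G a x := (\int[lebesgue_measure]_(t in `[a, x]) f t)%R.
have dG (a x : R) : a < x -> is_derive x 1 (G a) (f x).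
  move=> ax; have x1 : x < x + 1 by rewrite ltrDl.
  have fi : lebesgue_measure.-integrable `[a, x + 1] (EFin \o f).
    apply: continuous_compact_integrable; first exact: segment_compact.
    exact: cts_within.
  have [h1 h2] := @continuous_FTC1_closed R f a x (x + 1) x1 fi ax (cf x).
  by apply: DeriveDef; [exact: h1|rewrite -derive1E; exact: h2].
pose P a x := G a x - G a 0.
have dP (a x : R) : a < x -> is_derive x 1 (P a) (f x).
  by move=> ax; apply: rder_eq (rderB (dG _ _ ax) (rder_cst _ _)) _; rewrite subr0.
have P0 a : P a 0 = 0 by rewrite /P subrr.
have D0 a b y z : y <= z -> a < y -> b < y -> P a z - P b z = P a y - P b y.
  move=> yz ay yb; apply/eqP; rewrite -subr_eq0 -normr_le0.
  rewrite -[leRHS](subrr 0).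
  apply: (@rder_dominated R (fun s => P a s - P b s) (fun s => f s - f s)
    (fun=> 0) (fun=> 0) y z yz) => s /andP[ys _].
  - by apply: rderB; apply: dP; exact: lt_le_trans ys.
  - by rewrite subrr normr0.
have PE a b x : a < 0 -> b < 0 -> a < x -> b < x -> P a x = P b x.
  move=> a0 b0 ax bx; apply/eqP; rewrite -subr_eq0; apply/eqP.
  have [x0|/ltW x0] := leP x 0.
    by have := D0 a b x 0 x0 ax bx; rewrite !P0 subrr.
  by have := D0 a b 0 x x0 a0 b0; rewrite !P0 subrr.
exists (fun x => P (- `|x| - 1) x) => [|x0]; first by rewrite P0.
have a0 : - `|x0| - 2 < x0 by have := ler_norm (- x0); rewrite normrN; lra.
apply: (@near_eq_is_derive R R R (P (- `|x0| - 2))); last exact: dP.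
near=> x; have : `|x - x0| < 1.
  by near: x; apply/nbhs_ballP; exists 1 => //= y; rewrite /ball /= distrC.
move=> xx0; have n0 := normr_ge0 x; have n1 := normr_ge0 x0.
have := ler_norm (- x); rewrite normrN => nx.
have := ler_norm (- x0); rewrite normrN => nx0.
move: xx0; rewrite ltr_norml => /andP[? ?].
by apply: PE; lra.
Unshelve. all: by end_near. Qed.

Lemma mx_antiderivative (m n : nat) (D : R -> 'M[R[i]]_(m, n)) :
  (forall x i j, {for x, continuous (fun s => complex.Re (D s i j))} /\
                 {for x, continuous (fun s => complex.Im (D s i j))}) ->
  exists2 F : R -> 'M[R[i]]_(m, n), F 0 = 0 & forall x, mder F x (D x).
Proof.
move=> cD.
have h (ij : 'I_m * 'I_n) : exists F : R -> R[i],
    F 0 = 0 /\ forall x, cder F x (D x ij.1 ij.2).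
  have [A A0 dA] := antiderivative (fun x => (cD x ij.1 ij.2).1).
  have [B B0 dB] := antiderivative (fun x => (cD x ij.1 ij.2).2).
  exists (fun x => (A x +i* B x)%C); split; first by rewrite A0 B0.
  by move=> x; exact: conj (dA x) (dB x).
have [F hF] := choice h.
exists (fun x => \matrix_(i, j) F (i, j) x).
  by apply/matrixP => i j; rewrite !mxE; have [] := hF (i, j).
move=> x i j; under eq_fun do rewrite mxE; have [_] := hF (i, j); exact.
Qed.

End Antiderivative.

(** * Growth estimates for linear differential equations *)

Section Gronwall.
Context {R : realType}.

Lemma rder_growth (f f' : R -> R) (L k c : R) : 0 < k -> 0 <= c ->
  (forall s : R, is_derive s 1 f (f' s)) ->
  (forall s, `|s| <= L -> `|f' s| <= c * expR (k * `|s|)) ->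
  forall x, `|x| <= L -> `|f x - f 0| <= c / k * expR (k * `|x|).
Proof.
move=> k0 c0.
suff pos (g g' : R -> R) : (forall s : R, is_derive s 1 g (g' s)) ->
    (forall s, `|s| <= L -> `|g' s| <= c * expR (k * `|s|)) ->
    forall x, 0 <= x -> `|x| <= L -> `|g x - g 0| <= c / k * expR (k * `|x|).
  move=> df bf x xL; have [x0|/ltW x0] := leP 0 x; first exact: (pos f f').
  have := pos (fun s => f (- s)) (fun s => - f' (- s)).
  move=> /(_ (fun s => rder_reflect (df (- s)))) h.
  have := h _ (- x); rewrite !opprK oppr0 normrN; apply => //.
    by move=> s sL; rewrite normrN -[`|s|]normrN; apply: bf; rewrite normrN.
  by rewrite oppr_ge0.
move=> dg bg x x0 xL.
have h : `|g x - g 0| <= c / k * expR (k * x) - c / k * expR (k * 0).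
  apply: (@rder_dominated R g g' (fun s => c / k * expR (k * s))
    (fun s => c * expR (k * s)) 0 x x0) => // s /andP[s0 sx].
    apply: rder_eq (rderM (rder_cst _ _) (rder_expM _ _)) _.
    by rewrite mul0r add0r mulrA divfK// gt_eqF.
  have := bg s; rewrite (ger0_norm s0); apply.
  by apply: le_trans sx _; move: xL; rewrite ger0_norm.
rewrite (ger0_norm x0) (le_trans h)// lerBlDr lerDl.
by rewrite mulr_ge0 ?expR_ge0// divr_ge0// ltW.
Qed.

Lemma mder_growth (m n : nat) (F D : R -> 'M[R[i]]_(m, n)) (L k c : R) :
  0 < k -> 0 <= c -> (forall s, mder F s (D s)) ->
  (forall s, `|s| <= L -> nm (D s) <= c * expR (k * `|s|)) ->
  forall x, `|x| <= L ->
    nm (F x - F 0) <= (2 * (m * n)%:R) * (c / k) * expR (k * `|x|).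
Proof.
move=> k0 c0 dF bD x xL; rewrite (mulrC 2) -!mulrA; apply: nm_le => i j.
rewrite !mxE mulr_natl mulr2n.
have bl s : `|s| <= L -> l1 (D s i j) <= c * expR (k * `|s|).
  by move=> sL; apply: le_trans (bD s sL); exact: l1_le_nm.
rewrite /l1 ReD ReN ImD ImN lerD// mulrA.
  apply: (@rder_growth (fun s => complex.Re (F s i j))
    (fun s => complex.Re (D s i j)) L) => //.
    by move=> s; have [] := dF s i j.
  by move=> s /bl; apply: le_trans; exact: Re_le_l1.
apply: (@rder_growth (fun s => complex.Im (F s i j))
  (fun s => complex.Im (D s i j)) L) => //.
  by move=> s; have [] := dF s i j.
by move=> s /bl; apply: le_trans; exact: Im_le_l1.
Qed.

Definition mcts (m n : nat) (F : R -> 'M[R[i]]_(m, n)) :=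
  forall x i j, {for x, continuous (fun s => complex.Re (F s i j))} /\
                {for x, continuous (fun s => complex.Im (F s i j))}.

Lemma mder_cts m n (F D : R -> 'M[R[i]]_(m, n)) :
  (forall s, mder F s (D s)) -> mcts F.
Proof. by move=> dF x i j; exact: cder_cts (dF x i j). Qed.

Lemma sum_cts (I : Type) (r : seq I) (f : I -> R -> R) x :
  (forall i, {for x, continuous (f i)}) ->
  {for x, continuous (fun s => \sum_(i <- r) f i s)}.
Proof.
move=> cf; elim: r => [|i r ih].
  rewrite (_ : (fun s => _) = cst 0); first exact: cst_continuous.
  by apply/funext => s; rewrite big_nil.
rewrite (_ : (fun s => _) = fun s => f i s + \sum_(i <- r) f i s).
  by apply: continuousD => //; exact: cf.
by apply/funext => s; rewrite big_cons.
Qed.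

Lemma nm_cts m n (F : R -> 'M[R[i]]_(m, n)) : mcts F ->
  forall x, {for x, continuous (fun s => nm (F s))}.
Proof.
move=> cF x; apply: sum_cts => i; apply: sum_cts => j.
have [cr ci] := cF x i j; apply: continuousD.
  exact: (cvg_norm cr).
exact: (cvg_norm ci).
Qed.

Lemma mctsM m n k (F : R -> 'M[R[i]]_(m, n)) (G : R -> 'M[R[i]]_(n, k)) :
  mcts F -> mcts G -> mcts (fun s => F s *m G s).
Proof.
move=> cF cG x i j; split.
  rewrite (_ : (fun s => _) = fun s => \sum_l
     (complex.Re (F s i l) * complex.Re (G s l j)
      - complex.Im (F s i l) * complex.Im (G s l j))).
    apply: sum_cts => l; have [a b] := cF x i l; have [c d] := cG x l j.
    by apply: continuousB; exact: continuousM.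
  apply/funext => s; rewrite mxE.
  by elim/big_rec2 : _ => // l a b _ <-; rewrite ReD ReM.
rewrite (_ : (fun s => _) = fun s => \sum_l
   (complex.Re (F s i l) * complex.Im (G s l j)
    + complex.Im (F s i l) * complex.Re (G s l j))).
  apply: sum_cts => l; have [a b] := cF x i l; have [c d] := cG x l j.
  by apply: continuousD; exact: continuousM.
apply/funext => s; rewrite mxE.
by elim/big_rec2 : _ => // l a b _ <-; rewrite ImD ImM.
Qed.

Lemma mcts_bounded m n (F : R -> 'M[R[i]]_(m, n)) L : mcts F ->
  exists2 c, 0 <= c & forall x, `|x| <= L -> nm (F x) <= c.
Proof.
move=> /nm_cts /cts_bounded - /(_ L)[c c0 h]; exists c => // x /h.
by rewrite ger0_norm.
Qed.

(** The rate for which integrating a bound by this exponential halves it, with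
   [c] a bound for the coefficients. *)
Definition growth_rate (m n : nat) (c : R) : R := 4 * (m * n)%:R * c + 1.

Definition gronwall_factor (m n : nat) (c L : R) : R :=
  expR (growth_rate m n c * L).

Lemma growth_rate_gt0 m n c : 0 <= c -> 0 < growth_rate m n c.
Proof. by move=> c0; rewrite ltr_wpDl// !mulr_ge0. Qed.

Lemma growth_rate_half m n c : 0 <= c ->
  (2 * (m * n)%:R) * (c / growth_rate m n c) <= 2^-1.
Proof.
move=> c0; rewrite mulrA ler_pdivrMr ?growth_rate_gt0//.
by rewrite /growth_rate; lra.
Qed.

(** The supremum of the norm weighted by a fast exponential is at most half of
   itself plus the data. *)
Lemma gronwall (m n : nat) (F D : R -> 'M[R[i]]_(m, n)) (L c e : R) :
  0 <= c -> 0 <= e -> (forall s, mder F s (D s)) ->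
  (forall s, `|s| <= L -> nm (D s) <= c * (nm (F s) + e)) ->
  forall x, `|x| <= L ->
    nm (F x) <= (2 * nm (F 0) + e) * gronwall_factor m n c L.
Proof.
move=> c0 e0 dF bD x xL.
have L0 : 0 <= L := le_trans (normr_ge0 _) xL.
set k := growth_rate m n c; have k0 : 0 < k by exact: growth_rate_gt0.
pose w (s : R) := expR (- k * `|s|).
have cw (s : R) : {for s, continuous (fun s => nm (F s) * w s)}.
  apply: continuousM; first exact: nm_cts (mder_cts dF) s.
  apply: (@continuous_comp _ _ _ (fun s : R => - k * `|s|) expR).
    apply: continuousM; first exact: cst_continuous.
    exact: norm_continuous.
  exact: continuous_expR.
have LL : - L <= L by lra.
have [s0 s0L hs] := @EVT_max R _ (- L) L LL (cts_within cw).
set B := nm (F s0) * w s0 in hs.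
have B0 : 0 <= B by rewrite mulr_ge0 ?expR_ge0.
have wK s : w s * expR (k * `|s|) = 1.
  by rewrite -expRD mulNr addNr expR0.
have hB s : `|s| <= L -> nm (F s) <= B * expR (k * `|s|).
  move=> sL; rewrite -[leLHS]mulr1 -(wK s) mulrA ler_wpM2r ?expR_ge0//.
  by apply: hs; rewrite in_itv /= -ler_norml.
have e1 (s : R) : 1 <= expR (k * `|s|).
  by rewrite -expR0 ler_expR mulr_ge0// ltW.
have hD s : `|s| <= L -> nm (D s) <= (c * (B + e)) * expR (k * `|s|).
  move=> sL; apply: le_trans (bD _ sL) _; rewrite -mulrA ler_wpM2l// mulrDl.
  by rewrite lerD ?hB// ler_peMr.
have s0L' : `|s0| <= L by move: s0L; rewrite in_itv /= ler_norml.
have half s : `|s| <= L -> nm (F s - F 0) <= 2^-1 * (B + e) * expR (k * `|s|).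
  move=> sL; apply: le_trans (mder_growth k0 _ dF hD sL) _.
    by rewrite mulr_ge0// addr_ge0.
  rewrite ler_wpM2r ?expR_ge0// [c * _ / _]mulrAC mulrA ler_wpM2r ?addr_ge0//.
  exact: growth_rate_half.
have hB2 : B <= 2 * nm (F 0) + e.
  suff : B <= nm (F 0) + 2^-1 * (B + e) by lra.
  have h := le_trans (nm_sub_le (F s0) (F 0)) (lerD (lexx _) (half _ s0L')).
  apply: le_trans (_ : (nm (F 0) + 2^-1 * (B + e) * expR (k * `|s0|)) * w s0 <= _).
    by rewrite ler_wpM2r ?expR_ge0.
  rewrite [leLHS](_ : _ = nm (F 0) * w s0
    + 2^-1 * (B + e) * (w s0 * expR (k * `|s0|))); last by ring.
  rewrite wK mulr1 lerD2r.
  by rewrite ler_piMr// -(wK s0) ler_peMr ?expR_ge0.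
apply: le_trans (hB _ xL) _; apply: ler_pM => //.
by rewrite ler_expR ler_wpM2l// ltW.
Qed.

Lemma gronwall_eq0 (m n : nat) (F D : R -> 'M[R[i]]_(m, n)) :
  (forall s, mder F s (D s)) ->
  (forall L : R, exists2 c, 0 <= c & forall s, `|s| <= L -> nm (D s) <= c * nm (F s)) ->
  F 0 = 0 -> forall x, F x = 0.
Proof.
move=> dF bD F0 x; apply: nm_eq0; have [c c0 h] := bD `|x|.
have := @gronwall _ _ F D `|x| c 0 c0 (lexx _) dF.
move=> g; apply: le_trans (g _ x (lexx _)) _.
  by move=> s /h; rewrite addr0.
by rewrite F0 nm0 mulr0 add0r mul0r.
Qed.

End Gronwall.

(** * Linear differential equations *)

Section LinearODE.
Context {R : realType}.

Lemma le_geometric0 (x c : R) : (forall k, x <= c * 2^-1 ^+ k) -> x <= 0.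
Proof.
move=> h; have cv : (c * 2^-1 ^+ k)%R @[k --> \oo] --> (0 : R).
  apply: cvg_geometric; rewrite ger0_norm ?invr_ge0//.
  by rewrite invf_lt1// ltr1n.
by apply: (cvgr_to_ge cv); exact: nearW.
Qed.

(** The limit is chosen before the constant, so that one limit function serves
   on all bounded intervals. *)
Lemma geometric_limit (a : nat -> R) : exists y, forall c,
  (forall k, `|a k.+1 - a k| <= c * 2^-1 ^+ k) ->
  forall k, `|a k - y| <= 2 * c * 2^-1 ^+ k.
Proof.
exists (lim (a k @[k --> \oo])) => c hc.
have cv0 : (2 * c * 2^-1 ^+ k)%R @[k --> \oo] --> (0 : R).
  apply: cvg_geometric; rewrite ger0_norm ?invr_ge0//.
  by rewrite invf_lt1// ltr1n.
have pw (k : nat) : 2 * c * 2^-1 ^+ k = c * 2^-1 ^+ k + 2 * c * 2^-1 ^+ k.+1.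
  by rewrite exprS; field.
have ndb : nondecreasing_seq (fun k => a k - 2 * c * 2^-1 ^+ k).
  apply/nondecreasing_seqP => k; have := hc k; rewrite ler_norml => /andP[+ _].
  by have := pw k; lra.
have nic : nonincreasing_seq (fun k => a k + 2 * c * 2^-1 ^+ k).
  apply/nonincreasing_seqP => k; have := hc k; rewrite ler_norml => /andP[_].
  by have := pw k; lra.
have c0 : 0 <= c by have := le_trans (normr_ge0 _) (hc 0%N); rewrite expr0 mulr1.
have p0 k : 0 <= 2 * c * 2^-1 ^+ k by rewrite !mulr_ge0// exprn_ge0.
have cb : cvgn (fun k => a k - 2 * c * 2^-1 ^+ k).
  apply: nondecreasing_is_cvgn => //; exists (a 0%N + 2 * c) => _ [k _ <-].
  apply: le_trans (_ : a k + 2 * c * 2^-1 ^+ k <= _).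
    by have := p0 k; lra.
  by have := nic _ _ (leq0n k); rewrite expr0 mulr1.
have ca : cvgn a.
  rewrite (_ : a = (fun k => (a k - 2 * c * 2^-1 ^+ k) + 2 * c * 2^-1 ^+ k)).
    by apply: is_cvgD => //; apply/cvg_ex; exists 0.
  by apply/funext => k; rewrite subrK.
have eb : lim ((a k - 2 * c * 2^-1 ^+ k) @[k --> \oo]) = lim (a k @[k --> \oo]).
  by apply/cvg_lim => //; rewrite -[X in _ --> X]subr0; apply: cvgB.
have cc : cvgn (fun k => a k + 2 * c * 2^-1 ^+ k).
  by apply: is_cvgD => //; apply/cvg_ex; exists 0.
have ec : lim ((a k + 2 * c * 2^-1 ^+ k) @[k --> \oo]) = lim (a k @[k --> \oo]).
  by apply/cvg_lim => //; rewrite -[X in _ --> X]addr0; apply: cvgD.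
move=> k; have := nondecreasing_cvgn_le ndb cb k; rewrite eb.
have := nonincreasing_cvgn_ge nic cc k; rewrite ec => h1 h2.
by rewrite ler_norml; apply/andP; split; lra.
Qed.

Lemma uniform_limit_cts (f : nat -> R -> R) (g : R -> R) :
  (forall k x, {for x, continuous (f k)}) ->
  (forall L, exists c, forall k x, `|x| <= L -> `|f k x - g x| <= c * 2^-1 ^+ k) ->
  forall x, {for x, continuous g}.
Proof.
move=> cf hfg x; apply/cvgrPdist_lt => e e0.
have [c hc] := hfg (`|x| + 1).
have [k hk] : exists k : nat, c * 2^-1 ^+ k < e / 4.
  apply: contrapT => hn; suff : e / 4 <= 0 by rewrite leNgt divr_gt0.
  apply: (@le_geometric0 _ c) => k; rewrite leNgt; apply/negP => h; apply: hn.
  by exists k.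
have := cf k x; move=> /cvgrPdist_lt /(_ (e / 4)).
rewrite divr_gt0// => /(_ isT) cfx.
near=> y.
have xy : `|x - y| < 1.
  by near: y; apply/nbhs_ballP; exists 1 => //=.
have yL : `|y| <= `|x| + 1.
  by have := ler_normB x (x - y); rewrite subKr; lra.
have xL : `|x| <= `|x| + 1 by rewrite lerDl.
have h1 := hc k y yL; have h2 := hc k x xL.
have h3 : `|f k x - f k y| < e / 4 by near: y.
rewrite (_ : g x - g y = (f k x - f k y) - (f k x - g x) + (f k y - g y)); last by ring.
have := ler_normD ((f k x - f k y) - (f k x - g x)) (f k y - g y).
have := ler_normB (f k x - f k y) (f k x - g x).
lra.
Unshelve. all: by end_near. Qed.

(** Picard iteration: in the norm weighted by a fast exponential the iterates
   differ by a geometric sequence. *)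
Lemma linear_ode (n : nat) (M : R -> 'M[R[i]]_n) : mcts M ->
  exists2 Y : R -> 'M[R[i]]_n, Y 0 = 1%:M & forall x, mder Y x (Y x *m M x).
Proof.
move=> cM.
have [J hJ] : exists J : (R -> 'M[R[i]]_n) -> (R -> 'M[R[i]]_n),
    forall D, mcts D -> J D 0 = 0 /\ forall x, mder (J D) x (D x).
  have h (D : R -> 'M[R[i]]_n) : exists F : R -> 'M[R[i]]_n,
      mcts D -> F 0 = 0 /\ forall x, mder F x (D x).
    have [cD|cD] := pselect (mcts D); last by exists (fun=> 0).
    by have [F F0 dF] := mx_antiderivative cD; exists F.
  by have [J hJ] := choice h; exists J.
pose S := fix S k : R -> 'M[R[i]]_n :=
  if k is k'.+1 then fun x => 1%:M + J (fun s => S k' s *m M s) x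
  else fun=> 1%:M.
have cS k : mcts (S k).
  elim: k => [|k ih]; first exact: (mder_cts (fun s => mder_cst _ s)).
  have [_ dJ] := hJ _ (mctsM ih cM).
  exact: (mder_cts (fun s => mderD (mder_cst _ s) (dJ s))).
have S0 k : S k 0 = 1%:M.
  case: k => //= k; have [-> _] := hJ _ (mctsM (cS k) cM); exact: addr0.
have dS k x : mder (S k.+1) x (S k x *m M x).
  have [_ dJ] := hJ _ (mctsM (cS k) cM).
  by apply: mder_eq (mderD (mder_cst _ x) (dJ x)) _; rewrite add0r.
have Cauchy L : exists c, forall k x, `|x| <= L ->
    nm (S k.+1 x - S k x) <= c * 2^-1 ^+ k.
  have [c c0 hc] := mcts_bounded L cM.
  set r := growth_rate n n c; have r0 : 0 < r by exact: growth_rate_gt0.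
  have h k x : `|x| <= L ->
      nm (S k.+1 x - S k x) <= 2^-1 ^+ k * expR (r * `|x|).
    have half d (F D : R -> 'M[R[i]]_n) : 0 <= d -> (forall s, mder F s (D s)) ->
        F 0 = 0 -> (forall s, `|s| <= L -> nm (D s) <= d * c * expR (r * `|s|)) ->
        forall x, `|x| <= L -> nm (F x) <= 2^-1 * d * expR (r * `|x|).
      move=> d0 dF F0 bD y yL; rewrite -[F y]subr0 -F0.
      apply: le_trans (mder_growth r0 _ dF bD yL) _; first exact: mulr_ge0.
      rewrite ler_wpM2r ?expR_ge0// -[d * c / r]mulrA [d * _]mulrC mulrA.
      by rewrite ler_wpM2r//; exact: growth_rate_half.
    elim: k x => [|k ih] x xL.
      have [J0 dJ] := hJ _ (mctsM (cS 0%N) cM).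
      have -> : S 1%N x - S 0%N x = J (fun s => S 0%N s *m M s) x.
        by rewrite /= addrC addKr.
      apply: le_trans (half 1 _ _ ler01 dJ J0 _ x xL) _.
        move=> s sL; rewrite mul1r /= mul1mx; apply: le_trans (hc s sL) _.
        by rewrite ler_peMr// -expR0 ler_expR mulr_ge0// ltW.
      rewrite expr0 mulr1 ler_wpM2r ?expR_ge0//; lra.
    have hd s := mderB (dS k.+1 s) (dS k s).
    rewrite exprS; apply: (half _ _ _ _ hd) => //.
    - by rewrite !S0 subrr.
    - move=> s sL; rewrite -mulmxBl; apply: le_trans (nmM _ _) _.
      by rewrite mulrAC; apply: ler_pM; rewrite ?ih ?hc.
  exists (expR (r * L)) => k x xL; apply: le_trans (h k x xL) _.
  rewrite mulrC ler_wpM2r ?exprn_ge0// ler_expR ler_wpM2l//; exact: ltW.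
have [Y hY] : exists Y : R -> 'M[R[i]]_n, forall L, exists c,
    forall k x, `|x| <= L -> nm (S k x - Y x) <= c * 2^-1 ^+ k.
  have [yr hr] := choice (fun p : R * ('I_n * 'I_n) =>
    geometric_limit (fun k => complex.Re (S k p.1 p.2.1 p.2.2))).
  have [yi hi] := choice (fun p : R * ('I_n * 'I_n) =>
    geometric_limit (fun k => complex.Im (S k p.1 p.2.1 p.2.2))).
  exists (fun x => \matrix_(i, j) (yr (x, (i, j)) +i* yi (x, (i, j)))%C) => L.
  have [c hc] := Cauchy L.
  exists ((n * n)%:R * (2 * c + 2 * c)) => k x xL; rewrite -mulrA.
  apply: nm_le => i j; rewrite !mxE /l1 ReD ReN ImD ImN /= mulrDl.
  have hc' k' : l1 (S k'.+1 x i j - S k' x i j) <= c * 2^-1 ^+ k'.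
    apply: le_trans (hc k' x xL); have := l1_le_nm (S k'.+1 x - S k' x) i j.
    by rewrite !mxE.
  apply: lerD.
    apply: (hr (x, (i, j))) => k'; rewrite -ReN -ReD.
    exact: le_trans (Re_le_l1 _) (hc' k').
  apply: (hi (x, (i, j))) => k'; rewrite -ImN -ImD.
  exact: le_trans (Im_le_l1 _) (hc' k').
have cY : mcts Y.
  move=> x i j; split.
    apply: (@uniform_limit_cts (fun k s => complex.Re (S k s i j))).
      by move=> k s; have [] := cS k s i j.
    move=> L; have [c hc] := hY L; exists c => k s sL.
    rewrite -ReN -ReD; apply: le_trans (Re_le_l1 _) _.
    by have := l1_le_nm (S k s - Y s) i j; rewrite !mxE => /le_trans; apply; exact: hc.
  apply: (@uniform_limit_cts (fun k s => complex.Im (S k s i j))).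
    by move=> k s; have [] := cS k s i j.
  move=> L; have [c hc] := hY L; exists c => k s sL.
  rewrite -ImN -ImD; apply: le_trans (Im_le_l1 _) _.
  by have := l1_le_nm (S k s - Y s) i j; rewrite !mxE => /le_trans; apply; exact: hc.
have [J0 dJ] := hJ _ (mctsM cY cM).
pose Z x := 1%:M + J (fun s => Y s *m M s) x.
have dZ x : mder Z x (Y x *m M x).
  by apply: mder_eq (mderD (mder_cst _ x) (dJ x)) _; rewrite add0r.
have Z0 : Z 0 = 1%:M by rewrite /Z J0 addr0.
suff YZ : Y = Z by exists Y; [rewrite YZ|move=> x; rewrite {1}YZ].
apply/funext => x; apply/eqP; rewrite -subr_eq0; apply/eqP; apply: nm_eq0.
have [c hc] := hY `|x|; have [d d0 hd] := mcts_bounded `|x| cM.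
have c0 : 0 <= c.
  by have := le_trans (nm_ge0 _) (hc 0%N x (lexx _)); rewrite expr0 mulr1.
have hk k s : `|s| <= `|x| -> nm (S k.+1 s - Z s) <=
    (2 * (n * n)%:R) * (c * d) * expR (1 * `|s|) * 2^-1 ^+ k.
  move=> sL; have hdd y := mderB (dS k y) (dZ y).
  rewrite -[S _ _ - _]subr0 -[X in _ - X](subrr (1%:M)) -{1}(S0 k.+1) -{1}Z0.
  apply: le_trans (mder_growth (k := 1) (c := c * 2^-1 ^+ k * d) ltr01 _ hdd _ sL) _.
  - by rewrite !mulr_ge0// exprn_ge0.
  - move=> y yL; rewrite -mulmxBl; apply: le_trans (nmM _ _) _.
    apply: le_trans (_ : c * 2^-1 ^+ k * d <= _).
      by apply: ler_pM; rewrite ?hc ?hd.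
    rewrite ler_peMr ?mulr_ge0 ?exprn_ge0//.
    by rewrite -[leLHS]expR0 ler_expR mul1r.
  - by rewrite divr1 le_eqVlt; apply/orP; left; apply/eqP; ring.
apply: (@le_geometric0 _ (c + (2 * (n * n)%:R) * (c * d) * expR (1 * `|x|))) => k.
rewrite (_ : Y x - Z x = (S k.+1 x - Z x) - (S k.+1 x - Y x)); last first.
  by rewrite opprB [RHS]addrC addrA subrK.
apply: le_trans (nmB _ _) _; rewrite mulrDl addrC lerD ?hk//.
apply: le_trans (hc k.+1 x (lexx _)) _; rewrite ler_wpM2l// exprS.
by rewrite ler_piMl ?exprn_ge0// invf_le1// ler1n.
Qed.

(** First-order perturbation theory of [Y' = Y P] around [P = 0]. *)
Lemma ode_perturbation (n : nat) (c L : R) : 0 <= c -> exists2 C, 0 <= C &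
  forall (Y P K N : R -> 'M[R[i]]_n) (w : R[i]) (e : R),
    Y 0 = 1%:M -> (forall s, mder Y s (Y s *m P s)) ->
    K 0 = 0 -> (forall s, mder K s (N s)) ->
    0 <= e -> e <= 1 ->
    (forall s, `|s| <= L -> nm (P s) <= c * e) ->
    (forall s, `|s| <= L -> nm (P s - w *: N s) <= c * e ^+ 2) ->
  forall x, `|x| <= L -> nm (Y x - 1%:M - w *: K x) <= C * e ^+ 2.
Proof.
move=> c0; pose G : R := gronwall_factor n n c L.
have G0 : 0 <= G by exact: expR_ge0.
pose G1 : R := gronwall_factor n n 1 L.
have G10 : 0 <= G1 by exact: expR_ge0.
exists ((G * c + c) * G1); first by rewrite mulr_ge0// addr_ge0// mulr_ge0.
move=> Y P K N w e Y0 dY K0 dK e0 e1 bP bPN.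
have dF s : mder (fun s => Y s - 1%:M) s (Y s *m P s).
  by apply: mder_eq (mderB (dY s) (mder_cst _ s)) _; rewrite subr0.
have hF x : `|x| <= L -> nm (Y x - 1%:M) <= e * G.
  move=> xL; apply: le_trans (gronwall c0 e0 dF _ xL) _.
    move=> s sL; have -> : Y s *m P s = (Y s - 1%:M) *m P s + P s by rewrite mulmxBl mul1mx subrK.
    apply: le_trans (nmD _ _) _; rewrite mulrDr lerD ?bP//.
    apply: le_trans (nmM _ _) _; rewrite mulrC ler_wpM2r//.
    by apply: le_trans (bP _ sL) _; rewrite ler_piMr.
  by rewrite Y0 subrr nm0 mulr0 add0r.
have dR s : mder (fun s => Y s - 1%:M - w *: K s) s (Y s *m P s - w *: N s).
  by apply: mderB (dF s) (mderZ _ (dK s)).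
move=> x xL.
have e20 : 0 <= (G * c + c) * e ^+ 2.
  by rewrite mulr_ge0 ?exprn_ge0// addr_ge0// mulr_ge0.
apply: le_trans (gronwall ler01 e20 dR _ xL) _; last first.
  rewrite Y0 K0 subrr scaler0 subrr nm0 mulr0 add0r.
  by rewrite -/G1 le_eqVlt; apply/orP; left; apply/eqP; ring.
move=> s sL; rewrite mul1r; apply: le_trans (_ : (G * c + c) * e ^+ 2 <= _); last first.
  by rewrite lerDr.
have -> : Y s *m P s = (Y s - 1%:M) *m P s + P s by rewrite mulmxBl mul1mx subrK.
rewrite -addrA.
apply: le_trans (nmD _ _) _; rewrite mulrDl lerD ?bPN//.
apply: le_trans (nmM _ _) _.
rewrite (_ : G * c * e ^+ 2 = (e * G) * (c * e)); last by ring.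
by apply: ler_pM; rewrite ?hF ?bP.
Qed.

End LinearODE.

(** * Smooth functions of two variables *)

Section Smoothness.
Context {R : realType}.

Lemma rder_lipschitz (f f' : R -> R) (L c a b : R) :
  (forall s : R, is_derive s 1 f (f' s)) ->
  (forall s, `|s| <= L -> `|f' s| <= c) -> `|a| <= L -> `|b| <= L ->
  `|f b - f a| <= c * `|b - a|.
Proof.
move=> df bf; wlog ab : a b / a <= b.
  move=> h aL bL; have [/h|/ltW/h] := leP a b; first exact.
  by rewrite distrC [`|b - a|]distrC; exact.
move=> aL bL; move: (aL) (bL); rewrite !(ler_norml _ L) => /andP[a1 a2] /andP[b1 b2].
rewrite (@ger0_norm _ (b - a)) ?subr_ge0// mulrBr.
apply: (@rder_dominated R f f' (fun s => c * s) (fun=> c)) => // s /andP[s1 s2].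
  apply: rder_eq (rderM (rder_cst c s) (rder_id s)) _.
  by rewrite mul0r add0r mulr1.
by apply: bf; rewrite ler_norml; apply/andP; split; lra.
Qed.

Lemma partial1P (f : R * R -> R) (p : R * R) d :
  is_derive p (1, 0) f d <-> is_derive p.1 1 (fun s => f (s, p.2)) d.
Proof.
have e : (fun h : R => h^-1 *: (f (h *: ((1, 0) : R * R) + p) - f p)) =
  (fun h : R => h^-1 *: (f (h *: (1 : R) + p.1, p.2) - f (p.1, p.2))).
  apply/funext => h; congr (_ *: (f _ - _)); last by case: p.
  case: p => a b /=; congr pair; rewrite -[RHS]add0r; congr (_ + _).
  exact: mulr0.
split=> -[h1 h2]; split.
- by move: h1; rewrite /derivable /= e.
- by move: h2; rewrite /derive /= e.
- by rewrite /derivable /= e.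
- by rewrite /derive /= e.
Qed.

Lemma partial2P (f : R * R -> R) (p : R * R) d :
  is_derive p (0, 1) f d <-> is_derive p.2 1 (fun s => f (p.1, s)) d.
Proof.
have e : (fun h : R => h^-1 *: (f (h *: ((0, 1) : R * R) + p) - f p)) =
  (fun h : R => h^-1 *: (f (p.1, h *: (1 : R) + p.2) - f (p.1, p.2))).
  apply/funext => h; congr (_ *: (f _ - _)); last by case: p.
  case: p => a b /=; congr pair; rewrite -[RHS]add0r; congr (_ + _).
  exact: mulr0.
split=> -[h1 h2]; split.
- by move: h1; rewrite /derivable /= e.
- by move: h2; rewrite /derive /= e.
- by rewrite /derivable /= e.
- by rewrite /derive /= e.
Qed.

(** [Ck] asks for the continuity of the derivatives of order exactly [k]; the
   lower orders are collected here. *)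
Definition Cks (k : nat) (f : R * R -> R) := forall j, (j <= k)%N -> Ck j f.

Lemma CksS k f fx ft : continuous f ->
  (forall p : R * R, is_derive p (1, 0) f (fx p)) ->
  (forall p : R * R, is_derive p (0, 1) f (ft p)) ->
  Cks k fx -> Cks k ft -> Cks k.+1 f.
Proof.
move=> cf dx dt kx kt [|j] //= jk; split.
- by move=> p; have [] := dx p.
- by move=> p; have [] := dt p.
- rewrite (_ : (fun p => _) = fx); first exact: kx.
  by apply/funext => p; have [_] := dx p.
- rewrite (_ : (fun p => _) = ft); first exact: kt.
  by apply/funext => p; have [_] := dt p.
Qed.

Lemma CksSE k f : Cks k.+1 f -> exists fx ft,
  [/\ forall p : R * R, is_derive p (1, 0) f (fx p),
      forall p : R * R, is_derive p (0, 1) f (ft p), Cks k fx & Cks k ft].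
Proof.
move=> h; exists (fun p => 'D_(1, 0) f p), (fun p => 'D_(0, 1) f p).
have [d1 d2 _ _] := h 1%N isT; split.
- by move=> p; exact: derivableP.
- by move=> p; exact: derivableP.
- by move=> j jk; have [] := h j.+1 jk.
- by move=> j jk; have [] := h j.+1 jk.
Qed.

Lemma CksW k f : Cks k.+1 f -> Cks k f.
Proof. by move=> h j jk; apply: h; exact: leqW. Qed.

Lemma Cks_cts k f : Cks k f -> continuous f.
Proof. by move=> /(_ 0%N (leq0n _)). Qed.

Lemma Cks_cst k (c : R) : Cks k (fun=> c).
Proof.
elim: k c => [|k ih] c; first by move=> [|j]// _ /= p; exact: cst_continuous.
apply: (@CksS _ _ (fun=> 0) (fun=> 0)) => //.
by move=> p; exact: cst_continuous.
Qed.

Lemma CksD k f g : Cks k f -> Cks k g -> Cks k (fun p => f p + g p).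
Proof.
elim: k f g => [|k ih] f g kf kg.
  move=> [|j]// _ /= p.
  by apply: continuousD; [exact: (Cks_cts kf)|exact: (Cks_cts kg)].
have [fx [ft [dfx dft kfx kft]]] := CksSE kf.
have [gx [gt [dgx dgt kgx kgt]]] := CksSE kg.
apply: (@CksS _ _ (fun p => fx p + gx p) (fun p => ft p + gt p)).
- by move=> p; apply: continuousD; [exact: (Cks_cts kf)|exact: (Cks_cts kg)].
- exact: ih.
- exact: ih.
Qed.

Lemma CksM k f g : Cks k f -> Cks k g -> Cks k (fun p => f p * g p).
Proof.
elim: k f g => [|k ih] f g kf kg.
  move=> [|j]// _ /= p.
  by apply: continuousM; [exact: (Cks_cts kf)|exact: (Cks_cts kg)].
have [fx [ft [dfx dft kfx kft]]] := CksSE kf.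
have [gx [gt [dgx dgt kgx kgt]]] := CksSE kg.
apply: (@CksS _ _ (fun p => f p * gx p + g p * fx p)
                  (fun p => f p * gt p + g p * ft p)).
- by move=> p; apply: continuousM; [exact: (Cks_cts kf)|exact: (Cks_cts kg)].
- by apply: CksD; apply: ih => //; exact: CksW.
- by apply: CksD; apply: ih => //; exact: CksW.
Qed.

Lemma CksN k f : Cks k f -> Cks k (fun p => - f p).
Proof.
move=> kf; rewrite (_ : (fun p => _) = fun p => -1 * f p).
  by apply: CksM => //; exact: Cks_cst.
by apply/funext => p; rewrite mulN1r.
Qed.

Lemma Cks_sum k (I : Type) (r : seq I) (f : I -> R * R -> R) :
  (forall i, Cks k (f i)) -> Cks k (fun p => \sum_(i <- r) f i p).
Proof.
move=> kf; elim: r => [|i r ih].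
  by under eq_fun do rewrite big_nil; exact: Cks_cst.
by under eq_fun do rewrite big_cons; apply: CksD.
Qed.

Definition mCks (n k : nat) (F : R -> R -> 'M[R[i]]_n) := forall i j,
  Cks k (re_entry (fun p : R * R => F p.1 p.2) i j) /\
  Cks k (im_entry (fun p : R * R => F p.1 p.2) i j).

Lemma smoothP n (F : R -> R -> 'M[R[i]]_n) : smooth F <-> forall k, mCks k F.
Proof.
split=> h; first by move=> k i j; split=> l _; have [] := h i j l.
by move=> i j k; have [a b] := h k i j; split; [exact: a|exact: b].
Qed.

Lemma mCks_cst n k (A : 'M[R[i]]_n) : mCks k (fun _ _ => A).
Proof. by move=> i j; split; exact: Cks_cst. Qed.

Lemma mCksD n k (F G : R -> R -> 'M[R[i]]_n) :
  mCks k F -> mCks k G -> mCks k (fun x t => F x t + G x t).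
Proof.
move=> kF kG i j; have [a b] := kF i j; have [c d] := kG i j.
split; rewrite /re_entry /im_entry.
  by under eq_fun do rewrite mxE ReD; exact: CksD.
by under eq_fun do rewrite mxE ImD; exact: CksD.
Qed.

Lemma mCksM n k (F G : R -> R -> 'M[R[i]]_n) :
  mCks k F -> mCks k G -> mCks k (fun x t => F x t *m G x t).
Proof.
move=> kF kG i j; split; rewrite /re_entry /im_entry.
  rewrite (_ : (fun p : R * R => _) = fun p => \sum_l
     (complex.Re (F p.1 p.2 i l) * complex.Re (G p.1 p.2 l j)
      + - (complex.Im (F p.1 p.2 i l) * complex.Im (G p.1 p.2 l j)))).
    apply: Cks_sum => l; have [a b] := kF i l; have [c d] := kG l j.
    by apply: CksD; [|apply: CksN]; exact: CksM.
  apply/funext => p; rewrite mxE.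
  by elim/big_rec2 : _ => // l a b _ <-; rewrite ReD ReM.
rewrite (_ : (fun p : R * R => _) = fun p => \sum_l
   (complex.Re (F p.1 p.2 i l) * complex.Im (G p.1 p.2 l j)
    + complex.Im (F p.1 p.2 i l) * complex.Re (G p.1 p.2 l j))).
  apply: Cks_sum => l; have [a b] := kF i l; have [c d] := kG l j.
  by apply: CksD; exact: CksM.
apply/funext => p; rewrite mxE.
by elim/big_rec2 : _ => // l a b _ <-; rewrite ImD ImM.
Qed.

Lemma mCksZ n k (c : R[i]) (F : R -> R -> 'M[R[i]]_n) :
  mCks k F -> mCks k (fun x t => c *: F x t).
Proof.
move=> kF; rewrite (_ : (fun x t => _) = fun x t => c%:M *m F x t).
  by apply: mCksM => //; exact: mCks_cst.
by apply/funext => x; apply/funext => t; rewrite mul_scalar_mx.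
Qed.

Lemma mCksN n k (F : R -> R -> 'M[R[i]]_n) :
  mCks k F -> mCks k (fun x t => - F x t).
Proof.
move=> /(mCksZ (-1)) h; rewrite (_ : (fun x t => _) = fun x t => -1 *: F x t) //.
by apply/funext => x; apply/funext => t; rewrite scaleN1r.
Qed.

Lemma mCksB n k (F G : R -> R -> 'M[R[i]]_n) :
  mCks k F -> mCks k G -> mCks k (fun x t => F x t - G x t).
Proof. by move=> kF kG; apply: mCksD => //; exact: mCksN. Qed.

Lemma mCks_adj n k (F : R -> R -> 'M[R[i]]_n) :
  mCks k F -> mCks k (fun x t => (F x t) ^t*).
Proof.
move=> kF i j; have [a b] := kF j i; split; rewrite /re_entry /im_entry.
  by under eq_fun do rewrite !mxE Re_conj.
by under eq_fun do rewrite !mxE Im_conj; exact: CksN.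
Qed.

Definition partials n (F Fx Ft : R -> R -> 'M[R[i]]_n) := forall x t,
  mder (F ^~ t) x (Fx x t) /\ mder (F x) t (Ft x t).

Definition locally_bounded n (F : R -> R -> 'M[R[i]]_n) := forall L,
  exists2 c, 0 <= c & forall x t, `|x| <= L -> `|t| <= L -> nm (F x t) <= c.

Lemma mCksS n k (F Fx Ft : R -> R -> 'M[R[i]]_n) : partials F Fx Ft ->
  mCks 0 F -> mCks k Fx -> mCks k Ft -> mCks k.+1 F.
Proof.
move=> dF k0 kx kt i j.
have [a b] := k0 i j; have [c d] := kx i j; have [e f] := kt i j.
split; apply: CksS; [exact: (Cks_cts a)| | |exact: c|exact: e
                    |exact: (Cks_cts b)| | |exact: d|exact: f].
- by move=> [x t]; apply/partial1P; have [/(_ i j)[]] := dF x t.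
- by move=> [x t]; apply/partial2P; have [_ /(_ i j)[]] := dF x t.
- by move=> [x t]; apply/partial1P; have [/(_ i j)[]] := dF x t.
- by move=> [x t]; apply/partial2P; have [_ /(_ i j)[]] := dF x t.
Qed.

Lemma smooth_partials n (F : R -> R -> 'M[R[i]]_n) : smooth F ->
  [/\ partials F (dx F) (dt F), smooth (dx F) & smooth (dt F)].
Proof.
move=> sF.
have d1 i j (p : R * R) : is_derive p (1, 0) (re_entry (fun p : R * R => F p.1 p.2) i j)
      (complex.Re (dx F p.1 p.2 i j)) /\
    is_derive p (1, 0) (im_entry (fun p : R * R => F p.1 p.2) i j)
      (complex.Im (dx F p.1 p.2 i j)).
  rewrite !mxE /= !derive1E; have [[+ _ _ _] [+ _ _ _]] := sF i j 1%N.
  move=> /(_ p) /derivableP/partial1P [h1 _] /(_ p) /derivableP/partial1P [h2 _].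
  by split; apply/partial1P; exact: derivableP.
have d2 i j (p : R * R) : is_derive p (0, 1) (re_entry (fun p : R * R => F p.1 p.2) i j)
      (complex.Re (dt F p.1 p.2 i j)) /\
    is_derive p (0, 1) (im_entry (fun p : R * R => F p.1 p.2) i j)
      (complex.Im (dt F p.1 p.2 i j)).
  rewrite !mxE /= !derive1E; have [[_ + _ _] [_ + _ _]] := sF i j 1%N.
  move=> /(_ p) /derivableP/partial2P [h1 _] /(_ p) /derivableP/partial2P [h2 _].
  by split; apply/partial2P; exact: derivableP.
split.
- move=> x t; split=> i j.
    by have [/partial1P a /partial1P b] := d1 i j (x, t).
  by have [/partial2P a /partial2P b] := d2 i j (x, t).
- move=> i j k; have [[_ _ a _] [_ _ b _]] := sF i j k.+1; split.
    rewrite (_ : re_entry _ i j =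
      (fun p => 'D_(1, 0) (re_entry (fun p : R * R => F p.1 p.2) i j) p)) //.
    by apply/funext => p; have [[_ ->]] := d1 i j p.
  rewrite (_ : im_entry _ i j =
    (fun p => 'D_(1, 0) (im_entry (fun p : R * R => F p.1 p.2) i j) p)) //.
  by apply/funext => p; have [_ [_ ->]] := d1 i j p.
- move=> i j k; have [[_ _ _ a] [_ _ _ b]] := sF i j k.+1; split.
    rewrite (_ : re_entry _ i j =
      (fun p => 'D_(0, 1) (re_entry (fun p : R * R => F p.1 p.2) i j) p)) //.
    by apply/funext => p; have [[_ ->]] := d2 i j p.
  rewrite (_ : im_entry _ i j =
    (fun p => 'D_(0, 1) (im_entry (fun p : R * R => F p.1 p.2) i j) p)) //.
  by apply/funext => p; have [_ [_ ->]] := d2 i j p.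
Qed.

Lemma box_bounded (f : R * R -> R) (L : R) : continuous f ->
  exists2 c, 0 <= c & forall x t, `|x| <= L -> `|t| <= L -> `|f (x, t)| <= c.
Proof.
move=> cf; have [L0|L0] := ltP L 0.
  by exists 0 => // x t xL; have := le_lt_trans xL L0; rewrite normr_lt0.
pose A : set (R * R) := `[- L, L]%classic `*` `[- L, L]%classic.
have cA : compact A by apply: compact_setX; exact: segment_compact.
have A0 : A !=set0 by exists (0, 0); split; rewrite /= in_itv /= L0 lerNl oppr0 L0.
have cn : continuous (fun p => `|f p|) by move=> p; exact: (cvg_norm (cf p)).
have [c _ hc] := compact_EVT_max A0 cA (continuous_subspaceT cn).
exists `|f c| => // x t; rewrite !(ler_norml _ L) => xL tL.
have xtA : (x, t) \in A by rewrite inE /A; split; rewrite /= in_itv.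
exact: (hc _ xtA).
Qed.

Lemma smooth_locally_bounded n (F : R -> R -> 'M[R[i]]_n) :
  smooth F -> locally_bounded F.
Proof.
move=> /smoothP/(_ 0%N) sF L.
have h (ij : 'I_n * 'I_n) : exists c, forall x t, `|x| <= L -> `|t| <= L ->
    l1 (F x t ij.1 ij.2) <= c.
  have [a b] := sF ij.1 ij.2.
  have [c c0 hc] := box_bounded L (Cks_cts a).
  have [d d0 hd] := box_bounded L (Cks_cts b).
  by exists (c + d) => x t xL tL; rewrite /l1 lerD// ?(hc x t)// (hd x t).
have [c hc] := choice h.
exists (\sum_i \sum_j `|c (i, j)|).
  by apply: sumr_ge0 => i _; apply: sumr_ge0.
move=> x t xL tL; apply: ler_sum => i _; apply: ler_sum => j _.
exact: le_trans (hc (i, j) x t xL tL) (ler_norm _).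
Qed.

(** Locally bounded partial derivatives give joint continuity; the equations
   then raise the order of differentiability one step at a time. *)
Lemma smooth_bootstrap n (F Fx Ft : R -> R -> 'M[R[i]]_n) : partials F Fx Ft ->
  locally_bounded Fx -> locally_bounded Ft ->
  (forall k, mCks k F -> mCks k Fx /\ mCks k Ft) -> smooth F.
Proof.
move=> dF bx bt boot; apply/smoothP.
have cts (f fx ft : R -> R -> R) :
    (forall x t : R, is_derive x 1 (f ^~ t) (fx x t)) ->
    (forall x t : R, is_derive t 1 (f x) (ft x t)) ->
    (forall L, exists2 c, 0 <= c & forall x t, `|x| <= L -> `|t| <= L ->
      `|fx x t| <= c /\ `|ft x t| <= c) ->
    continuous (fun p : R * R => f p.1 p.2).
  move=> dx dt bd [x0 t0]; apply/cvgrPdist_lt => e e0.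
  have [c c0 hc] := bd (`|x0| + `|t0| + 1).
  set L := `|x0| + `|t0| + 1 in hc.
  have d0 : 0 < Num.min 1 (e / (2 * (c + 1))).
    by rewrite lt_min ltr01 divr_gt0// mulr_gt0// ltr_wpDl.
  exists (ball x0 (Num.min 1 (e / (2 * (c + 1)))),
          ball t0 (Num.min 1 (e / (2 * (c + 1))))) => /=.
    by split; apply: nbhsx_ballx.
  move=> [x t] [/= + +]; rewrite /ball /= !lt_min.
  move=> /andP[x1 x2] /andP[t1 t2].
  have x0L : `|x0| <= L by rewrite /L -addrA lerDl addr_ge0.
  have t0L : `|t0| <= L by rewrite /L addrAC lerDr addr_ge0.
  have xL : `|x| <= L.
    by have := ler_normB x0 (x0 - x); rewrite subKr /L; have := normr_ge0 t0; lra.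
  have tL : `|t| <= L.
    by have := ler_normB t0 (t0 - t); rewrite subKr /L; have := normr_ge0 x0; lra.
  have h1 : `|f x0 t - f x t| <= c * `|x0 - x|.
    apply: (@rder_lipschitz (f ^~ t) (fx ^~ t) L) => // s sL.
    by have [] := hc s t sL tL.
  have h2 : `|f x0 t0 - f x0 t| <= c * `|t0 - t|.
    apply: (@rder_lipschitz (f x0) (ft x0) L) => // s sL.
    by have [] := hc x0 s x0L sL.
  have -> : f x0 t0 - f x t = (f x0 t0 - f x0 t) + (f x0 t - f x t) by rewrite addrA subrK.
  have c2 : 0 < 2 * (c + 1) by rewrite mulr_gt0// ltr_wpDl.
  move: x2 t2; rewrite !ltr_pdivlMr// => x2 t2.
  have := ler_normD (f x0 t0 - f x0 t) (f x0 t - f x t).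
  have := normr_ge0 (x0 - x); have := normr_ge0 (t0 - t); nra.
have k0 : mCks 0 F.
  have bd (l : R[i] -> R) i j : (forall z, `|l z| <= l1 z) -> forall L,
      exists2 c, 0 <= c & forall x t, `|x| <= L -> `|t| <= L ->
      `|l (Fx x t i j)| <= c /\ `|l (Ft x t i j)| <= c.
    move=> hl L; have [c c0 hc] := bx L; have [d d0 hd] := bt L.
    exists (c + d); first exact: addr_ge0.
    move=> x t xL tL; split; apply: le_trans (hl _) _.
      by rewrite (le_trans (l1_le_nm _ _ _))// (le_trans (hc _ _ xL tL))// lerDl.
    by rewrite (le_trans (l1_le_nm _ _ _))// (le_trans (hd _ _ xL tL))// lerDr.
  move=> i j; split=> -[|//] _ /=.
    apply: (cts (fun x t => complex.Re (F x t i j)) _ _ _ _ (bd _ i j (@Re_le_l1 R))).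
      by move=> x t; have [/(_ i j)[]] := dF x t.
    by move=> x t; have [_ /(_ i j)[]] := dF x t.
  apply: (cts (fun x t => complex.Im (F x t i j)) _ _ _ _ (bd _ i j (@Im_le_l1 R))).
    by move=> x t; have [/(_ i j)[]] := dF x t.
  by move=> x t; have [_ /(_ i j)[]] := dF x t.
elim=> [//|k ih]; have [a b] := boot k ih; exact: mCksS dF k0 a b.
Qed.

End Smoothness.

(** * Quadratic remainders and holomorphy *)

Section Adjoint.
Context {R : realType}.
Local Notation C := R[i].

Lemma adjM m n k (A : 'M[C]_(m, n)) (B : 'M[C]_(n, k)) :
  (A *m B) ^t* = B ^t* *m A ^t*.
Proof. by rewrite trmx_mul map_mxM. Qed.

Lemma adjD m n (A B : 'M[C]_(m, n)) : (A + B) ^t* = A ^t* + B ^t*.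
Proof. by apply/matrixP => i j; rewrite !mxE rmorphD. Qed.

Lemma adjN m n (A : 'M[C]_(m, n)) : (- A) ^t* = - A ^t*.
Proof. by apply/matrixP => i j; rewrite !mxE rmorphN. Qed.

Lemma adjB m n (A B : 'M[C]_(m, n)) : (A - B) ^t* = A ^t* - B ^t*.
Proof. by rewrite adjD adjN. Qed.

Lemma adjZ m n c (A : 'M[C]_(m, n)) : (c *: A) ^t* = c^* *: A ^t*.
Proof. by apply/matrixP => i j; rewrite !mxE rmorphM. Qed.

Lemma adjK m n (A : 'M[C]_(m, n)) : (A ^t*) ^t* = A.
Proof. by apply/matrixP => i j; rewrite !mxE conjCK. Qed.

Lemma adj1 n : (1%:M : 'M[C]_n) ^t* = 1%:M.
Proof. by rewrite trmx1 map_mx1. Qed.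

Lemma adj0 m n : (0 : 'M[C]_(m, n)) ^t* = 0.
Proof. by rewrite trmx0 map_mx0. Qed.

End Adjoint.

Section Expansions.
Context {R : realType}.
Local Notation C := R[i].

Lemma mder_const (m n : nat) (F : R -> 'M[C]_(m, n)) :
  (forall s, mder F s 0) -> forall x, F x = F 0.
Proof.
move=> dF x; apply/eqP; rewrite -subr_eq0; apply/eqP.
apply: (@gronwall_eq0 _ _ _ (fun s => F s - F 0) (fun=> 0)).
- by move=> s; apply: mder_eq (mderB (dF s) (mder_cst _ s)) _; rewrite subr0.
- by move=> L; exists 0 => // s _; rewrite nm0 mul0r.
- by rewrite subrr.
Qed.

(** A quadratic bound on the remainder forces the difference quotients to
   converge. *)
Lemma rder_quadratic (f : R -> R) (t d c e : R) : 0 < e ->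
  (forall h, `|h| < e -> `|f (t + h) - f t - h * d| <= c * h ^+ 2) ->
  is_derive t 1 f d.
Proof.
move=> e0 hf.
have cv : h^-1 *: (f (h *: (1 : R) + t) - f t) @[h --> 0^'] --> d.
  apply/cvgrPdist_lt => r r0; near=> h.
  have h0 : h != 0 by near: h; exact: nbhs_dnbhs_neq.
  have he : `|h| < Num.min e (r / (`|c| + 1)).
    near: h; apply: dnbhs0_lt; rewrite lt_min e0 divr_gt0// ltr_wpDl//.
  move: he; rewrite lt_min => /andP[he hr].
  have hh := hf h he; rewrite /GRing.scale /= mulr1 [h + t]addrC.
  have -> : d - h^-1 * (f (t + h) - f t) = - (h^-1 * (f (t + h) - f t - h * d)).
    by field.
  rewrite normrN normrM; apply: le_lt_trans (_ : `|c| * `|h| < _).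
    rewrite normfV ler_pdivrMl ?normr_gt0//; apply: le_trans hh _.
    rewrite [leRHS](_ : _ = `|c| * h ^+ 2); last first.
      by rewrite -[h ^+ 2]real_normK ?num_real//; ring.
    by rewrite ler_wpM2r ?sqr_ge0// ler_norm.
  apply: le_lt_trans (_ : (`|c| + 1) * `|h| < _).
    by rewrite ler_wpM2r// lerDl.
  by rewrite mulrC -ltr_pdivlMr// ltr_wpDl.
by split; [apply/cvg_ex; exists d|exact/cvg_lim].
Unshelve. all: by end_near. Qed.

Lemma mder_quadratic (m n : nat) (F : R -> 'M[C]_(m, n)) t D c e : 0 < e ->
  (forall h, `|h| < e -> nm (F (t + h) - F t - (h%:C)%C *: D) <= c * h ^+ 2) ->
  mder F t D.
Proof.
move=> e0 hF i j; split; apply: (rder_quadratic (c := c) e0) => h he.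
  have := le_trans (Re_le_l1 _) (le_trans (l1_le_nm _ i j) (hF h he)).
  by rewrite !mxE !(ReD, ReN, ReM) /= mul0r subr0.
have := le_trans (Im_le_l1 _) (le_trans (l1_le_nm _ i j) (hF h he)).
by rewrite !mxE !(ImD, ImN, ImM) /= mul0r addr0.
Qed.

Lemma rder_taylor (f f' f'' : R -> R) (t h c : R) :
  (forall s : R, is_derive s 1 f (f' s)) ->
  (forall s : R, is_derive s 1 f' (f'' s)) ->
  (forall s, `|s - t| <= `|h| -> `|f'' s| <= c) ->
  `|f (t + h) - f t - h * f' t| <= c * h ^+ 2.
Proof.
move=> df df' bf.
have shift (g g' : R -> R) : (forall s : R, is_derive s 1 g (g' s)) ->
    forall s : R, is_derive s 1 (fun s => g (t + s)) (g' (t + s)).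
  move=> dg s; have := rder_comp (dg (t + s)) (rderD (rder_cst t s) (rder_id s)).
  by rewrite add0r mulr1.
have bl s : `|s| <= `|h| -> `|f' (t + s) - f' t| <= c * `|h|.
  move=> sh; have := @rder_lipschitz R (fun s => f' (t + s))
    (fun s => f'' (t + s)) `|h| c 0 s (shift _ _ df').
  rewrite addr0 subr0 => /(_ _ _ sh) hs; apply: le_trans (hs _ _) _.
  - by move=> r rh; apply: bf; rewrite addrC addKr.
  - by rewrite normr0.
  - rewrite ler_wpM2l//; apply: le_trans (normr_ge0 _) (bf t _).
    by rewrite subrr normr0.
have := @rder_lipschitz R (fun s => f (t + s) - s * f' t)
  (fun s => f' (t + s) - f' t) `|h| (c * `|h|) 0 h.
rewrite addr0 subr0 mul0r subr0 -mulrA -expr2 real_normK ?num_real// => hs.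
rewrite [X in `|X|](_ : _ = f (t + h) - h * f' t - f t); last by ring.
apply: hs => //; last by rewrite normr0.
move=> s.
apply: rder_eq (rderB (shift _ _ df s) (rderM (rder_id s) (rder_cst (f' t) s))) _.
by rewrite mul1r mulr0 addr0.
Qed.

Lemma mder_taylor (m n : nat) (F F' F'' : R -> 'M[C]_(m, n)) t h c :
  (forall s, mder F s (F' s)) -> (forall s, mder F' s (F'' s)) ->
  (forall s, `|s - t| <= `|h| -> nm (F'' s) <= c) ->
  nm (F (t + h) - F t - (h%:C)%C *: F' t) <= (m * n)%:R * (c + c) * h ^+ 2.
Proof.
move=> dF dF' bF; rewrite -mulrA; apply: nm_le => i j.
rewrite !mxE /l1 !(ReD, ReN, ReM) !(ImD, ImN, ImM) /= !mul0r subr0 addr0.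
rewrite mulrDl lerD//.
  apply: (@rder_taylor (fun s => complex.Re (F s i j))
    (fun s => complex.Re (F' s i j)) (fun s => complex.Re (F'' s i j))).
  - by move=> s; have [] := dF s i j.
  - by move=> s; have [] := dF' s i j.
  - by move=> s /bF; apply: le_trans; apply: le_trans (l1_le_nm _ i j); exact: Re_le_l1.
apply: (@rder_taylor (fun s => complex.Im (F s i j))
  (fun s => complex.Im (F' s i j)) (fun s => complex.Im (F'' s i j))).
- by move=> s; have [] := dF s i j.
- by move=> s; have [] := dF' s i j.
- by move=> s /bF; apply: le_trans; apply: le_trans (l1_le_nm _ i j); exact: Im_le_l1.
Qed.

(** Complex differentiability with a quadratic remainder, the form in which it
   comes out of perturbation theory. *)
Definition cquad (m n : nat) (F : C -> 'M[C]_(m, n)) (l : C) :=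
  exists D c e, [/\ 0 <= c, 0 < e & forall h, l1 h <= e ->
    nm (F (l + h) - F l - h *: D) <= c * l1 h ^+ 2].

Lemma cquadM m n k (F : C -> 'M[C]_(m, n)) (G : C -> 'M[C]_(n, k)) l :
  cquad F l -> cquad G l -> cquad (fun l => F l *m G l) l.
Proof.
move=> [D [c [e [c0 e0 hF]]]] [D' [c' [e' [c0' e0' hG]]]].
pose g := nm D' + c'.
have g0 : 0 <= g by rewrite addr_ge0.
exists (D *m G l + F l *m D'), (c * (nm (G l) + g) + nm (F l) * c' + nm D * g),
  (Num.min 1 (Num.min e e')); split.
- by rewrite !addr_ge0// mulr_ge0// addr_ge0.
- by rewrite !lt_min ltr01 e0 e0'.
move=> h; rewrite !le_min => /and3P[h1 he he'].
set RF := F (l + h) - F l - h *: D; set RG := G (l + h) - G l - h *: D'.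
have bG : nm (G (l + h) - G l) <= g * l1 h.
  rewrite -[G (l + h) - G l](subrK (h *: D')) addrC.
  apply: le_trans (nmD _ _) _; rewrite /g mulrDl lerD//.
    by apply: le_trans (nmZ _ _) _; rewrite mulrC.
  apply: le_trans (hG h he') _; rewrite ler_wpM2l// expr2.
  by rewrite ler_piMr.
have bG' : nm (G (l + h)) <= nm (G l) + g.
  apply: le_trans (nm_sub_le _ (G l)) _; rewrite lerD2l (le_trans bG)//.
  by rewrite ler_piMr.
have -> : F (l + h) *m G (l + h) - F l *m G l - h *: (D *m G l + F l *m D') =
    RF *m G (l + h) + F l *m RG + (h *: D) *m (G (l + h) - G l).
  rewrite /RF /RG !(mulmxBl, mulmxBr) scalerDr -!scalemxAl -!scalemxAr.
  move: (F (l + h) *m G (l + h)) (F l *m G (l + h)) (h *: (D *m G (l + h)))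
    (F l *m G l) (h *: (F l *m D')) (h *: (D *m G l)) => a1 a2 a3 a4 a5 a6.
  by apply/matrixP => i j; rewrite !mxE; ring.
apply: le_trans (nmD _ _) _; rewrite mulrDl lerD//.
  apply: le_trans (nmD _ _) _; rewrite mulrDl lerD//.
    apply: le_trans (nmM _ _) _; rewrite mulrAC; apply: ler_pM => //; exact: hF.
  by apply: le_trans (nmM _ _) _; rewrite -mulrA ler_wpM2l// hG.
apply: le_trans (nmM _ _) _; rewrite expr2.
rewrite (_ : nm D * g * (l1 h * l1 h) = (l1 h * nm D) * (g * l1 h)); last by ring.
by apply: ler_pM => //; exact: nmZ.
Qed.

Lemma l1_inv (z : C) : z != 0 -> l1 z^-1 * l1 z <= 2.
Proof.
case: z => a b z0; have ab : 0 < a ^+ 2 + b ^+ 2.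
  rewrite lt_def addr_ge0 ?sqr_ge0// andbT; apply: contra z0.
  by rewrite paddr_eq0 ?sqr_ge0// !sqrf_eq0 => /andP[/eqP -> /eqP ->].
rewrite /l1 /= normrN !normrM normfV (ger0_norm (ltW ab)) -mulrDl mulrAC.
rewrite ler_pdivrMr// -[a ^+ 2]real_normK ?num_real//.
rewrite -[b ^+ 2]real_normK ?num_real//.
have := sqr_ge0 (`|a| - `|b|); nra.
Qed.

Lemma cquad_holomorphic (n : nat) (F : C -> 'M[C]_n) :
  (forall l, l != 0 -> cquad F l) -> mx_holomorphic F.
Proof.
move=> hF l /hF [D [c [e [c0 e0 {}hF]]]] i j.
apply/cvg_ex; exists (D i j); apply/cvgrPdist_lt => r r0.
have rE : r = (complex.Re r)%:C%C.
  by case: r r0 => a b; rewrite ltcE /= => /andP[/eqP -> _].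
have r0' : 0 < complex.Re r by move: r0; rewrite ltcE => /andP[].
pose d := Num.min (e / 2) (complex.Re r / (8 * (c + 1))).
have c1 : 0 < 8 * (c + 1) by rewrite mulr_gt0// ltr_wpDl.
have d0 : 0 < d by rewrite /d lt_min !divr_gt0.
near=> h.
have h0 : h != 0 by near: h; exact: nbhs_dnbhs_neq.
have : `|h| < d%:C%C by near: h; apply: dnbhs0_lt; rewrite ltcR.
move=> /ltW /l1_le_norm hd.
have hd1 : l1 h <= e.
  apply: le_trans hd _; have : d <= e / 2 by rewrite /d ge_min lexx.
  lra.
have hd2 : l1 h * (4 * (c + 1)) <= complex.Re r.
  have : d <= complex.Re r / (8 * (c + 1)) by rewrite /d ge_min lexx orbT.
  rewrite ler_pdivlMr// => hd2; have := ler_wpM2r (ltW c1) hd; lra.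
rewrite /GRing.scale /= mulr1 [h + l]addrC.
set X := F (l + h) i j - F l i j.
have -> : D i j - h^-1 * X = - (h^-1 * (X - h * D i j)).
  by rewrite [h^-1 * (_ - h * _)]mulrBr mulKf// opprB.
have hX : l1 (X - h * D i j) <= c * l1 h ^+ 2.
  have := le_trans (l1_le_nm _ i j) (hF h hd1).
  by rewrite !mxE.
have lh : 0 < l1 h.
  by rewrite lt_def l1_ge0 andbT; apply: contra h0 => /eqP/l1_eq0/eqP.
apply: le_lt_trans (norm_le_l1 _) _; rewrite rE ltcR l1N.
apply: le_lt_trans (l1M _ _) _.
apply: le_lt_trans (_ : l1 h^-1 * (c * l1 h ^+ 2) < _).
  by rewrite ler_wpM2l.
rewrite (_ : l1 h^-1 * (c * l1 h ^+ 2) = (l1 h^-1 * l1 h) * (c * l1 h)); last by ring.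
apply: le_lt_trans (_ : 2 * (c * l1 h) < _).
  by rewrite ler_wpM2r ?mulr_ge0// l1_inv.
have : 0 <= c * l1 h by rewrite mulr_ge0.
nra.
Unshelve. all: by end_near. Qed.

End Expansions.

(** * Zero curvature and wave functions *)

Section MatrixAlgebra.
Context {C : comPzRingType}.

Lemma mxDE m n (A B : 'M[C]_(m, n)) i j : (A + B) i j = A i j + B i j.
Proof. by rewrite mxE. Qed.

Lemma mxNE m n (A : 'M[C]_(m, n)) i j : (- A) i j = - A i j.
Proof. by rewrite mxE. Qed.

Lemma mxZE m n c (A : 'M[C]_(m, n)) i j : (c *: A) i j = c * A i j.
Proof. by rewrite mxE. Qed.

Lemma mx0E m n i j : (0 : 'M[C]_(m, n)) i j = 0.
Proof. by rewrite mxE. Qed.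

Lemma scalemxl m n k c (A : 'M[C]_(m, n)) (B : 'M[C]_(n, k)) :
  (c *: A) *m B = c *: (A *m B).
Proof. by rewrite scalemxAl. Qed.

Lemma scalemxr m n k c (A : 'M[C]_(m, n)) (B : 'M[C]_(n, k)) :
  A *m (c *: B) = c *: (A *m B).
Proof. by rewrite scalemxAr. Qed.

End MatrixAlgebra.

(** Identities between linear combinations of products of matrices: expand,
   then compare coefficients of the products entrywise. *)
Ltac mxexpand := rewrite ?(mulmxDl, mulmxDr, mulNmx, mulmxN, scalemxl, scalemxr,
  mulmxA, mul1mx, mulmx1, mul0mx, mulmx0).
Ltac mxabel := apply/matrixP => ? ?; rewrite ?(mxDE, mxNE, mxZE, mx0E).
Ltac mxring := mxexpand; mxabel; ring.

(** The identities behind parameter dependence and transport, over an arbitrary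
   field. *)
Section TransportAlgebra.
Context {F : fieldType} {n : nat}.
Implicit Types (Y K G U T M B : 'M[F]_n) (c l : F).

Lemma quotient_algebra Y K G U c c' :
  Y *m (c *: G + U) *m K + Y *m - ((c' *: G + U) *m K) = (c - c') *: (Y *m G *m K).
Proof. by mxring. Qed.

Lemma variation_algebra Y K T T' M :
  (Y *m M *m T + Y *m T') *m K + Y *m T *m - (M *m K) =
  Y *m (T' + M *m T - T *m M) *m K.
Proof. by mxring. Qed.

Lemma remainder_algebra Y Y' K T T0 c :
  (Y' *m K - 1%:M - c *: (Y *m T *m K - T0)) *m Y =
  Y' *m (K *m Y) - Y - c *: (Y *m T *m (K *m Y) - T0 *m Y).
Proof. by mxring. Qed.

Lemma difference_algebra Y K M U U' :
  Y *m (M + U') *m K + Y *m - ((M + U) *m K) = Y *m (U' - U) *m K.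
Proof. by mxring. Qed.

Lemma first_order_algebra Y K U U' c :
  Y *m U *m K - c *: (Y *m U' *m K) = Y *m (U - c *: U') *m K.
Proof. by mxring. Qed.

Lemma curvature_algebra M B U l : l != 0 ->
  M *m B - B *m M = l^-1 *: (B *m U - U *m B) + (l *: M + U) *m (l^-1 *: B)
    - (l^-1 *: B) *m (l *: M + U).
Proof. by move=> l0; mxexpand; mxabel; field. Qed.

Lemma two_step_algebra Y K B B' :
  Y *m B *m K + Y *m (K *m B' - B *m K) = Y *m K *m B'.
Proof. by mxring. Qed.

End TransportAlgebra.

Section Lax.
Context {R : realType} {n : nat}.
Local Notation C := R[i].
Local Notation M := 'M[C]_n.
Implicit Types (a : M) (u B : R -> R -> M) (E : R -> R -> C -> M).

(** The coefficients of the powers of the spectral parameter in the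
   zero-curvature condition of [l *: a + u] and [l^-1 *: B]. *)
Definition lax a u B : Prop :=
  [/\ smooth u, smooth B, forall x t, in_u (u x t), forall x t, in_u (B x t)
    & forall x t, dt u x t = comm a (B x t) /\ dx B x t = comm (B x t) (u x t)].

(** A trivialization in which [B] need not come from a frame: whether the dressed
   [B] has a frame is a separate question, settled only under an assumption on
   [b]. *)
Definition wave a u B E : Prop :=
  [/\ forall x t, mx_holomorphic (E x t),
      forall l, l != 0 -> partials (fun x t => E x t l)
        (fun x t => E x t l *m (l *: a + u x t))
        (fun x t => E x t l *m (l^-1 *: B x t))
    & forall l, l != 0 -> E 0 0 l = 1%:M].

Lemma trivialization_wave a b u g E :
  trivialization a b u g E <-> wave a u (fun x t => conj_by b (g x t)) E.
Proof.
split=> [[h1 h2 h3 h4 h5]|[h1 h2 h3]].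
  split=> // l l0 x t; split; apply/mderE; have [a1 a2] := h2 l l0 x t.
    by split => //; exact: h3.
  by split => //; exact: h4.
by split=> // [l l0 x t|l x t l0|l x t l0]; have [/mderE[a1 a2] /mderE[a3 a4]] := h2 l l0 x t.
Qed.

Lemma flat_const (F : R -> R -> M) :
  partials F (fun _ _ => 0) (fun _ _ => 0) -> forall x t, F x t = F 0 0.
Proof.
move=> dF x t.
rewrite (@mder_const R _ _ (F ^~ t) (fun s => (dF s t).1) x).
exact: (@mder_const R _ _ (F 0) (fun s => (dF 0 s).2) t).
Qed.

Lemma conjC_neq0 (l : C) : l != 0 -> l^* != 0.
Proof. by rewrite conjC_eq0. Qed.

Lemma lax_adjx a u (l : C) x t : in_u a -> in_u (u x t) ->
  (l^* *: a + u x t) ^t* = - (l *: a + u x t).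
Proof.
by rewrite /in_u => ha hu; rewrite adjD adjZ conjCK ha hu scalerN -opprD.
Qed.

Lemma lax_adjt B (l : C) x t : in_u (B x t) ->
  ((l^*)^-1 *: B x t) ^t* = - (l^-1 *: B x t).
Proof. by rewrite /in_u => hB; rewrite adjZ -fmorphV conjCK hB scalerN. Qed.

(** The reality condition holds at the origin and is preserved, because the
   connection matrices at conjugate parameters are opposite adjoints. *)
Lemma wave_pairing a u B E E' l x t : in_u a -> lax a u B -> wave a u B E ->
  wave a u B E' -> l != 0 -> E' x t l *m (E x t l^*) ^t* = 1%:M.
Proof.
move=> ha [su sB uu uB _] [_ dE E0] [_ dE' E0'] l0.
have l0' := conjC_neq0 l0.
rewrite (@flat_const (fun x t => E' x t l *m (E x t l^*) ^t*)) ?E0 ?E0'//.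
  by rewrite adj1 mulmx1.
move=> {}x {}t.
have [dx' dt'] := dE' l l0 x t; have [dx dt] := dE _ l0' x t; split.
  apply: mder_eq (mderM dx' (mder_adj dx)) _.
  by rewrite adjM lax_adjx// mulNmx mulmxN mulmxA subrr.
apply: mder_eq (mderM dt' (mder_adj dt)) _.
by rewrite adjM lax_adjt// mulNmx mulmxN mulmxA subrr.
Qed.

Lemma wave_unitary a u B E l x t : in_u a -> lax a u B -> wave a u B E ->
  l != 0 -> (E x t l^*) ^t* *m E x t l = 1%:M.
Proof. by move=> ha hl hE l0; apply: mulmx1C; exact: (wave_pairing x t ha hl hE hE). Qed.

Lemma wave_unit a u B E l x t : in_u a -> lax a u B -> wave a u B E ->
  l != 0 -> E x t l \in unitmx.
Proof.
by move=> ha hl hE l0; have := wave_unitary x t ha hl hE l0; case/mulmx1_unit.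
Qed.

Lemma wave_unique a u B E E' l x t : in_u a -> lax a u B -> wave a u B E ->
  wave a u B E' -> l != 0 -> E x t l = E' x t l.
Proof.
move=> ha hl hE hE' l0.
have h := wave_pairing x t ha hl hE hE' l0.
rewrite -[RHS]mulmx1 -(wave_unitary x t ha hl hE l0) mulmxA h mul1mx //.
Qed.

(** Analytic dependence of a linear ODE on a parameter entering its coefficients
   affinely through [phi]. *)
Lemma ode_param_cquad (G U : R -> M) (Y Yi : C -> R -> M) (phi : C -> C)
    (l phi' : C) (c e : R) (x : R) :
  mcts G -> (forall l, Y l 0 = 1%:M) ->
  (forall l s, mder (Y l) s (Y l s *m (phi l *: G s + U s))) ->
  (forall l s, mder (Yi l) s (- ((phi l *: G s + U s) *m Yi l s))) ->
  (forall l s, Y l s *m Yi l s = 1%:M) ->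
  0 <= c -> 0 < e -> (forall h, l1 h <= e ->
    l1 (phi (l + h) - phi l - h * phi') <= c * l1 h ^+ 2) ->
  cquad (Y ^~ x) l.
Proof.
move=> cG Y0 dY dYi YYi c0 e0 hphi.
have YiY s : Yi l s *m Y l s = 1%:M by exact: mulmx1C.
pose N s := Y l s *m G s *m Yi l s.
have cN : mcts N.
  apply: mctsM; last exact: mder_cts (dYi l).
  by apply: mctsM => //; exact: mder_cts (dY l).
have [K K0 dK] := mx_antiderivative cN.
have [cn cn0 hN] := mcts_bounded `|x| cN.
pose cc := (c + l1 phi') * cn.
have cc0 : 0 <= cc by rewrite mulr_ge0// addr_ge0.
have [D D0 hD] := @ode_perturbation R n cc `|x| cc0.
exists (phi' *: (K x *m Y l x)), (D * nm (Y l x)), (Num.min 1 e); split.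
- exact: mulr_ge0.
- by rewrite lt_min ltr01.
move=> h; rewrite le_min => /andP[h1 he].
pose Z s := Y (l + h) s *m Yi l s.
pose P s := (phi (l + h) - phi l) *: N s.
have bphi : l1 (phi (l + h) - phi l) <= (c + l1 phi') * l1 h.
  rewrite -[phi (l + h) - phi l](subrK (h * phi')).
  apply: le_trans (l1D _ _) _; rewrite mulrDl lerD//.
    apply: le_trans (hphi h he) _; rewrite ler_wpM2l// expr2.
    by rewrite ler_piMr.
  by apply: le_trans (l1M _ _) _; rewrite mulrC.
have := hD Z P K N (h * phi') (l1 h) _ _ K0 dK (l1_ge0 _) h1 _ _ x (lexx _).
move=> /(_ _ _ _ _)/le_trans hZ.
have -> : Y (l + h) x - Y l x - h *: (phi' *: (K x *m Y l x)) =
    (Z x - 1%:M - (h * phi') *: K x) *m Y l x.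
  by rewrite /Z !mulmxBl -mulmxA YiY mulmx1 mul1mx scalerA scalemxAl.
apply: le_trans (nmM _ _) _; rewrite mulrAC ler_wpM2r//.
apply: hZ => //.
- by rewrite /Z Y0 mul1mx; rewrite -[LHS]mul1mx -(Y0 l) YYi.
- move=> s; apply: mder_eq (mderM (dY _ s) (dYi l s)) _.
  rewrite /P /Z /N.
  have -> : Y (l + h) s *m Yi l s *m ((phi (l + h) - phi l) *:
      (Y l s *m G s *m Yi l s)) = (phi (l + h) - phi l) *:
      (Y (l + h) s *m (Yi l s *m Y l s) *m G s *m Yi l s).
    by rewrite -scalemxAr !mulmxA.
  by rewrite YiY mulmx1; exact: quotient_algebra.
- move=> s sx; apply: le_trans (nmZ _ _) _; rewrite /cc mulrAC.
  by apply: ler_pM => //; exact: hN.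
- move=> s sx; rewrite /P -scalerBl; apply: le_trans (nmZ _ _) _.
  rewrite /cc mulrAC; apply: ler_pM => //; last exact: hN.
  by apply: le_trans (hphi h he) _; rewrite mulrDl lerDl mulr_ge0 ?sqr_ge0.
Qed.


(** Dependence of the transport in [x] on [t]: by the zero-curvature equation
   the first-order variation is a conjugate of the [t]-connection. *)
Lemma transport_dt (M0 : M) (u : R -> R -> M) (Phi Phii : R -> R -> M)
    (T Tx : R -> M) (t x : R) :
  smooth u -> (forall t, Phi t 0 = 1%:M) ->
  (forall t s, mder (Phi t) s (Phi t s *m (M0 + u s t))) ->
  (forall t s, mder (Phii t) s (- ((M0 + u s t) *m Phii t s))) ->
  (forall t s, Phi t s *m Phii t s = 1%:M) ->
  (forall s, mder T s (Tx s)) ->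
  (forall s, dt u s t = Tx s + (M0 + u s t) *m T s - T s *m (M0 + u s t)) ->
  mder (Phi ^~ x) t (Phi t x *m T x - T 0 *m Phi t x).
Proof.
move=> su Phi0 dPhi dPhii PP dT curv.
have PiP s : Phii t s *m Phi t s = 1%:M by exact: mulmx1C.
have Phii0 s : Phii s 0 = 1%:M by rewrite -[LHS]mul1mx -(Phi0 s) PP.
have [pu sux sut] := smooth_partials su.
have [put _ sutt] := smooth_partials sut.
pose N s := Phi t s *m dt u s t *m Phii t s.
(* an antiderivative of [N], by the zero-curvature equation *)
pose K s := Phi t s *m T s *m Phii t s - T 0.
have dK s : mder K s (N s).
  apply: mder_eq (mderB (mderM (mderM (dPhi t s) (dT s)) (dPhii t s)) (mder_cst _ s)) _.
  by rewrite subr0 /N curv; exact: variation_algebra.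
have K0 : K 0 = 0 by rewrite /K Phi0 Phii0 mul1mx mulmx1 subrr.
pose L := Num.max `|x| (`|t| + 1).
have xL : `|x| <= L by rewrite le_max lexx.
have [c1 c10 h1] := smooth_locally_bounded sut L.
have [c2 c20 h2] := smooth_locally_bounded sutt L.
have [c3 c30 h3] := mcts_bounded L (mder_cts (dPhi t)).
have [c4 c40 h4] := mcts_bounded L (mder_cts (dPhii t)).
pose cu := c1 + (n * n)%:R * (c2 + c2).
have cu0 : 0 <= cu by rewrite addr_ge0// mulr_ge0// addr_ge0.
pose cc := c3 * cu * c4.
have cc0 : 0 <= cc by rewrite !mulr_ge0.
have [D D0 hD] := @ode_perturbation R n cc `|x| cc0.
apply: (@mder_quadratic _ _ _ _ _ _ (D * nm (Phi t x)) 1 ltr01) => h hlt1.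
have tL s : `|s - t| <= `|h| -> `|s| <= L.
  move=> st; rewrite le_max; apply/orP; right.
  by have := ler_normD (s - t) t; rewrite subrK; lra.
have taylor s : `|s| <= L ->
    nm (u s (t + h) - u s t - (h%:C)%C *: dt u s t) <= (n * n)%:R * (c2 + c2) * h ^+ 2.
  move=> sL; apply: (@mder_taylor _ _ _ (u s) (dt u s) (dt (dt u) s)).
  - by move=> r; have [] := pu s r.
  - by move=> r; have [] := put s r.
  - by move=> r /tL rL; exact: h2.
have h20 : h ^+ 2 <= `|h|.
  by rewrite -real_normK ?num_real// expr2 ler_piMr// ltW.
have diff s : `|s| <= L -> nm (u s (t + h) - u s t) <= cu * `|h|.
  move=> sL; rewrite -[u s (t + h) - u s t](subrK ((h%:C)%C *: dt u s t)) addrC.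
  apply: le_trans (nmD _ _) _; rewrite /cu mulrDl lerD//.
    apply: le_trans (nmZ _ _) _; rewrite l1_real mulrC ler_wpM2r// h1//.
    by apply: tL; rewrite subrr normr0.
  by apply: le_trans (taylor s sL) _; rewrite ler_wpM2l// mulr_ge0// addr_ge0.
pose Z s := Phi (t + h) s *m Phii t s.
pose P s := Phi t s *m (u s (t + h) - u s t) *m Phii t s.
have hZ := hD Z P K N (h%:C)%C `|h| _ _ K0 dK (normr_ge0 _) (ltW hlt1) _ _ x (lexx _).
rewrite (_ : Phi (t + h) x - Phi t x - _ = (Z x - 1%:M - (h%:C)%C *: K x) *m Phi t x); last first.
  have -> : (Z x - 1%:M - (h%:C)%C *: K x) *m Phi t x =
      Phi (t + h) x *m (Phii t x *m Phi t x) - Phi t x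
      - (h%:C)%C *: (Phi t x *m T x *m (Phii t x *m Phi t x) - T 0 *m Phi t x).
    exact: remainder_algebra.
  by rewrite PiP !mulmx1.
apply: le_trans (nmM _ _) _; rewrite mulrAC ler_wpM2r//.
rewrite -[h ^+ 2]real_normK ?num_real//.
apply: hZ.
- by rewrite /Z Phi0 Phii0 mul1mx.
- move=> s; apply: mder_eq (mderM (dPhi _ s) (dPhii t s)) _.
  rewrite /P /Z.
  have -> : Phi (t + h) s *m Phii t s *m (Phi t s *m (u s (t + h) - u s t)
      *m Phii t s) = Phi (t + h) s *m (Phii t s *m Phi t s)
      *m (u s (t + h) - u s t) *m Phii t s by rewrite !mulmxA.
  by rewrite PiP mulmx1; exact: difference_algebra.
- move=> s sx; have sL := le_trans sx xL.
  apply: le_trans (nmM _ _) _; rewrite /cc mulrAC; apply: ler_pM => //.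
    by apply: le_trans (nmM _ _) _; rewrite -mulrA; apply: ler_pM; rewrite ?h3 ?diff.
  exact: h4.
- move=> s sx; have sL := le_trans sx xL.
  have -> : P s - (h%:C)%C *: N s =
      Phi t s *m (u s (t + h) - u s t - (h%:C)%C *: dt u s t) *m Phii t s.
    exact: first_order_algebra.
  apply: le_trans (nmM _ _) _; rewrite /cc mulrAC; apply: ler_pM => //; last exact: h4.
  apply: le_trans (nmM _ _) _; rewrite -mulrA; apply: ler_pM => //; first exact: h3.
  apply: le_trans (taylor s sL) _; rewrite real_normK ?num_real//.
  by rewrite ler_wpM2r ?sqr_ge0// lerDr.
Qed.

(** Opposite adjoint coefficients make the adjoint of one solution the inverse of
   the other; for skew coefficients the other one is the solution at the conjugate
   parameter. *)
Lemma adjoint_solution (Y Z P Q : R -> M) : Y 0 = 1%:M -> Z 0 = 1%:M ->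
  (forall s, mder Y s (Y s *m P s)) -> (forall s, mder Z s (Z s *m Q s)) ->
  (forall s, (Q s) ^t* = - P s) ->
  (forall s, mder (fun s => (Z s) ^t*) s (- (P s *m (Z s) ^t*))) /\
  (forall s, Y s *m (Z s) ^t* = 1%:M).
Proof.
move=> Y0 Z0 dY dZ QP.
have dZa s : mder (fun s => (Z s) ^t*) s (- (P s *m (Z s) ^t*)).
  by apply: mder_eq (mder_adj (dZ s)) _; rewrite adjM QP mulNmx.
split=> // s; rewrite (@mder_const R _ _ (fun s => Y s *m (Z s) ^t*)) ?Y0 ?Z0.
  by rewrite adj1 mulmx1.
move=> r; apply: mder_eq (mderM (dY r) (dZa r)) _.
by rewrite mulmxN mulmxA subrr.
Qed.

(** Solve along the line [x = 0] in [t], then along each horizontal line in [x].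
   The equation in [t] off the line [x = 0] is the zero-curvature condition. *)
Lemma wave_exists a u B : in_u a -> lax a u B -> exists E, wave a u B E.
Proof.
move=> ha [su sB uu uB curv].
have [pu _ _] := smooth_partials su; have [pB _ _] := smooth_partials sB.
have cA (l : C) t : mcts (fun s => l *: a + u s t).
  apply: (@mder_cts R n n _ (fun s => 0 + dx u s t)) => s.
  by apply: mderD; [exact: mder_cst|have [] := pu s t].
have cB (l : C) : mcts (fun s => l^-1 *: B 0 s).
  apply: (@mder_cts R n n _ (fun s => l^-1 *: dt B 0 s)) => s.
  by apply: mderZ; have [] := pB 0 s.
have [Phi' hPhi] := choice (fun lt : C * R =>
  let: ex_intro2 Y h0 h1 := linear_ode (cA lt.1 lt.2) in
  ex_intro (fun Y => Y 0 = 1%:M /\ forall s, mder Y s (Y s *m (lt.1 *: a + u s lt.2)))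
    Y (conj h0 h1)).
have [Psi hPsi] := choice (fun l : C =>
  let: ex_intro2 Y h0 h1 := linear_ode (cB l) in
  ex_intro (fun Y => Y 0 = 1%:M /\ forall s, mder Y s (Y s *m (l^-1 *: B 0 s)))
    Y (conj h0 h1)).
pose Phi l t := Phi' (l, t).
have Phi0 l t : Phi l t 0 = 1%:M by have [] := hPhi (l, t).
have dPhi l t s : mder (Phi l t) s (Phi l t s *m (l *: a + u s t)).
  by have [_] := hPhi (l, t); exact.
have Psi0 l : Psi l 0 = 1%:M by have [] := hPsi l.
have dPsi l s : mder (Psi l) s (Psi l s *m (l^-1 *: B 0 s)) by have [_] := hPsi l; exact.
have Phi_adj l t := adjoint_solution (Phi0 l t) (Phi0 l^* t) (dPhi l t) (dPhi l^* t)
  (fun s => lax_adjx l ha (uu s t)).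
have Psi_adj l := adjoint_solution (Psi0 l) (Psi0 l^*) (dPsi l) (dPsi l^*)
  (fun s => lax_adjt l (uB 0 s)).
exists (fun x t l => Psi l t *m Phi l t x); split.
- move=> x t; apply: cquad_holomorphic => l l0; apply: cquadM.
    apply: (@ode_param_cquad (B 0) (fun=> 0) Psi
      (fun l s => (Psi l^* s) ^t*) (fun l => l^-1) l (- l^-2)
      (l1 (l^-2) * (2 / (l1 l / 2))) (l1 l / 2)) => //.
    + apply: (@mder_cts R n n _ (dt B 0)) => s; by have [] := pB 0 s.
    + by move=> k s; rewrite addr0.
    + by move=> k s; rewrite addr0; have [+ _] := Psi_adj k; exact.
    + by move=> k s; have [_] := Psi_adj k; exact.
    + by rewrite mulr_ge0// divr_ge0// divr_ge0.
    + rewrite divr_gt0// lt_def l1_ge0 andbT.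
      by apply: contra l0 => /eqP/l1_eq0/eqP.
    + move=> h hl.
      have lh : l1 l / 2 <= l1 (l + h).
        by have := l1D (l + h) (- h); rewrite addrK l1N; lra.
      have lpos : 0 < l1 l.
        rewrite lt_def l1_ge0 andbT.
        by apply: contra l0 => /eqP/l1_eq0/eqP.
      have lh0 : l + h != 0.
        by apply/negP => /eqP e; move: lh; rewrite e l10; lra.
      have -> : (l + h)^-1 - l^-1 - h * - l^-2 = l^-2 * (l + h)^-1 * (h * h).
        by field; rewrite l0 lh0.
      apply: le_trans (l1M _ _) _; apply: ler_pM => //; last first.
        by rewrite expr2; exact: l1M.
      apply: le_trans (l1M _ _) _; rewrite ler_wpM2l// ler_pdivlMr ?divr_gt0//.
      by apply: le_trans (l1_inv lh0); rewrite ler_wpM2l.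
  apply: (@ode_param_cquad (fun=> a) (u ^~ t) (fun l => Phi l t)
      (fun l s => (Phi l^* t s) ^t*) id l 1 0 1) => //.
  + exact: (mder_cts (fun s => mder_cst a s)).
  + by move=> k s; have [+ _] := Phi_adj k t; exact.
  + by move=> k s; have [_] := Phi_adj k t; exact.
  + move=> h _; rewrite (_ : id (l + h) - id l - h * 1 = 0); last by rewrite /=; ring.
    by rewrite l10 mul0r.
- move=> l l0 x t; split.
    by apply: mder_eq (mderMl _ (dPhi l t x)) _; rewrite mulmxA.
  have h := @transport_dt (l *: a) u (Phi l) (fun t s => (Phi l^* t s) ^t*)
    (fun s => l^-1 *: B s t) (fun s => l^-1 *: dx B s t) t x su (Phi0 l) (dPhi l)
    (fun t => (Phi_adj l t).1) (fun t => (Phi_adj l t).2).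
  apply: mder_eq (mderM (dPsi l t) (h _ _)) _.
  + by move=> s; apply: mderZ; have [] := pB s t.
  + move=> s; have [-> ->] := curv s t; exact: curvature_algebra.
  + exact: two_step_algebra.
- by move=> l l0; rewrite Psi0 Phi0 mulmx1.
Qed.

End Lax.

(** * Moving projections *)

Lemma proj_flow_algebra (F : fieldType) (n : nat) (p q T T' : 'M[F]_n) :
  (1%:M - q) *m T *m q + q *m T' *m (1%:M - q)
  - ((1%:M - p) *m T *m p + p *m T' *m (1%:M - p)) =
  (1%:M - p) *m T *m (q - p) - (q - p) *m T *m q
  + (q - p) *m T' *m (1%:M - q) - p *m T' *m (q - p).
Proof. by mxring. Qed.

Section Projections.
Context {R : realType} {n : nat}.
Local Notation C := R[i].
Local Notation M := 'M[C]_n.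

Lemma sqnormE m (w : 'rV[C]_m) : (w *m w ^t*) 0 0 = \sum_j `|w 0 j| ^+ 2.
Proof. by rewrite mxE; apply: eq_bigr => j _; rewrite !mxE normCK. Qed.

Lemma sqnorm_ge0 m (w : 'rV[C]_m) : 0 <= (w *m w ^t*) 0 0.
Proof. by rewrite sqnormE; apply: sumr_ge0 => j _; rewrite exprn_ge0. Qed.

Lemma sqnorm_eq0 m (w : 'rV[C]_m) : (w *m w ^t*) 0 0 = 0 -> w = 0.
Proof.
rewrite sqnormE => /eqP; rewrite psumr_eq0 => [/allP h|j _]; last first.
  by rewrite exprn_ge0.
apply/rowP => j; rewrite mxE; apply/eqP; rewrite -normr_eq0 -sqrf_eq0.
exact: h (mem_index_enum j).
Qed.

Lemma unitmx_inj (A : M) : (forall v : 'rV_n, v *m A = 0 -> v = 0) -> A \in unitmx.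
Proof.
move=> h; rewrite -row_free_unit -kermx_eq0; apply/eqP/row_matrixP => i.
by rewrite row0; apply: h; rewrite -row_mul mulmx_ker row0.
Qed.

Lemma gram_sum_ker (Q P : M) (v : 'rV_n) :
  v *m (Q ^t* *m Q + P *m P ^t*) = 0 -> v *m Q ^t* = 0 /\ v *m P = 0.
Proof.
move=> h; have : (v *m Q ^t*) *m (v *m Q ^t*) ^t* + (v *m P) *m (v *m P) ^t* = 0.
  by rewrite !adjM adjK -[RHS](mul0mx _ (v ^t*)) -h; mxring.
move=> /(congr1 (fun X : matrix C 1 1 => X 0 0)); rewrite mxDE mx0E => /eqP.
by rewrite paddr_eq0 ?sqnorm_ge0// => /andP[/eqP/sqnorm_eq0 h1 /eqP/sqnorm_eq0 h2].
Qed.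

(** For an invertible [A], the orthogonal projection onto the image under [A] of
   the range of the projection [q], written so that it is visibly as regular as
   [A]. *)
Definition image_proj (A q : M) : M :=
  (A *m q) *m invmx ((A *m q) ^t* *m (A *m q) + (1%:M - q)) *m (A *m q) ^t*.

Section ImageProj.
Variables (A q : M).
Hypotheses (uA : A \in unitmx) (hq : hermitian_projection q).
Let Q := A *m q.
Let S := Q ^t* *m Q + (1%:M - q).

Let q2 : q *m q = q. Proof. by case: hq. Qed.
Let qs : q ^t* = q. Proof. by case: hq. Qed.
Let Qq : Q *m q = Q. Proof. by rewrite /Q -mulmxA q2. Qed.

Lemma image_gram_unit : S \in unitmx.
Proof.
apply: unitmx_inj => v vS.
have idem : (1%:M - q) = (1%:M - q) *m (1%:M - q) ^t*.
  rewrite adjB adj1 qs mulmxBl mul1mx mulmxBr mulmx1 q2 subrr subr0 //.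
have [h1 h2] : v *m Q ^t* = 0 /\ v *m (1%:M - q) = 0.
  by apply: gram_sum_ker; rewrite -idem.
have vq : v = v *m q.
  by move/eqP: h2; rewrite mulmxBr mulmx1 subr_eq0 => /eqP.
move: h1; rewrite /Q adjM qs mulmxA -vq => h1.
have uAs : A ^t* \in unitmx by rewrite map_unitmx unitmx_tr.
by rewrite -[v](mulmxK uAs) h1 mul0mx.
Qed.

Let QQ : Q ^t* *m Q = S *m q.
Proof. by rewrite /S mulmxDl mulmxBl mul1mx q2 subrr addr0 -mulmxA Qq. Qed.

Lemma image_proj_fix : image_proj A q *m (A *m q) = A *m q.
Proof.
rewrite /image_proj -/Q -/S -mulmxA QQ -mulmxA (mulmxA (invmx S)).
by rewrite mulVmx ?image_gram_unit// mul1mx Qq.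
Qed.

Lemma image_proj_hermitian : hermitian_projection (image_proj A q).
Proof.
split; last by rewrite {2}/image_proj -mulmxA mulmxA image_proj_fix mulmxA.
have Ss : S ^t* = S by rewrite /S adjD adjM adjK adjB adj1 qs.
have Is : (invmx S) ^t* = invmx S by rewrite trmx_inv map_invmx Ss.
by rewrite /image_proj -/Q -/S (adjM _ (Q ^t*)) adjK (adjM Q) Is mulmxA.
Qed.

End ImageProj.

Lemma image_proj1 (q : M) : hermitian_projection q -> image_proj 1%:M q = q.
Proof.
case=> qs q2; rewrite /image_proj mul1mx qs q2 addrC subrK.
by rewrite invmx1 mulmx1 q2.
Qed.

Lemma range_image_proj (A q : M) : A \in unitmx -> hermitian_projection q ->
  range (mulmx (image_proj A q) : 'cV[C]_n -> 'cV[C]_n)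
  = mulmx A @` range (mulmx q : 'cV[C]_n -> 'cV[C]_n).
Proof.
move=> uA hq; apply/seteqP; split=> [_ [v _ <-]|_ [_ [v _ <-] <-]].
  by rewrite /image_proj -!mulmxA; eexists; [eexists; [|reflexivity]|].
by exists (A *m (q *m v)); rewrite // !mulmxA -(mulmxA _ A) image_proj_fix.
Qed.

(** The vector field on projections induced by the linear equation [A' = T A]. *)
Definition proj_flow (T p : M) : M :=
  (1%:M - p) *m T *m p + p *m T ^t* *m (1%:M - p).

(** The derivative [D] of [p] exists by the formula for [p]. It satisfies
   [D = D *m p + p *m D], where [p *m D] is the adjoint of [D *m p], and
   differentiating [p *m (A *m q) = A *m q] computes [D *m p]. *)
Lemma image_proj_mder (A : R -> M) (q T : M) (s : R) :
  (forall r, A r \in unitmx) -> hermitian_projection q ->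
  mder A s (T *m A s) ->
  mder (fun r => image_proj (A r) q) s (proj_flow T (image_proj (A s) q)).
Proof.
move=> uA hq dA.
have dQ : mder (fun r => A r *m q) s (T *m (A s *m q)).
  by apply: mder_eq (mderMr q dA) _; rewrite mulmxA.
have dQs := mder_adj dQ.
have dS := mderD (mderM dQs dQ) (mder_cst (1%:M - q) s).
have dI := mder_inv (fun r => image_gram_unit (uA r) hq) dS.
have dP := mderM (mderM dQ dI) dQs.
set D := (X in mder _ _ X) in dP.
change (mder (fun r => image_proj (A r) q) s D) in dP.
apply: (mder_eq dP); clearbody D.
have fixp r := image_proj_fix (uA r) hq.
have herm r := image_proj_hermitian (uA r) hq.
set p := image_proj (A s) q.
have DQ : D *m (A s *m q) = (1%:M - p) *m T *m (A s *m q).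
  have := mderM dP dQ; rewrite (_ : (fun r => _) = (fun r => A r *m q)); last first.
    by apply/funext => r; exact: fixp.
  move=> /mder_uniq /(_ dQ) h; apply: (addIr (p *m (T *m (A s *m q)))).
  by rewrite [LHS]h; mxring.
have Dp : D *m p = (1%:M - p) *m T *m p.
  by rewrite {1 3}/p /image_proj -/p !mulmxA -!(mulmxA _ (A s)) DQ !mulmxA.
have Dadj : D ^t* = D.
  apply: (mder_uniq (F := fun r => image_proj (A r) q) _ dP).
  apply: mder_ext (mder_adj dP) => r; by have [] := herm r.
have Dsum : D = D *m p + p *m D.
  apply: (mder_uniq dP); apply: mder_ext (mderM dP dP) => r.
  by have [] := herm r.
have ps : p ^t* = p by have [] := herm s.
clear fixp herm DQ; clearbody p.
have pD : p *m D = (D *m p) ^t* by rewrite adjM Dadj ps.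
by rewrite Dsum pD Dp !adjM adjB adj1 ps mulmxA.
Qed.

(** [p = p *m p] bounds the diagonal entries of [p] by [1], and these bound the
   squared moduli of the other entries. *)
Lemma proj_bounded (p : M) : hermitian_projection p -> nm p <= (n * n)%:R * (1 + 1).
Proof.
move=> [ps p2]; apply: nm_le => i j; apply: l1_le_norm.
have pii k : p k k = \sum_l `|p k l| ^+ 2.
  rewrite -{1}p2 mxE; apply: eq_bigr => l _; rewrite -{2}ps !mxE normCK //.
have sq k l : `|p k l| ^+ 2 <= p k k.
  rewrite [leRHS]pii (bigD1 l)//= lerDl; apply: sumr_ge0 => *.
  by rewrite exprn_ge0.
have p0 k : 0 <= p k k by rewrite pii; apply: sumr_ge0 => *; rewrite exprn_ge0.
have p1 k : p k k <= 1.
  have := sq k k; rewrite ger0_norm// expr2.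
  have [->|k0] := eqVneq (p k k) 0; first by rewrite ler01.
  by rewrite ger_pMr// lt_def k0 p0.
by rewrite -(ler_pXn2r (n := 2)) ?nnegrE// expr1n (le_trans (sq i j)).
Qed.

Lemma compl_hermitian (p : M) : hermitian_projection p ->
  hermitian_projection (1%:M - p).
Proof.
move=> [ps p2]; split; first by rewrite adjB adj1 ps.
by rewrite mulmxBl mul1mx mulmxBr mulmx1 p2 subrr subr0.
Qed.

(** The field [proj_flow] is Lipschitz on projections, which are bounded. *)
Lemma proj_flow_lipschitz (T p q : M) :
  hermitian_projection p -> hermitian_projection q ->
  nm (proj_flow T q - proj_flow T p) <=
  4 * (nm T * ((n * n)%:R * (1 + 1))) * nm (q - p).
Proof.
move=> hp hq; set k := _ * (1 + 1); rewrite /proj_flow proj_flow_algebra.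
have [kp kp' kq'] : [/\ nm p <= k, nm (1%:M - p) <= k & nm (1%:M - q) <= k].
  by split; apply: proj_bounded => //; exact: compl_hermitian.
have kq : nm q <= k by exact: proj_bounded.
have b3 (A B D : M) (x y : R) : nm A <= x -> nm D <= y ->
    nm (A *m B *m D) <= x * nm B * y.
  move=> Ax Dy; apply: le_trans (nmM _ _) _; apply: ler_pM => //.
  by apply: le_trans (nmM _ _) _; rewrite ler_wpM2r.
have T4 : 4 * (nm T * k) * nm (q - p) = k * nm T * nm (q - p)
    + nm (q - p) * nm T * k + nm (q - p) * nm T * k + k * nm T * nm (q - p) by ring.
rewrite T4; apply: le_trans (nmB _ _) _; apply: lerD; last first.
  by rewrite -(nm_adj T); exact: b3.
apply: le_trans (nmD _ _) _; apply: lerD; last by rewrite -(nm_adj T); exact: b3.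
by apply: le_trans (nmB _ _) _; apply: lerD; exact: b3.
Qed.

Lemma proj_flow_unique (q p T : R -> M) : mcts T ->
  (forall s, hermitian_projection (q s)) -> (forall s, hermitian_projection (p s)) ->
  (forall s, mder q s (proj_flow ((T s) ^t*) (q s))) ->
  (forall s, mder p s (proj_flow ((T s) ^t*) (p s))) ->
  q 0 = p 0 -> forall s, q s = p s.
Proof.
move=> cT hq hp dq dp e0 s; apply/eqP; rewrite -subr_eq0; apply/eqP.
apply: (gronwall_eq0 (fun s => mderB (dq s) (dp s))); last by rewrite e0 subrr.
move=> L; have [c c0 hc] := mcts_bounded L cT.
exists (4 * (c * ((n * n)%:R * (1 + 1)))); first by rewrite !mulr_ge0.
move=> r rL; apply: le_trans (proj_flow_lipschitz _ (hp r) (hq r)) _.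
by rewrite ler_wpM2r// ler_wpM2l// ler_wpM2r ?mulr_ge0// nm_adj hc.
Qed.

End Projections.

(** * Dressing by a simple element *)

(** The algebraic identities behind dressing, with the conjugate of [z]
   replaced by an independent scalar [w]. *)
Section DressingAlgebra.
Context {F : fieldType} {n : nat}.
Implicit Types (a b p v : 'M[F]_n) (z w l : F).

Lemma proj_flow_x_algebra a p v z w : p *m p = p ->
  (1%:M - p) *m (w *: - a - v) *m p + p *m (z *: a + v) *m (1%:M - p) =
  (p *m v - v *m p) + z *: (p *m a - a *m p)
  - (z - w) *: ((p *m a - a *m p) *m p).
Proof.
move=> p2; have pp m (X : 'M[F]_(m, n)) : X *m p *m p = X *m p by rewrite -mulmxA p2.
by mxexpand; rewrite ?pp; mxabel; ring.
Qed.

(** The right-hand side of the equation in [t], with [w] for the conjugate of [z]. *)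
Definition tflow z w b p : 'M[F]_n := (z * w)^-1 *:
  ((z - w) *: (p *m b *m p) - z *: (b *m p) + w *: (p *m b)).

Lemma proj_flow_t_algebra p b z w : z != 0 -> w != 0 ->
  (1%:M - p) *m (w^-1 *: - b) *m p + p *m (z^-1 *: b) *m (1%:M - p) =
  tflow z w b p.
Proof.
by move=> z0 w0; rewrite /tflow; mxexpand; mxabel; field; rewrite z0 w0.
Qed.

Lemma simple_conj_algebra p b z w : z != 0 -> w != 0 ->
  (z * w)^-1 *: (((0 - z) *: 1%:M + (z - w) *: p) *m b *m
                 ((0 - w) *: 1%:M - (z - w) *: p)) =
  b - (z - w) *: tflow z w b p.
Proof.
by move=> z0 w0; rewrite /tflow; mxexpand; mxabel; field; rewrite z0 w0.
Qed.

Lemma simple_flow_x_algebra a p v z w l : p *m p = p ->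
  (z - w) *: ((p *m v - v *m p) + z *: (p *m a - a *m p)
              - (z - w) *: ((p *m a - a *m p) *m p)) =
  ((l - z) *: 1%:M + (z - w) *: p) *m (l *: a + v)
  - (l *: a + (v + (z - w) *: (p *m a - a *m p)))
    *m ((l - z) *: 1%:M + (z - w) *: p).
Proof.
move=> p2; have pp m (X : 'M[F]_(m, n)) : X *m p *m p = X *m p by rewrite -mulmxA p2.
by mxexpand; rewrite ?pp; mxabel; ring.
Qed.

Lemma simple_flow_t_algebra p b z w l : z != 0 -> w != 0 -> l != 0 ->
  p *m p = p ->
  (z - w) *: tflow z w b p =
  ((l - z) *: 1%:M + (z - w) *: p) *m (l^-1 *: b)
  - (l^-1 *: (b - (z - w) *: tflow z w b p)) *m ((l - z) *: 1%:M + (z - w) *: p).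
Proof.
move=> z0 w0 l0 p2; rewrite /tflow.
have pp m (X : 'M[F]_(m, n)) : X *m p *m p = X *m p by rewrite -mulmxA p2.
by mxexpand; rewrite ?pp; mxabel; field; rewrite z0 w0 l0.
Qed.

Lemma dress_curvature_algebra a p b z w :
  (a *m b - b *m a) + (z - w) *: (tflow z w b p *m a - a *m tflow z w b p) =
  a *m (b - (z - w) *: tflow z w b p) - (b - (z - w) *: tflow z w b p) *m a.
Proof. by move: (tflow z w b p) => X; mxring. Qed.

Lemma conj_flow_algebra a b v (N N' : 'M[F]_n) w :
  w *: (((N *m v - a *m N) *m b + N *m (b *m v - v *m b)) *m N'
        + (N *m b) *m (- v *m N' - N' *m - a)) =
  (w *: (N *m b *m N')) *m a - a *m (w *: (N *m b *m N')) :> 'M[F]_n.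
Proof. by mxring. Qed.

Lemma intertwine_algebra (E N K A A' : 'M[F]_n) :
  (E *m A' *m N + E *m (N *m A - A' *m N)) *m K + (E *m N) *m (- A *m K) = 0.
Proof. by mxring. Qed.

Lemma simple_element_algebra p z w l : l - w != 0 ->
  p + ((l - z) / (l - w)) *: (1%:M - p) =
  (l - w)^-1 *: ((l - z) *: 1%:M + (z - w) *: p).
Proof. by move=> lw; mxexpand; mxabel; field. Qed.

End DressingAlgebra.

Section SimpleDressing.
Context {R : realType} {n : nat}.
Local Notation C := R[i].
Local Notation M := 'M[C]_n.
Implicit Types (a p : M) (z l : C) (u B : R -> R -> M) (E : R -> R -> C -> M).

Lemma nonreal_neq0 z : z \isn't Num.real -> z != 0.
Proof. by apply: contra => /eqP ->; exact: real0. Qed.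

(** The polynomial [(l - z^* ) g_{z,p}(l)]. *)
Definition simple_num z p l : M := (l - z)%:M + (z - z^*) *: p.

Lemma simple_elementE z p l : l != z^* ->
  simple_element z p l = (l - z^*)^-1 *: simple_num z p l.
Proof.
rewrite -subr_eq0 => lz; rewrite /simple_num -(scalemx1 _ (l - z)).
exact: simple_element_algebra.
Qed.

Lemma proj_flow_x a p z (v : M) : in_u a -> in_u v -> p *m p = p ->
  proj_flow ((z *: a + v) ^t*) p =
  comm p v + z *: comm p a - (z - z^*) *: (comm p a *m p).
Proof.
by move=> ha hv p2; rewrite /proj_flow adjK adjD adjZ ha hv; exact: proj_flow_x_algebra.
Qed.

Lemma proj_flow_t p z (v : M) : z != 0 -> in_u v ->
  proj_flow ((z^-1 *: v) ^t*) p = tflow z z^* v p.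
Proof.
move=> z0 hv; rewrite /proj_flow adjK adjZ hv fmorphV.
by apply: proj_flow_t_algebra => //; rewrite conjC_eq0.
Qed.

Definition dress_u a z u (p : R -> R -> M) x t := u x t + (z - z^*) *: comm (p x t) a.

(** Conjugation of [B] by the value at [0] of the simple element. *)
Definition dress_B z B (p : R -> R -> M) x t : M := (z * z^*)^-1 *:
  (simple_num z (p x t) 0 *m B x t *m (simple_num z (p x t) 0) ^t*).

Lemma simple_num_adj z p l : p ^t* = p ->
  (simple_num z p l) ^t* = (l^* - z^*)%:M - (z - z^*) *: p.
Proof.
move=> ps; rewrite /simple_num adjD adjZ ps -(scalemx1 _ (l - z)) adjZ adj1.
by rewrite scalemx1 !rmorphB /= conjCK -scaleNr opprB.
Qed.

Lemma dress_BE z B (p : R -> R -> M) x t : z != 0 -> (p x t) ^t* = p x t ->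
  dress_B z B p x t = B x t - (z - z^*) *: tflow z z^* (B x t) (p x t).
Proof.
move=> z0 ps; rewrite /dress_B simple_num_adj// /simple_num rmorph0.
rewrite -!(scalemx1 n (_ - _)); apply: simple_conj_algebra => //.
by rewrite conjC_eq0.
Qed.

(** The numerators of the simple elements built on [p] intertwine the two linear
   systems, for every value of the spectral variable. *)
Lemma simple_num_flow_x a z l (p v : M) : p *m p = p ->
  (z - z^*) *: (comm p v + z *: comm p a - (z - z^*) *: (comm p a *m p)) =
  simple_num z p l *m (l *: a + v)
  - (l *: a + (v + (z - z^*) *: comm p a)) *m simple_num z p l.
Proof.
move=> p2; rewrite /simple_num -(scalemx1 n (l - z)).
exact: simple_flow_x_algebra.
Qed.

Lemma simple_num_flow_t z l B (p : R -> R -> M) x t : z != 0 -> l != 0 ->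
  hermitian_projection (p x t) ->
  (z - z^*) *: tflow z z^* (B x t) (p x t) =
  simple_num z (p x t) l *m (l^-1 *: B x t)
  - (l^-1 *: dress_B z B p x t) *m simple_num z (p x t) l.
Proof.
move=> z0 l0 [ps p2]; rewrite dress_BE// /simple_num -(scalemx1 n (l - z)).
by apply: simple_flow_t_algebra => //; rewrite conjC_eq0.
Qed.

Section WithProjection.
Variables (a : M) (z : C) (u B p : R -> R -> M).
Hypotheses (ha : in_u a) (hz : z \isn't Num.real) (hl : lax a u B).
Hypothesis hp : forall x t, hermitian_projection (p x t).
Hypothesis dp : partials p
  (fun x t => proj_flow ((z *: a + u x t) ^t*) (p x t))
  (fun x t => proj_flow ((z^-1 *: B x t) ^t*) (p x t)).

Let z0 : z != 0. Proof. exact: nonreal_neq0. Qed.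
Let ps x t : (p x t) ^t* = p x t. Proof. by case: (hp x t). Qed.
Let p2 x t : p x t *m p x t = p x t. Proof. by case: (hp x t). Qed.
Let uu x t : in_u (u x t). Proof. by case: hl. Qed.
Let uB x t : in_u (B x t). Proof. by case: hl. Qed.

Lemma simple_num_dx l x t : mder (fun s => simple_num z (p s t) l) x
  (simple_num z (p x t) l *m (l *: a + u x t)
   - (l *: a + dress_u a z u p x t) *m simple_num z (p x t) l).
Proof.
have [d _] := dp x t.
apply: mder_eq (mderD (mder_cst _ x) (mderZ (z - z^*) d)) _.
by rewrite add0r proj_flow_x// (simple_num_flow_x _ _ l).
Qed.

Lemma simple_num_dt l x t : l != 0 -> mder (fun s => simple_num z (p x s) l) t
  (simple_num z (p x t) l *m (l^-1 *: B x t)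
   - (l^-1 *: dress_B z B p x t) *m simple_num z (p x t) l).
Proof.
move=> l0; have [_ d] := dp x t.
apply: mder_eq (mderD (mder_cst _ t) (mderZ (z - z^*) d)) _.
by rewrite add0r proj_flow_t// (simple_num_flow_t (l := l)).
Qed.

(** The partial derivatives are polynomial in [p], [u] and [B], and projections are
   uniformly bounded. *)
Lemma dress_proj_smooth : smooth p.
Proof.
have [su sB _ _ _] := hl.
have bp x t : nm (p x t) <= (n * n)%:R * (1 + 1) by exact: proj_bounded.
have b1p x t : nm (1%:M - p x t) <= (n * n)%:R * (1 + 1).
  apply: proj_bounded; split; first by rewrite adjB adj1 ps.
  by rewrite mulmxBl mul1mx mulmxBr mulmx1 p2 subrr subr0.
have lb (T : R -> R -> M) : locally_bounded T ->
    locally_bounded (fun x t => proj_flow ((T x t) ^t*) (p x t)).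
  move=> bT L; have [c c0 hc] := bT L.
  pose k : R := (n * n)%:R * (1 + 1).
  have k0 : 0 <= k by rewrite mulr_ge0.
  exists (k * c * k + k * c * k); first by rewrite addr_ge0// !mulr_ge0.
  move=> x t xL tL; apply: le_trans (nmD _ _) _; apply: lerD.
    apply: le_trans (nmM _ _) _; apply: ler_pM => //.
    apply: le_trans (nmM _ _) _; apply: ler_pM => //.
    by rewrite nm_adj hc.
  apply: le_trans (nmM _ _) _; apply: ler_pM => //.
  apply: le_trans (nmM _ _) _; apply: ler_pM => //.
  by rewrite !nm_adj hc.
have kflow (T : R -> R -> M) k : mCks k T -> mCks k p ->
    mCks k (fun x t => proj_flow ((T x t) ^t*) (p x t)).
  move=> kT kp; apply: mCksD; repeat (apply: mCksM => //).
  - by apply: mCksB => //; exact: mCks_cst.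
  - exact: mCks_adj.
  - by apply: mCks_adj; exact: mCks_adj.
  - by apply: mCksB => //; exact: mCks_cst.
have kA k : mCks k (fun x t => z *: a + u x t).
  by apply: mCksD; [exact: mCks_cst|exact: (smoothP u).1].
have kT k : mCks k (fun x t => z^-1 *: B x t).
  by apply: mCksZ; exact: (smoothP B).1.
apply: (smooth_bootstrap dp).
- by apply: (lb (fun x t => z *: a + u x t)); apply: smooth_locally_bounded; exact/smoothP.
- by apply: (lb (fun x t => z^-1 *: B x t)); apply: smooth_locally_bounded; exact/smoothP.
- by move=> k kp; split; [exact: (kflow (fun x t => z *: a + u x t))
                         |exact: (kflow (fun x t => z^-1 *: B x t))].
Qed.

Lemma comm_proj_adj q : q ^t* = q -> (comm q a) ^t* = comm q a.
Proof. by move=> qs; rewrite /comm adjB !adjM qs ha; mxring. Qed.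

Lemma dress_u_skew x t : in_u (dress_u a z u p x t).
Proof.
rewrite /in_u /dress_u adjD adjZ comm_proj_adj// uu rmorphB /= conjCK.
by rewrite opprD -scaleNr opprB.
Qed.

(** [dress_B] is a conjugate of [B] by the value at [0] of the intertwiner, so its
   equation in [x] is the intertwining relation at [0]. *)
Lemma dress_lax : lax a (dress_u a z u p) (dress_B z B p).
Proof.
have sp := dress_proj_smooth.
have [su sB _ _ curv] := hl.
have [pu _ _] := smooth_partials su; have [pB _ _] := smooth_partials sB.
have kp k : mCks k p by exact: (smoothP p).1.
have knum k : mCks k (fun x t => simple_num z (p x t) 0).
  by apply: mCksD; [exact: mCks_cst|exact: mCksZ].
split.
- apply/smoothP => k; apply: mCksD; first exact: (smoothP u).1.
  by apply/mCksZ/mCksB; apply: mCksM => //; exact: mCks_cst.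
- apply/smoothP => k; apply/mCksZ/mCksM; last exact: mCks_adj.
  by apply: mCksM => //; exact: (smoothP B).1.
- exact: dress_u_skew.
- move=> x t; rewrite /in_u /dress_B adjZ !adjM adjK uB fmorphV rmorphM /= conjCK.
  by rewrite [z^* * z]mulrC mulNmx mulmxN scalerN mulmxA.
- move=> x t; split.
    suff /mderE[] : mder (dress_u a z u p x) t (comm a (dress_B z B p x t)) by [].
    have [_ d] := dp x t; have [_ du] := pu x t.
    apply: mder_eq.
      by apply: mderD du (mderZ _ (mderB (mderMr a d) (mderMl a d))).
    have [-> _] := curv x t; rewrite proj_flow_t// dress_BE//.
    exact: dress_curvature_algebra.
  suff /mderE[] : mder (dress_B z B p ^~ t) x
    (comm (dress_B z B p x t) (dress_u a z u p x t)) by [].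
  have [dB _] := pB x t.
  have dnum := simple_num_dx 0 x t.
  rewrite scale0r !add0r in dnum.
  apply: mder_eq (mderZ _ (mderM (mderM dnum dB) (mder_adj dnum))) _.
  have [_ ->] := curv x t.
  have ud := dress_u_skew x t.
  rewrite adjB !adjM ud uu; exact: conj_flow_algebra.
Qed.

(** [E' g E^-1] has vanishing derivatives, so it keeps its value at the origin.
   The inverse of [E] is the adjoint at the conjugate parameter. *)
Lemma simple_num_intertwine E E' l x t : wave a u B E ->
  wave a (dress_u a z u p) (dress_B z B p) E' -> l != 0 ->
  simple_num z (p 0 0) l *m E x t l = E' x t l *m simple_num z (p x t) l.
Proof.
move=> hE hE' l0; have l0' := conjC_neq0 l0.
have [_ dE E0] := hE; have [_ dE' E0'] := hE'.
have un := wave_unitary x t ha hl hE l0.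
rewrite -[RHS]mulmx1 -un mulmxA; congr (_ *m _).
rewrite -[LHS](@mul1mx _ _ n) -(@mulmx1 _ _ n (1%:M *m _)).
rewrite -{1}(E0' l l0) -(@adj1 R n) -(E0 _ l0').
apply/esym; apply: (@flat_const _ _ (fun x t =>
  E' x t l *m simple_num z (p x t) l *m (E x t l^*) ^t*)) => x' t'.
have [ex et] := dE _ l0' x' t'; have [ex' et'] := dE' l l0 x' t'; split.
  apply: mder_eq (mderM (mderM ex' (simple_num_dx l x' t')) (mder_adj ex)) _.
  by rewrite adjM lax_adjx//; exact: intertwine_algebra.
apply: mder_eq (mderM (mderM et' (simple_num_dt x' t' l0)) (mder_adj et)) _.
by rewrite adjM lax_adjt//; exact: intertwine_algebra.
Qed.

End WithProjection.

Section Existence.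
Variables (a : M) (z : C) (u B : R -> R -> M) (E : R -> R -> C -> M) (p0 : M).
Hypotheses (ha : in_u a) (hz : z \isn't Num.real) (hl : lax a u B).
Hypotheses (hE : wave a u B E) (hp0 : hermitian_projection p0).

Definition dress_proj x t := image_proj ((E x t z) ^t*) p0.

Let z0 : z != 0. Proof. exact: nonreal_neq0. Qed.

Lemma wave_adj_unit x t : (E x t z) ^t* \in unitmx.
Proof. by rewrite map_unitmx unitmx_tr (wave_unit x t ha hl hE). Qed.

Lemma dress_proj_hermitian x t : hermitian_projection (dress_proj x t).
Proof. exact: image_proj_hermitian (wave_adj_unit x t) hp0. Qed.

Lemma dress_proj_partials : partials dress_proj
  (fun x t => proj_flow ((z *: a + u x t) ^t*) (dress_proj x t))
  (fun x t => proj_flow ((z^-1 *: B x t) ^t*) (dress_proj x t)).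
Proof.
have [_ dE _] := hE => x t; have [ex et] := dE z z0 x t; split.
  apply: (@image_proj_mder _ _ (fun s => (E s t z) ^t*)) => //.
    by move=> s; exact: wave_adj_unit.
  by apply: mder_eq (mder_adj ex) _; rewrite adjM.
apply: (@image_proj_mder _ _ (fun s => (E x s z) ^t*)) => //.
  by move=> s; exact: wave_adj_unit.
by apply: mder_eq (mder_adj et) _; rewrite adjM.
Qed.

Lemma dress_proj00 : dress_proj 0 0 = p0.
Proof.
by have [_ _ E0] := hE; rewrite /dress_proj E0// adj1 image_proj1.
Qed.

Lemma dress_proj_unique (q : R -> R -> M) :
  (forall x t, hermitian_projection (q x t)) -> q 0 0 = p0 ->
  partials q (fun x t => proj_flow ((z *: a + u x t) ^t*) (q x t))
             (fun x t => proj_flow ((z^-1 *: B x t) ^t*) (q x t)) ->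
  forall x t, q x t = dress_proj x t.
Proof.
move=> hq q00 dq x t; have [su sB _ _ _] := hl.
have [pu _ _] := smooth_partials su; have [pB _ _] := smooth_partials sB.
have dp := dress_proj_partials; have hp := dress_proj_hermitian.
have q0t : q 0 t = dress_proj 0 t.
  apply: (@proj_flow_unique R n (q 0) (dress_proj 0) (fun s => z^-1 *: B 0 s)) => //.
  - by apply: (@mder_cts R n n _ (fun s => z^-1 *: dt B 0 s)) => s;
      apply: mderZ; have [] := pB 0 s.
  - by move=> s; have [] := dq 0 s.
  - by move=> s; have [] := dp 0 s.
  - by rewrite q00 dress_proj00.
apply: (@proj_flow_unique R n (q ^~ t) (dress_proj ^~ t) (fun s => z *: a + u s t)) => //.
- by apply: (@mder_cts R n n _ (fun s => 0 + dx u s t)) => s;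
    apply: mderD; [exact: mder_cst|have [] := pu s t].
- exact: (fun s => (dq s t).1).
- exact: (fun s => (dp s t).1).
Qed.

End Existence.

End SimpleDressing.

(** * Rational functions *)

Section OffFinite.
Context {R : realType}.
Local Notation C := R[i].
Implicit Types (P Q : C -> Prop).

Lemma off_finite_all P : (forall l, P l) -> off_finite P.
Proof.
move=> h; rewrite /off_finite (_ : [set l | _] = set0) //.
by apply/seteqP; split=> // l /=; apply; exact: h.
Qed.

Lemma off_finite_sub P Q : (forall l, P l -> Q l) -> off_finite P -> off_finite Q.
Proof. by move=> PQ; apply: sub_finite_set => l /= nQ /PQ. Qed.

Lemma off_finite_and P Q : off_finite P -> off_finite Q ->
  off_finite (fun l => P l /\ Q l).
Proof.
move=> fP fQ; apply: (@sub_finite_set _ _ ([set l | ~ P l] `|` [set l | ~ Q l])).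
  by move=> l /= /not_andP.
by rewrite finite_setU.
Qed.

Lemma off_finite_neq (c : C) : off_finite (fun l => l != c).
Proof.
rewrite /off_finite (_ : [set l | _] = [set c]); first exact: finite_set1.
by apply/seteqP; split=> l /=; [move/negP; rewrite negbK => /eqP|move=> ->; rewrite eqxx].
Qed.

Lemma off_finite_preim P (f g : C -> C) : cancel f g -> off_finite P ->
  off_finite (fun l => P (f l)).
Proof.
move=> fg fP; apply: (@sub_finite_set _ _ [set g l | l in [set l | ~ P l]]).
  by move=> l /= nP; exists (f l).
exact: finite_image.
Qed.

Lemma off_finite_conj P : off_finite P -> off_finite (fun l => P l^*).
Proof. by apply: (@off_finite_preim _ _ (fun l => l^*)) => l; rewrite conjCK. Qed.

Lemma off_finite_inv P : off_finite P -> off_finite (fun l => P l^-1).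
Proof. by apply: (@off_finite_preim _ _ (fun l => l^-1)) => l; rewrite invrK. Qed.

(** A finite exceptional set is avoided by short horizontal segments. *)
Lemma off_finite_right P (c : C) : off_finite P ->
  exists2 d : R, 0 < d & forall h : R, 0 < h -> h < d -> P (c + h%:C%C).
Proof.
move=> /finite_seqP[s es].
suff [d d0 hd] : exists2 d : R, 0 < d &
    forall h : R, 0 < h -> h < d -> c + h%:C%C \notin s.
  exists d => // h h0 hlt; have [//|nP] := pselect (P (c + h%:C%C)).
  by have : [set l | ~ P l] (c + h%:C%C) by []; rewrite es /= (negbTE (hd h h0 hlt)).
elim: s {es} => [|x s [d d0 hd]]; first by exists 1.
have [xc|xc] := ltP 0 (complex.Re (x - c)).
  exists (Num.min d (complex.Re (x - c))); first by rewrite lt_min d0.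
  move=> h h0; rewrite lt_min => /andP[hlt hx]; rewrite inE negb_or hd// andbT.
  by apply: contraL hx => /eqP <-; rewrite addrC addKr /= ltxx.
exists d => // h h0 hlt; rewrite inE negb_or hd// andbT.
by apply: contraL h0 => /eqP e; move: xc; rewrite -e addrC addKr /= leNgt.
Qed.

Lemma off_finite_ex P (c : C) : off_finite P -> exists l, P l.
Proof.
move=> /(off_finite_right c)[d d0 h]; exists (c + (d / 2)%:C%C); apply: h.
  by rewrite divr_gt0.
by rewrite ltr_pdivrMr// ltr_pMr// ltr1n.
Qed.

Lemma off_finite_nroot (q : {poly C}) : q != 0 -> off_finite (fun l => q.[l] != 0).
Proof.
move=> q0; have [r hr] := closed_field_poly_normal q.
apply/finite_seqP; exists r; apply/seteqP; split=> l /=.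
  move/negP; rewrite negbK => ql.
  have : root q l by [].
  by rewrite hr rootZ ?lead_coef_eq0// root_prod_XsubC.
move=> lr; apply/negP; rewrite negbK.
suff : root q l by [].
by rewrite hr rootZ ?lead_coef_eq0// root_prod_XsubC.
Qed.

Lemma poly_off_finite_eq (p q : {poly C}) :
  off_finite (fun l => p.[l] = q.[l]) -> p = q.
Proof.
move=> h; apply/eqP; rewrite -subr_eq0; apply/negPn/negP => pq.
have [l [h1]] := off_finite_ex 0 (off_finite_and h (off_finite_nroot pq)).
by rewrite hornerD hornerN h1 subrr eqxx.
Qed.

End OffFinite.

Section PolynomialBounds.
Context {R : realType}.
Local Notation C := R[i].

Lemma poly_bounded (p : {poly C}) (L : R) : exists2 K, 0 <= K &
  forall l, l1 l <= L -> l1 p.[l] <= K.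
Proof.
elim/poly_ind: p => [|p c [K K0 hK]].
  by exists 0 => // l _; rewrite horner0 l10.
exists (K * `|L| + l1 c); first by rewrite addr_ge0// mulr_ge0.
move=> l lL; rewrite hornerMXaddC; apply: le_trans (l1D _ _) _; rewrite lerD2r.
apply: le_trans (l1M _ _) _; apply: ler_pM => //; first exact: hK.
by apply: le_trans lL _; exact: ler_norm.
Qed.

Lemma poly_lipschitz (p : {poly C}) (c : C) : exists2 K, 0 <= K &
  forall h : R, 0 <= h -> h <= 1 -> l1 (p.[c + h%:C%C] - p.[c]) <= K * h.
Proof.
have [q hq] : exists q, p - (p.[c])%:P = q * ('X - c%:P).
  by apply/factor_theorem; rewrite /root !hornerE subrr.
have [K K0 hK] := poly_bounded q (l1 c + 1); exists K => // h h0 h1.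
have -> : p.[c + h%:C%C] - p.[c] = (p - (p.[c])%:P).[c + h%:C%C].
  by rewrite !hornerE.
rewrite hq !hornerE [c + _]addrC addrK; apply: le_trans (l1M _ _) _.
rewrite l1_real (ger0_norm h0) ler_wpM2r// hK// addrC.
by apply: le_trans (l1D _ _) _; rewrite l1_real (ger0_norm h0) lerD2l.
Qed.

Definition right_bounded (f : C -> C) (c : C) := exists K d : R,
  0 < d /\ forall h, 0 < h -> h < d -> l1 (f (c + h%:C%C)) <= K.

Lemma le0_small (x K d : R) : 0 < d -> 0 <= K ->
  (forall h, 0 < h -> h < d -> x <= K * h) -> x <= 0.
Proof.
move=> d0 K0 hx; rewrite leNgt; apply/negP => x0.
have K1 : 0 < K + 1 by rewrite ltr_wpDl.
pose h := Num.min (d / 2) (x / (2 * (K + 1))).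
have h0 : 0 < h by rewrite lt_min !divr_gt0// mulr_gt0.
have hd : h < d.
  have : h <= d / 2 by rewrite ge_min lexx.
  lra.
have := hx h h0 hd; have : h <= x / (2 * (K + 1)) by rewrite ge_min lexx orbT.
rewrite ler_pdivlMr ?mulr_gt0//; nra.
Qed.

Lemma ratio_right_bounded (p q : {poly C}) (f : C -> C) (c : C) :
  off_finite (fun l => f l * q.[l] = p.[l]) -> q.[c] != 0 -> right_bounded f c.
Proof.
move=> hf qc.
have [K K0 hK] := poly_lipschitz q c; have [Kp Kp0 hKp] := poly_lipschitz p c.
have [d d0 hd] := off_finite_right c hf.
have qc0 : 0 < l1 q.[c].
  by rewrite lt_def l1_ge0 andbT; apply: contra qc => /eqP/l1_eq0/eqP.
pose e := Num.min (Num.min 1 d) (l1 q.[c] / (2 * (K + 1))).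
have K1 : 0 < K + 1 by rewrite ltr_wpDl.
exists ((l1 p.[c] + Kp) * (2 / (l1 q.[c] / 2))), e; split.
  by rewrite !lt_min ltr01 d0 divr_gt0// mulr_gt0.
move=> h h0; rewrite !lt_min => /andP[/andP[h1 hd'] he].
have hq := hK h (ltW h0) (ltW h1); have hp := hKp h (ltW h0) (ltW h1).
set ql := q.[c + h%:C%C] in hq *; set pl := p.[c + h%:C%C] in hp *.
have ql0 : l1 q.[c] / 2 <= l1 ql.
  have := l1D ql (q.[c] - ql); rewrite addrC subrK l1B.
  move: he; rewrite ltr_pdivlMr ?mulr_gt0//; nra.
have qn : ql != 0 by apply/negP => /eqP e0; move: ql0; rewrite e0 l10; lra.
have -> : f (c + h%:C%C) = pl * ql^-1.
  by rewrite /pl -(hd h h0 hd') mulfK.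
apply: le_trans (l1M _ _) _; apply: ler_pM => //.
  have := l1D p.[c] (pl - p.[c]); rewrite addrC subrK => hh.
  apply: le_trans hh _; rewrite lerD2l; apply: le_trans hp _.
  by rewrite ler_piMr// ltW.
rewrite ler_pdivlMr ?divr_gt0//; apply: le_trans (l1_inv qn).
by rewrite ler_wpM2l.
Qed.

(** A Liouville theorem: approaching a zero of the reduced denominator, or
   infinity, along the real direction detects every pole. *)
Lemma rational_liouville (p q : {poly C}) (f : C -> C) : q != 0 ->
  off_finite (fun l => f l * q.[l] = p.[l]) ->
  (forall c, right_bounded f c) -> right_bounded (fun l => f l^-1) 0 ->
  exists c, off_finite (fun l => f l = c).
Proof.
move=> q0 hf bf binf.
pose g := gcdp p q.
have g0 : g != 0 by rewrite gcdp_eq0 negb_and q0 orbT.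
pose p1 := p %/ g; pose q1 := q %/ g.
have ep : p = p1 * g by rewrite divpK// dvdp_gcdl.
have eq : q = q1 * g by rewrite divpK// dvdp_gcdr.
have cop : coprimep p1 q1 by apply: coprimep_div_gcd; rewrite q0 orbT.
have hf1 : off_finite (fun l => f l * q1.[l] = p1.[l]).
  apply: off_finite_sub (off_finite_and hf (off_finite_nroot g0)) => l [].
  by rewrite ep eq !hornerM mulrA => /mulIf h /h.
have sq1 : size q1 == 1%N.
  apply: contraT => /closed_rootP[c rc].
  have pc : p1.[c] != 0 by apply: (@coprimep_root _ q1 p1); rewrite // coprimep_sym.
  have [K [d [d0 hd]]] := bf c.
  have [Kq Kq0 hq] := poly_lipschitz q1 c; have [Kp Kp0 hp] := poly_lipschitz p1 c.
  have [e e0 he] := off_finite_right c hf1.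
  suff : l1 p1.[c] <= 0.
    move=> h; case/negP: pc; apply/eqP/l1_eq0/eqP.
    by rewrite eq_le h l1_ge0.
  apply: (@le0_small _ (`|K| * Kq + Kp) (Num.min 1 (Num.min d e))).
  - by rewrite !lt_min ltr01 d0 e0.
  - by rewrite addr_ge0// mulr_ge0.
  move=> h h0; rewrite !lt_min => /and3P[h1 hd' he'].
  have hqh := hq h (ltW h0) (ltW h1); have hph := hp h (ltW h0) (ltW h1).
  move: rc => /eqP q1c; rewrite q1c subr0 in hqh.
  rewrite -[p1.[c]](subKr p1.[c + h%:C%C]).
  apply: le_trans (l1D _ _) _; rewrite l1N mulrDl; apply: lerD => //.
  rewrite -(he h h0 he'); apply: le_trans (l1M _ _) _.
  rewrite -mulrA; apply: ler_pM => //.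
  by apply: le_trans (hd h h0 hd') _; exact: ler_norm.
have [k k0 ek] : exists2 k, k != 0 & q1 = k%:P.
  by move/size_poly1P: sq1 => [k]; exists k.
pose r := k^-1 *: p1.
have hr : off_finite (fun l => f l = r.[l]).
  apply: off_finite_sub hf1 => l; rewrite ek hornerC /r hornerZ => <-.
  by rewrite mulrCA mulVf// mulr1.
suff sr : (size r <= 1)%N.
  by exists r`_0; apply: off_finite_sub hr => l ->; rewrite (size1_polyC sr) hornerC coefC.
rewrite leqNgt; apply/negP => sr.
have [m sm] : exists m, size r = m.+2 by case: (size r) sr => [|[|m]]// _; exists m.
(* the reversed polynomial, the expansion of [r] at infinity *)
pose s := \poly_(j < m.+2) r`_(m.+1 - j).
have sE (w : C) : w != 0 -> s.[w] = r.[w^-1] * w ^+ m.+1.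
  move=> w0; rewrite horner_poly horner_coef sm mulr_suml.
  rewrite (reindex_inj rev_ord_inj) /=; apply: eq_bigr => j _.
  have jm : (j <= m.+1)%N by rewrite -ltnS.
  rewrite subSS subKn// -mulrA; congr (_ * _).
  move: (nat_of_ord j) jm => k' jm; rewrite -{2}(subnK jm) addnC exprD mulrA -exprMn mulVf//.
  by rewrite expr1n mul1r.
have s0 : s.[0] = lead_coef r.
  by rewrite horner_coef0 coef_poly /= subn0 lead_coefE sm.
have [K [d [d0 hd]]] := binf.
have [Ks Ks0 hs] := poly_lipschitz s 0.
have [e e0 he] := off_finite_right 0 (off_finite_inv hr).
have : l1 s.[0] <= 0.
  apply: (@le0_small _ (`|K| + Ks) (Num.min 1 (Num.min d e))).
  - by rewrite !lt_min ltr01 d0 e0.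
  - by rewrite addr_ge0.
  move=> h h0; rewrite !lt_min => /and3P[h1 hd' he'].
  have hsh := hs h (ltW h0) (ltW h1).
  rewrite -[s.[0]](subKr s.[0 + h%:C%C]).
  apply: le_trans (l1D _ _) _; rewrite l1N mulrDl; apply: lerD => //.
  rewrite sE; last first.
    by rewrite add0r; apply/eqP => -[hh]; move: h0; rewrite hh ltxx.
  rewrite -(he h h0 he'); apply: le_trans (l1M _ _) _; apply: ler_pM => //.
    by apply: le_trans (hd h h0 hd') _; exact: ler_norm.
  rewrite add0r -rmorphXn /= l1_real (ger0_norm (exprn_ge0 _ (ltW h0))) exprS.
  by apply: ler_piMr; [exact: ltW|apply: exprn_ile1; exact: ltW].
move=> h; have /l1_eq0/eqP : l1 s.[0] = 0 by apply/eqP; rewrite eq_le h l1_ge0.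
by rewrite s0 lead_coef_eq0 -size_poly_eq0 sm.
Qed.

End PolynomialBounds.

(** * The rational loop group *)

Section RegularLimits.
Context {K : numFieldType} {T : Type} {F : set_system T} {FF : Filter F}.
Implicit Types (f g : T -> K) (a b : K).

Lemma regular_cvgM f g a b :
  (f s : K^o) @[s --> F] --> (a : K^o) -> (g s : K^o) @[s --> F] --> (b : K^o) ->
  (f s * g s : K^o) @[s --> F] --> (a * b : K^o).
Proof. by move=> fa gb; exact: (cvgM fa gb). Qed.

Lemma regular_cvgD f g a b :
  (f s : K^o) @[s --> F] --> (a : K^o) -> (g s : K^o) @[s --> F] --> (b : K^o) ->
  (f s + g s : K^o) @[s --> F] --> (a + b : K^o).
Proof. by move=> fa gb; exact: (cvgD fa gb). Qed.

Lemma regular_cvgB f g a b :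
  (f s : K^o) @[s --> F] --> (a : K^o) -> (g s : K^o) @[s --> F] --> (b : K^o) ->
  (f s - g s : K^o) @[s --> F] --> (a - b : K^o).
Proof. by move=> fa gb; exact: (cvgB fa gb). Qed.

Lemma regular_cvgV f a : a != 0 -> (f s : K^o) @[s --> F] --> (a : K^o) ->
  ((f s)^-1 : K^o) @[s --> F] --> (a^-1 : K^o).
Proof. by move=> a0 fa; exact: (cvgV a0 fa). Qed.

Lemma regular_cvg_cst a : (a : K^o) @[_ --> F] --> (a : K^o).
Proof. exact: cvg_cst. Qed.

End RegularLimits.

Section MatrixLimits.
Context {R : realType} {n : nat} {T : Type} {F : set_system T} {FF : ProperFilter F}.
Local Notation C := R[i].
Local Notation M := 'M[C]_n.
Implicit Types (f g : T -> M).

Lemma mx_cvgM f g A B : mx_cvg f F A -> mx_cvg g F B ->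
  mx_cvg (fun s => f s *m g s) F (A *m B).
Proof.
move=> fA gB i j.
have h (r : seq 'I_n) : (\sum_(k <- r) f s i k * g s k j : C^o) @[s --> F] -->
    (\sum_(k <- r) A i k * B k j : C^o).
  elim: r => [|k r ih].
    under eq_fun do rewrite big_nil; rewrite big_nil.
    exact: (@regular_cvg_cst _ _ _ _ _).
  under eq_fun do rewrite big_cons; rewrite big_cons.
  by apply: regular_cvgD ih; exact: regular_cvgM (fA i k) (gB k j).
by under eq_fun do rewrite mxE; rewrite mxE; exact: h.
Qed.

Lemma mx_cvgD f g A B : mx_cvg f F A -> mx_cvg g F B ->
  mx_cvg (fun s => f s + g s) F (A + B).
Proof.
move=> fA gB i j; under eq_fun do rewrite mxDE; rewrite mxDE.
exact: regular_cvgD (fA i j) (gB i j).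
Qed.

Lemma mx_cvg_cst (A : M) : mx_cvg (fun=> A) F A.
Proof. by move=> i j; exact: (@regular_cvg_cst _ _ _ _ _). Qed.

Lemma mx_cvgZ c f A : mx_cvg f F A -> mx_cvg (fun s => c *: f s) F (c *: A).
Proof.
move=> fA i j; under eq_fun do rewrite mxZE; rewrite mxZE.
exact: regular_cvgM (@regular_cvg_cst _ _ _ _ _) (fA i j).
Qed.

Lemma mx_cvgB f g A B : mx_cvg f F A -> mx_cvg g F B ->
  mx_cvg (fun s => f s - g s) F (A - B).
Proof.
move=> fA gB i j; under eq_fun do rewrite mxDE mxNE; rewrite mxDE mxNE.
exact: regular_cvgB (fA i j) (gB i j).
Qed.

Lemma mx_cvg_adj f A : mx_cvg f F A -> mx_cvg (fun s => (f s) ^t*) F (A ^t*).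
Proof.
move=> fA i j; under eq_fun do rewrite !mxE; rewrite !mxE.
apply/cvgrPdist_lt => e e0; move/cvgrPdist_lt/(_ e e0): (fA j i).
by apply: filterS => s; rewrite -rmorphB /= norm_conjC.
Qed.

Lemma mx_cvg_unique f A B : mx_cvg f F A -> mx_cvg f F B -> A = B.
Proof.
by move=> fA fB; apply/matrixP => i j; exact: (@cvg_unique _ (@norm_hausdorff _ C^o) _ _ _ _ (fA i j) (fB i j)).
Qed.

Lemma mx_cvg_parts f (A : M) :
  (forall i j, complex.Re (f s i j) @[s --> F] --> complex.Re (A i j)) ->
  (forall i j, complex.Im (f s i j) @[s --> F] --> complex.Im (A i j)) ->
  mx_cvg f F A.
Proof.
move=> hr hi i j; apply/cvgrPdist_lt => e e0.
have eR : e = ((complex.Re e)%:C)%C.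
  by move: e0; rewrite ltcE => /andP[/eqP h _]; case: e h => er ei /= ->.
have e0' : 0 < complex.Re e / 2 by move: e0; rewrite {1}eR ltcR => ?; rewrite divr_gt0.
move/cvgrPdist_lt/(_ _ e0'): (hr i j) => h1; move/cvgrPdist_lt/(_ _ e0'): (hi i j) => h2.
move: h1 h2; apply: filterS2 => s h1 h2.
apply: le_lt_trans (norm_le_l1 _) _; rewrite eR ltcR /l1 ReD ReN ImD ImN.
by rewrite [ltRHS]splitr ltrD.
Qed.

Lemma mx_cvg_entry f A : mx_cvg f F A -> forall i j,
  (complex.Re (f s i j) @[s --> F] --> complex.Re (A i j)) /\
  (complex.Im (f s i j) @[s --> F] --> complex.Im (A i j)).
Proof.
move=> fA i j.
have h (e : R) : 0 < e -> \forall s \near F, l1 (A i j - f s i j) < e.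
  move=> e0; have e30 : 0 < e / 3 by rewrite divr_gt0.
  have := fA i j; move/cvgrPdist_lt/(_ (e / 3)%:C%C); rewrite ltcR => /(_ e30).
  apply: filterS => s /ltW/l1_le_norm/le_lt_trans; apply; lra.
split; apply/cvgrPdist_lt => e /h; apply: filterS => s; apply: le_lt_trans.
  by rewrite -ReN -ReD; exact: Re_le_l1.
by rewrite -ImN -ImD; exact: Im_le_l1.
Qed.

End MatrixLimits.
Arguments mx_cvg_cst {R n T F FF} A.
Arguments mx_cvgZ {R n T F FF} c {f A}.

Section LoopGroupStructure.
Context {R : realType} {n : nat}.
Local Notation C := R[i].
Local Notation M := 'M[C]_n.
Implicit Types (f h : C -> M).

Lemma rational_mapP f : rational_map f <-> exists (P : 'M[{poly C}]_n) (q : {poly C}),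
  q != 0 /\ off_finite (fun l => q.[l] *: f l = map_mx (horner^~ l) P).
Proof.
split=> -[P [q [q0 hf]]]; exists P, q; split=> //;
    apply: off_finite_sub (off_finite_and hf (off_finite_nroot q0)) => l [e ql].
  by rewrite e scalerA divff// scale1r.
by rewrite -[RHS]/(_ *: map_mx (horner^~ l) P) -e scalerA mulVf// scale1r.
Qed.

Lemma rational_mapM f h : rational_map f -> rational_map h ->
  rational_map (fun l => f l *m h l).
Proof.
move=> /rational_mapP[P [p [p0 hP]]] /rational_mapP[Q [q [q0 hQ]]].
apply/rational_mapP; exists (P *m Q), (p * q); split; first by rewrite mulf_neq0.
apply: off_finite_sub (off_finite_and hP hQ) => l [eP eQ].
rewrite (map_mxM (horner_eval l)) -eP -[map_mx _ Q]eQ hornerM.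
by rewrite scalemxl scalemxr scalerA.
Qed.

Lemma rational_map_adj f : rational_map f -> rational_map (fun l => (f l^*) ^t*).
Proof.
move=> /rational_mapP[P [q [q0 hP]]]; apply/rational_mapP.
exists (map_mx (map_poly (fun c => c^*)) P^T), (map_poly (fun c => c^*) q); split.
  by rewrite map_poly_eq0.
have ev (r : {poly C}) l : (map_poly (fun c : C => c^*) r).[l] = (r.[l^*])^*.
  by rewrite -{1}[l]conjCK horner_map.
apply: off_finite_sub (off_finite_conj hP) => l e.
rewrite ev -adjZ e; apply/matrixP => i j; rewrite !mxE ev //.
Qed.

Definition entry_right_bounded f c := forall i j, right_bounded (fun l => f l i j) c.

Lemma rational_mx_liouville f : rational_map f ->
  (forall c, entry_right_bounded f c) ->
  entry_right_bounded (fun l => f l^-1) 0 ->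
  exists A, off_finite (fun l => f l = A).
Proof.
move=> /rational_mapP[P [q [q0 hf]]] bf binf.
have hh (ij : 'I_n * 'I_n) : exists c, off_finite (fun l => f l ij.1 ij.2 = c).
  apply: (@rational_liouville _ (P ij.1 ij.2) q) => //.
  - by apply: off_finite_sub hf => l /matrixP/(_ ij.1 ij.2); rewrite !mxE mulrC.
  - by move=> c; exact: bf.
have [A hA] := choice hh; exists (\matrix_(i, j) A (i, j)).
suff : off_finite (fun l => forall ij, ij \in enum {: 'I_n * 'I_n} ->
    f l ij.1 ij.2 = A ij).
  apply: off_finite_sub => l e; apply/matrixP => i j; rewrite mxE.
  by apply: (e (i, j)); rewrite mem_enum.
elim: (enum _) => [|ij s ih]; first exact: off_finite_all.
apply: off_finite_sub (off_finite_and (hA ij) ih) => l [e1 e2] kl.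
by rewrite inE => /orP[/eqP ->//|]; exact: e2.
Qed.

Lemma mx_cvg_right (T : C -> M) (A : M) (e : R) : 0 < e ->
  mx_cvg (fun w : C^o => T w) 0^' A ->
  exists2 d : R, 0 < d & forall h : R, 0 < h -> h < d -> nm (T h%:C%C - A) <= e.
Proof.
move=> e0 hT.
pose e' := e / ((n * n)%:R * 2 + 1).
have k0 : 0 < (n * n)%:R * 2 + 1 :> R by rewrite ltr_wpDl// mulr_ge0.
have e'0 : 0 < e' by rewrite divr_gt0.
have h (ij : 'I_n * 'I_n) : exists d : R, 0 < d /\ forall h : R, 0 < h -> h < d ->
    l1 ((T h%:C%C - A) ij.1 ij.2) <= e' + e'.
  have := hT ij.1 ij.2; move=> /cvgrPdist_le /(_ (e'%:C)%C).
  rewrite ltcR e'0 => /(_ isT); rewrite near_withinE => -[r /= r0 hr].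
  have r0' : 0 < complex.Re r by move: r0; rewrite ltcE => /andP[].
  exists (complex.Re r); split=> // h h0 hlt.
  rewrite mxDE mxNE l1B; apply: l1_le_norm; apply: hr => /=.
    rewrite sub0r normrN ger0_norm ?ler0c ?ltW//.
    by move: r0; rewrite !ltcE => /andP[/eqP -> _]; rewrite /= eqxx.
  by apply/eqP => -[h0']; move: h0; rewrite h0' ltxx.
have [d hd] := choice h.
have [D D0 hD] : exists2 D : R, 0 < D & forall ij, D <= d ij.
  suff : exists2 D : R, 0 < D &
      forall ij, ij \in enum {: 'I_n * 'I_n} -> D <= d ij.
    by case=> D D0 hD; exists D => // ij; apply: hD; rewrite mem_enum.
  elim: (enum _) => [|ij s [D D0 hD]]; first by exists 1.
  exists (Num.min D (d ij)); first by rewrite lt_min D0; have [] := hd ij.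
  move=> kl; rewrite inE => /orP[/eqP ->|/hD]; first by rewrite ge_min lexx orbT.
  by rewrite ge_min => ->.
exists D => // h0 h00 hlt; apply: le_trans (nm_le (c := e' + e') _) _.
  move=> i j; have [_] := hd (i, j); apply => //.
  exact: lt_le_trans hlt (hD _).
have e'E : e' * ((n * n)%:R * 2 + 1) = e by rewrite divfK ?gt_eqF.
rewrite -e'E; nra.
Qed.

(** The normalizations at infinity of two loops leave no room for a constant
   factor between them. *)
Lemma right_limit_unique (S T : C -> M) (A : M) :
  mx_cvg (fun w : C^o => S w) 0^' 1%:M -> mx_cvg (fun w : C^o => T w) 0^' 1%:M ->
  (exists2 d : R, 0 < d & forall h : R, 0 < h -> h < d ->
     A *m S h%:C%C = T h%:C%C) -> A = 1%:M.
Proof.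
move=> hS hT [d d0 hd]; apply/eqP; rewrite -subr_eq0; apply/eqP/nm_eq0.
rewrite leNgt; apply/negP => A1.
pose e := nm (A - 1%:M) / (2 * (nm A + 1)).
have A0 : 0 < nm A + 1 by rewrite ltr_wpDl.
have e0 : 0 < e by rewrite divr_gt0// mulr_gt0.
have [d1 d10 h1] := mx_cvg_right e0 hS; have [d2 d20 h2] := mx_cvg_right e0 hT.
pose h := Num.min d (Num.min d1 d2) / 2.
have m0 : 0 < Num.min d (Num.min d1 d2) by rewrite !lt_min d0 d10.
have h0 : 0 < h by rewrite divr_gt0.
have : h < Num.min d (Num.min d1 d2) by rewrite /h; lra.
rewrite !lt_min => /and3P[hd0 hd1 hd2].
have : A - 1%:M = (T h%:C%C - 1%:M) - A *m (S h%:C%C - 1%:M).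
  by rewrite mulmxBr mulmx1 hd// opprB [RHS]addrC addrA subrK.
move=> /(congr1 (@nm _ _ _)) eA.
have := nmB (T h%:C%C - 1%:M) (A *m (S h%:C%C - 1%:M)); rewrite -eA.
have := nmM A (S h%:C%C - 1%:M).
have := ler_wpM2l (nm_ge0 A) (h1 h h0 hd1); have := h2 h h0 hd2.
have : e * (2 * (nm A + 1)) = nm (A - 1%:M) by rewrite divfK ?gt_eqF ?mulr_gt0.
nra.
Qed.

Lemma unitary_bounded (A : M) i j : A ^t* *m A = 1%:M -> l1 (A i j) <= 1 + 1.
Proof.
move=> h; apply: l1_le_norm.
have hk : \sum_k `|A k j| ^+ 2 = 1.
  have /matrixP/(_ j j) := h; rewrite !mxE eqxx => e; rewrite -[RHS]e.
  by apply: eq_bigr => k _; rewrite !mxE normCK mulrC.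
rewrite -(ler_pXn2r (n := 2)) ?nnegrE// expr1n -hk (bigD1 i)//= lerDl.
by apply: sumr_ge0 => *; rewrite exprn_ge0.
Qed.

Lemma GminusM f h : Gminus f -> Gminus h -> Gminus (fun l => f l *m h l).
Proof.
move=> [fr fu fc fs] [hr hu hc hs]; split.
- exact: rational_mapM.
- by apply: off_finite_sub (off_finite_and fu hu) => l [a b]; rewrite unitmx_mul a.
- by rewrite -[1%:M]mulmx1; exact: (mx_cvgM fc hc).
- apply: off_finite_sub (off_finite_and fs hs) => l [a b].
  by rewrite adjM mulmxA -(mulmxA _ _ (f l)) a mulmx1.
Qed.

Lemma Gminus1 : Gminus (fun=> 1%:M : M).
Proof.
split.
- exists 1%:M, 1; split; first exact: oner_neq0.
  apply: off_finite_all => l; rewrite hornerC invr1 scale1r.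
  by rewrite (map_mx1 (horner_eval l)).
- by apply: off_finite_all => l; exact: unitmx1.
- by move=> i j; exact: regular_cvg_cst.
- by apply: off_finite_all => l; rewrite adj1 mulmx1.
Qed.

Lemma simple_elementK z (p : M) l : l != z -> l != z^* -> p *m p = p ->
  simple_element z p l *m simple_element z^* p l = 1%:M.
Proof.
rewrite -(subr_eq0 l z) -(subr_eq0 l (z^*)) => l1 l2 p2; rewrite /simple_element conjCK.
set c := (l - z) / _; have cd : c * ((l - z^*) / (l - z)) = 1.
  by rewrite /c mulrA divfK// divff.
rewrite mulmxDl !mulmxDr p2 !scalemxl !scalemxr scalerA cd scale1r.
rewrite !(mulmxBl, mulmxBr) !(mul1mx, mulmx1) p2 subrr !scaler0 addr0 subr0 add0r.
by rewrite addrC subrK.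
Qed.

Lemma simple_element_adj z (p : M) l : p ^t* = p ->
  (simple_element z p l^*) ^t* = simple_element z^* p l.
Proof.
move=> ps; rewrite /simple_element adjD adjZ adjB adj1 ps conjCK.
by rewrite rmorphM /= fmorphV !rmorphB /= !conjCK.
Qed.

Lemma Gminus_simple z (p : M) : hermitian_projection p -> Gminus (simple_element z p).
Proof.
move=> [ps p2]; split.
- exists (('X - (z^*)%:P) *: map_mx polyC p + ('X - z%:P) *: map_mx polyC (1%:M - p)),
    ('X - (z^*)%:P); split; first by rewrite polyXsubC_eq0.
  apply: off_finite_sub (off_finite_neq z^*) => l; rewrite -subr_eq0 => lz.
  apply/matrixP => i j; rewrite !mxE !hornerE.
  move: (p i j) ((i == j)%:R) z^* lz => c1 c2 w lw.
  by field.
- apply: off_finite_sub (off_finite_and (off_finite_neq z) (off_finite_neq z^*)).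
  by move=> l [l1 l2]; have /mulmx1_unit[] := simple_elementK l1 l2 p2.
- have cw : (fun w : C^o => (1 - z * w) / (1 - z^* * w) : C^o) @ (0 : C^o)^' --> (1 : C^o).
    rewrite -[X in _ --> X](_ : (1 - z * 0) / (1 - z^* * 0) = 1 :> C); last first.
      by rewrite !mulr0 subr0 divr1.
    apply: cvg_within_filter; apply: regular_cvgM.
      apply: regular_cvgB; first exact: regular_cvg_cst.
      by apply: regular_cvgM; [exact: regular_cvg_cst|exact: cvg_id].
    apply: regular_cvgV; first by rewrite mulr0 subr0 oner_neq0.
    apply: regular_cvgB; first exact: regular_cvg_cst.
    by apply: regular_cvgM; [exact: regular_cvg_cst|exact: cvg_id].
  have cw' : (fun w : C^o => (w^-1 - z) / (w^-1 - z^*) : C^o) @ (0 : C^o)^' --> (1 : C^o).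
    apply: cvg_trans cw; apply: near_eq_cvg; near=> w.
    have w0 : w != 0 by near: w; exact: (@nbhs_dnbhs_neq C^o 0).
    rewrite -[w^-1 - z](_ : (1 - z * w) / w = _); last first.
      by rewrite mulrBl mulfK// div1r.
    rewrite -[w^-1 - z^*](_ : (1 - z^* * w) / w = _); last first.
      by rewrite mulrBl mulfK// div1r.
    by rewrite invf_div mulrA divfK.
  move=> i j.
  have -> : (1%:M : M) i j = p i j + 1 * (1%:M - p) i j.
    by rewrite mul1r -mxDE addrC subrK.
  rewrite (_ : (fun s : C^o => _) = fun s : C^o =>
    (p i j + (s^-1 - z) / (s^-1 - z^*) * (1%:M - p) i j : C^o)); last first.
    by apply/funext => s; rewrite /simple_element mxDE mxZE.
  apply: regular_cvgD; first exact: regular_cvg_cst.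
  exact: (regular_cvgM cw' (@regular_cvg_cst _ _ _ _ _)).
- apply: off_finite_sub (off_finite_and (off_finite_neq z) (off_finite_neq z^*)).
  move=> l [l1 l2]; rewrite simple_element_adj//.
  by apply: mulmx1C; exact: simple_elementK.
Unshelve. all: by end_near. Qed.

End LoopGroupStructure.

(** * Uniqueness of factorizations and generators of the rational loop group *)

Section Factorization.
Context {R : realType} {n : nat}.
Local Notation C := R[i].
Local Notation M := 'M[C]_n.
Implicit Types (f g E : C -> M).

Lemma conj_right (c : C) (h : R) : (c + h%:C%C)^* = c^* + h%:C%C.
Proof. by rewrite rmorphD /= [X in _ + X]conjc_real. Qed.

Definition mx_right_bounded f c := exists K d : R,
  0 < d /\ forall h, 0 < h -> h < d -> nm (f (c + h%:C%C)) <= K.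

Lemma mx_right_bounded_entry f c : mx_right_bounded f c -> entry_right_bounded f c.
Proof.
move=> [K [d [d0 hd]]] i j; exists K, d; split=> // h h0 hlt.
by apply: le_trans (hd h h0 hlt); exact: l1_le_nm.
Qed.

Lemma mx_right_boundedM f g c : mx_right_bounded f c -> mx_right_bounded g c ->
  mx_right_bounded (fun l => f l *m g l) c.
Proof.
move=> [K [d [d0 hd]]] [L [e [e0 he]]]; exists (K * L), (Num.min d e).
split=> [|r r0]; first by rewrite lt_min d0.
rewrite lt_min => /andP[rd re]; apply: le_trans (nmM _ _) _.
by apply: ler_pM => //; [exact: hd|exact: he].
Qed.

Lemma mx_right_bounded_adj f c : mx_right_bounded f c^* ->
  mx_right_bounded (fun l => (f l^*) ^t*) c.
Proof.
move=> [K [d [d0 hd]]]; exists K, d; split=> // h h0 hlt.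
by rewrite nm_adj conj_right; exact: hd.
Qed.

Lemma unitary_nm (A : M) : A ^t* *m A = 1%:M -> nm A <= (n * n)%:R * (1 + 1).
Proof. by move=> h; apply: nm_le => i j; exact: unitary_bounded. Qed.

Lemma holomorphic_right_cts f c (e : R) : mx_holomorphic f -> c != 0 -> 0 < e ->
  exists2 d : R, 0 < d & forall h : R, 0 < h -> h < d ->
    nm (f (c + h%:C%C) - f c) <= e.
Proof.
move=> hf c0 e0; apply: (@mx_cvg_right R n (fun w => f (c + w))) => // i j.
have /derivable1_diffP/differentiable_continuous ct := hf c c0 i j.
apply: cvg_within_filter.
have sh : (fun w : C^o => c + w : C^o) @ (0 : C^o) --> (c : C^o).
  have := @regular_cvgD C C^o (nbhs (0 : C^o)) _ (fun=> c) id c 0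
    (@regular_cvg_cst C C^o _ _ c) cvg_id.
  by rewrite addr0 => h; exact: h.
apply: (@cvg_comp _ _ _ (fun w : C^o => c + w : C^o) (fun w : C^o => f w i j : C^o)
  _ _ _ sh); exact: ct.
Qed.

Lemma holomorphic_right_bounded f c : mx_holomorphic f -> c != 0 ->
  mx_right_bounded f c.
Proof.
move=> hf c0; have [d d0 hd] := holomorphic_right_cts hf c0 ltr01.
exists (nm (f c) + 1), d; split=> // h h0 hlt.
by apply: le_trans (nm_sub_le _ (f c)) _; rewrite lerD2l hd.
Qed.

Lemma real_conj (h : R) : (h%:C%C : C)^* = h%:C%C.
Proof. exact: conjc_real. Qed.

Lemma right_neq0 (h : R) : 0 < h -> (h%:C%C : C) != 0.
Proof. by move=> h0; apply/eqP => -[e]; move: h0; rewrite e ltxx. Qed.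

Lemma Gplus_real_bounded E (h : R) : Gplus E -> 0 < h ->
  nm (E h%:C%C) <= (n * n)%:R * (1 + 1).
Proof.
move=> [_ _ uE] h0; apply: unitary_nm.
by have := uE _ (right_neq0 h0); rewrite real_conj.
Qed.

Lemma Gplus_right_bounded E c : Gplus E -> mx_right_bounded E c.
Proof.
move=> hE; have [->|c0] := eqVneq c 0.
  exists ((n * n)%:R * (1 + 1)), 1; split=> // h h0 _.
  by rewrite add0r; exact: Gplus_real_bounded.
by have [holo _ _] := hE; exact: holomorphic_right_bounded.
Qed.

Lemma Gplus_ext E E' : mx_holomorphic E -> mx_holomorphic E' ->
  off_finite (fun l => E l = E' l) -> forall l, l != 0 -> E l = E' l.
Proof.
move=> hE hE' ee l l0; apply/eqP; rewrite -subr_eq0; apply/eqP/nm_eq0.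
rewrite leNgt; apply/negP => e0.
have e1 : 0 < nm (E l - E' l) / 3 by rewrite divr_gt0.
have [d d0 hd] := holomorphic_right_cts hE l0 e1.
have [d' d0' hd'] := holomorphic_right_cts hE' l0 e1.
have [d1 d10 h1] := off_finite_right l ee.
pose h := Num.min d (Num.min d' d1) / 2.
have m0 : 0 < Num.min d (Num.min d' d1) by rewrite !lt_min d0 d0'.
have h0 : 0 < h by rewrite divr_gt0.
have : h < Num.min d (Num.min d' d1) by rewrite /h; lra.
rewrite !lt_min => /and3P[a1 a2 a3].
have b1 := hd h h0 a1; have b2 := hd' h h0 a2; have b3 := h1 h h0 a3.
rewrite b3 in b1.
have := nmB (E' (l + h%:C%C) - E' l) (E' (l + h%:C%C) - E l).
rewrite opprB addrC addrA subrK; lra.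
Qed.

(** The quotient of two factorizations is at once holomorphic off the origin and
   rational, and it is unitary on the real axis; hence it is constant. *)
Lemma factorization_unique E E' f f' : Gplus E -> Gplus E' -> Gminus f -> Gminus f' ->
  off_finite (fun l => E l *m f l = E' l *m f' l) -> forall l, l != 0 -> E l = E' l.
Proof.
move=> hE hE' [fr fu fc fs] [fr' fu' fc' fs'] ee.
have [holo uE sE] := hE; have [holo' uE' sE'] := hE'.
pose X l := (E' l^*) ^t* *m E l.
pose Y l := f' l *m (f l^*) ^t*.
have YX : off_finite (fun l => Y l = X l).
  apply: off_finite_sub (off_finite_and ee (off_finite_and fs (off_finite_neq 0))).
  move=> l [e [fl l0]]; rewrite /X /Y.
  have -> : f' l = (E' l^*) ^t* *m (E l *m f l) by rewrite e mulmxA sE'// mul1mx.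
  by rewrite -!mulmxA (mulmx1C fl) mulmx1.
have XK : off_finite (fun l => X l *m f l = f' l).
  apply: off_finite_sub (off_finite_and ee (off_finite_neq 0)) => l [e l0].
  by rewrite /X -mulmxA e mulmxA sE'// mul1mx.
have bX c : mx_right_bounded X c.
  apply: mx_right_boundedM; last exact: Gplus_right_bounded.
  by apply: mx_right_bounded_adj; exact: Gplus_right_bounded.
have [A hA] : exists A, off_finite (fun l => X l = A).
  suff [A hA] : exists A, off_finite (fun l => Y l = A).
    by exists A; apply: off_finite_sub (off_finite_and YX hA) => l [-> <-].
  have tr (g : C -> C) c : off_finite (fun l => Y (g l) = X (g l)) ->
      mx_right_bounded (fun l => X (g l)) c -> mx_right_bounded (fun l => Y (g l)) c.
    move=> /(off_finite_right c)[d d0 hd] [K [e [e0 he]]].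
    exists K, (Num.min d e); split; first by rewrite lt_min d0.
    move=> h h0; rewrite lt_min => /andP[h1 h2].
    by rewrite hd//; exact: he.
  apply: rational_mx_liouville.
  - exact: rational_mapM fr' (rational_map_adj fr).
  - by move=> c; apply: mx_right_bounded_entry; exact: (tr id).
  - apply: mx_right_bounded_entry; apply: (tr (fun l => l^-1)).
      exact: (off_finite_inv YX).
    exists ((n * n)%:R * (1 + 1) * ((n * n)%:R * (1 + 1))), 1; split=> // h h0 _.
    have -> : (0 + h%:C%C : C)^-1 = (h^-1)%:C%C by rewrite add0r fmorphV.
    apply: le_trans (nmM _ _) _; rewrite nm_adj real_conj.
    by apply: ler_pM => //; apply: Gplus_real_bounded; rewrite ?invr_gt0.
have A1 : A = 1%:M.
  apply: (right_limit_unique fc fc').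
  have := off_finite_inv (off_finite_and XK hA) => /(off_finite_right 0)[d d0 hd].
  exists d => // h h0 hlt; have [h1 h2] := hd h h0 hlt.
  by rewrite add0r in h1 h2; rewrite -h2.
apply: Gplus_ext => //.
apply: off_finite_sub (off_finite_and hA (off_finite_neq 0)) => l [e l0].
rewrite -[LHS]mul1mx -(mulmx1C (sE' l l0)) -mulmxA -/(X l) e A1 mulmx1 //.
Qed.

End Factorization.

Section Generation.
Context {R : realType} {n : nat}.
Local Notation C := R[i].
Local Notation M := 'M[C]_n.
Implicit Types (f : C -> M) (P : 'M[{poly C}]_n) (q : {poly C}).

Definition upper (z : C) : bool := 0 < complex.Im z.

Lemma upper_nonreal z : upper z -> z \isn't Num.real.
Proof.
rewrite /upper => z0; apply/negP => /complex_realP[k e].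
by move: z0; rewrite e /= ltxx.
Qed.

Lemma upper_conj z : upper z -> ~~ upper z^*.
Proof. by rewrite /upper Im_conj => z0; rewrite -leNgt oppr_le0 ltW. Qed.

Definition pvalue P l : M := map_mx (horner_eval l) P.

(** The matrix determinant lemma for the identity, from two factorizations of one
   block matrix. *)
Lemma det_rank1 (u : 'cV[C]_n) (v : 'rV[C]_n) :
  \det (1%:M + u *m v) = 1 + (v *m u) 0 0.
Proof.
have e1 : block_mx (1%:M : M) (- u) v (1%:M : 'M[C]_1) =
    block_mx 1%:M 0 v 1%:M *m block_mx 1%:M (- u) 0 (1%:M + v *m u).
  rewrite mulmx_block !mul1mx !mulmx1 !mul0mx !addr0.
  by rewrite mulmxN addrC addrK.
have e2 : block_mx (1%:M : M) (- u) v (1%:M : 'M[C]_1) =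
    block_mx (1%:M + u *m v) (- u) 0 1%:M *m block_mx 1%:M 0 v 1%:M.
  rewrite mulmx_block !mul1mx !mulmx1 !mul0mx !mulmx0 !add0r.
  by rewrite mulNmx addrK.
have := congr1 determinant e2; rewrite e1 !det_mulmx det_lblock !det_ublock.
rewrite !det1 !mul1r !mulr1 det_mx11 !mxE eqxx /= => <-.
by rewrite mulr1n.
Qed.

(** Without poles and zeros in the upper half plane, the adjoint loop has no poles
   there by Cramer's rule, none in the lower half plane by reflection, and none on
   the real axis, where it is unitary. *)
Lemma pole_free_trivial f P q : Gminus f -> q != 0 ->
  off_finite (fun l => q.[l] *: f l = pvalue P l) ->
  (forall c, upper c -> q.[c] != 0) -> (forall c, upper c -> (\det P).[c] != 0) ->
  off_finite (fun l => f l = 1%:M).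
Proof.
move=> [fr fu fc fs] q0 hP hq hd.
pose X l := (f l^*) ^t*.
have realb : forall (g : C -> C) (c : C) (k : R -> R),
    (forall h : R, g (c + h%:C%C) = (k h)%:C%C) ->
    off_finite (fun l => X (g l) *m f (g l) = 1%:M) ->
    mx_right_bounded (fun l => X (g l)) c.
  move=> g c k gk /(off_finite_right c)[d d0 h1].
  exists ((n * n)%:R * (1 + 1)), d; split=> // h h0 hlt.
  rewrite /X nm_adj gk real_conj; apply: unitary_nm.
  by have := h1 h h0 hlt; rewrite /X gk real_conj.
have [A hA] : exists A, off_finite (fun l => X l = A).
  apply: rational_mx_liouville.
  - exact: rational_map_adj.
  - move=> c i j; have [cu|cu] := boolP (upper c).
      apply: (@ratio_right_bounded R (q * (\adj P) i j) (\det P)); last exact: hd.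
      apply: off_finite_sub (off_finite_and fs hP) => l [e1 e2].
      have : q.[l] *: (\adj (pvalue P l)) = (\det (pvalue P l)) *: X l.
        rewrite -[\adj _]mul1mx -e1 -mulmxA -scalemxr -scalemxl.
        by rewrite e2 mul_mx_adj mul_mx_scalar.
      move=> /matrixP/(_ i j); rewrite -map_mx_adj det_map_mx !mxZE => e3.
      by rewrite mulrC; apply: etrans (esym e3) _; rewrite hornerM mxE.
    have [c0|c0] := eqVneq (complex.Im c) 0.
      apply: (mx_right_bounded_entry (f := X)).
      apply: (realb id c (fun h => complex.Re c + h)) => // h.
      by move: c0; case: c {cu} => a b /= ->; apply: cplxP; rewrite /= ?addr0.
    have cu' : upper c^*.
      by rewrite /upper Im_conj oppr_gt0 lt_neqAle c0 leNgt.
    have [K [d [d0 hd']]] : right_bounded (fun l => f l j i) c^*.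
      apply: (@ratio_right_bounded R (P j i) q); last exact: hq.
      by apply: off_finite_sub hP => l /matrixP/(_ j i); rewrite !mxE mulrC.
    exists K, d; split=> // h h0 hlt; rewrite /X !mxE l1J conj_right.
    exact: hd'.
  - apply: mx_right_bounded_entry.
    apply: (realb (fun l => l^-1) 0 (fun h => h^-1)); last exact: (off_finite_inv fs).
    by move=> h; rewrite add0r fmorphV.
have A1 : A = 1%:M.
  apply: (@right_limit_unique R n (fun w => f w^-1) (fun=> 1%:M)) => //.
    by move=> i j; exact: regular_cvg_cst.
  have := off_finite_inv (off_finite_and fs hA) => /(off_finite_right 0)[d d0 h1].
  exists d => // h h0 hlt; have [e1 e2] := h1 h h0 hlt.
  by rewrite add0r in e1 e2; rewrite -e2.
apply: off_finite_sub (off_finite_and fs hA) => l [e1 e2].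
by rewrite -[LHS]mul1mx -{1}A1 -e2.
Qed.

Section Induction.
Variable D : (C -> M) -> Prop.
Hypothesis D_ext : forall f g, off_finite (fun l => f l = g l) -> D f -> D g.
Hypothesis D_1 : D (fun=> 1%:M).
Hypothesis D_mul : forall f g, D f -> D g -> D (fun l => f l *m g l).
Hypothesis D_simple : forall z p, z \isn't Num.real -> hermitian_projection p ->
  (\rank p <= 1)%N -> D (simple_element z p).

Let D_scalar z : z \isn't Num.real -> D (simple_element z 0).
Proof.
move=> hz; apply: D_simple => //; last by rewrite mxrank0.
by split; rewrite ?adj0 ?mul0mx.
Qed.

Lemma nonreal_conjz (z : C) : z \isn't Num.real -> z^* \isn't Num.real.
Proof. by rewrite !CrealE conjCK eq_sym. Qed.

(** A scalar simple element times one of rank at most one. *)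
Lemma simple_corank1 z p : z \isn't Num.real -> hermitian_projection p ->
  (\rank p <= 1)%N -> D (simple_element z (1%:M - p)).
Proof.
move=> hz hp rp.
apply: (@D_ext (fun l => simple_element z 0 l *m simple_element z^* p l)).
  apply: off_finite_sub (off_finite_and (off_finite_neq z) (off_finite_neq z^*)) => l [].
  rewrite -(subr_eq0 l z) -(subr_eq0 l (z^*)) => l1 l2.
  rewrite /simple_element conjCK add0r subr0 opprB addrCA subrr addr0.
  rewrite scalemxl mul1mx scalerDr scalerA mulrA divfK// divff// scale1r addrC //.
by apply: D_mul; [exact: D_scalar|apply: D_simple => //; exact: nonreal_conjz].
Qed.

Lemma prod_XsubC_upper (s : seq C) c : {in s, forall b, ~~ upper b} -> upper c ->
  (\prod_(b <- s) ('X - b%:P)).[c] != 0.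
Proof.
move=> hs cu; rewrite -[_ == 0]/(root _ c) root_prod_XsubC.
by apply/negP => /hs; rewrite cu.
Qed.

(** Each zero of the determinant in the upper half plane is moved to its
   conjugate by splitting off a simple factor whose complementary projection has
   rank one. *)
Lemma generation_zeros (m : nat) (bs : seq C) f P q k :
  count upper bs = m -> Gminus f -> q != 0 ->
  off_finite (fun l => q.[l] *: f l = pvalue P l) ->
  (forall c, upper c -> q.[c] != 0) -> k != 0 ->
  \det P = k *: \prod_(b <- bs) ('X - b%:P) -> D f.
Proof.
elim: m bs f P => [|m ih] bs f P cm hf q0 hP hq k0 dP.
  apply: D_ext D_1; apply: off_finite_sub (pole_free_trivial hf q0 hP hq _) => [l ->//|].
  move=> c cu; rewrite dP hornerZ mulf_neq0// prod_XsubC_upper//.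
  move=> b bb; apply/negP => bu.
  by move: cm => /eqP; rewrite -leqn0 leqNgt -has_count; apply/negP; rewrite negbK; apply/hasP; exists b.
have /hasP[b bb bu] : has upper bs by rewrite has_count cm.
have pbs := perm_to_rem bb.
have hb := upper_nonreal bu.
have {}cm : count upper (b^* :: rem b bs) = m.
  have := cm; rewrite (seq.permP pbs) /= bu (negbTE (upper_conj bu)) add1n => -[<-].
  by rewrite add0n.
have : \det (pvalue P b) == 0.
  rewrite det_map_mx dP (perm_big _ pbs) big_cons /= /horner_eval hornerZ hornerM.
  by rewrite hornerXsubC subrr mul0r mulr0.
move=> /det0P[v v0 vP].
pose s := (v *m v ^t*) 0 0.
have s0 : s != 0 by apply: contra v0 => /eqP/sqnorm_eq0 ->.
have vv : v *m v ^t* = s%:M by rewrite [LHS]mx11_scalar.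
have sr : s^* = s by apply/CrealP; exact: ger0_real (sqnorm_ge0 v).
clearbody s; pose e : M := s^-1 *: (v ^t* *m v).
have es : e ^t* = e by rewrite /e adjZ adjM adjK fmorphV /= sr.
have e2 : e *m e = e.
  rewrite /e scalemxl scalemxr mulmxA -(mulmxA _ v) vv mul_mx_scalar.
  by rewrite scalemxl !scalerA -mulrA mulVf// mulr1.
have eP : e *m pvalue P b = 0 by rewrite /e scalemxl -mulmxA vP mulmx0 scaler0.
have re : (\rank e <= 1)%N.
  by rewrite /e -scalemxl (leq_trans (mxrankM_maxl _ _))// rank_leq_col.
have hp : hermitian_projection (1%:M - e) by exact: compl_hermitian.
pose eC := map_mx polyC e : 'M[{poly C}]_n.
have [T hT] : exists T : 'M[{poly C}]_n, eC *m P = ('X - b%:P) *: T.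
  have hE (ij : 'I_n * 'I_n) : exists t, (eC *m P) ij.1 ij.2 = t * ('X - b%:P).
    apply/factor_theorem; rewrite /root; apply/eqP.
    have := congr1 (fun X : M => X ij.1 ij.2) eP; rewrite mx0E => <-.
    rewrite !mxE horner_sum; apply: eq_bigr => l _.
    by rewrite !mxE hornerM hornerC.
  have [T hT] := choice hE; exists (\matrix_(i, j) T (i, j)).
  by apply/matrixP => i j; rewrite !mxE mulrC -(hT (i, j)) mxE.
(* The factor with pole at [b] is harmless, as its polar part kills [P] at [b]. *)
pose P1 : 'M[{poly C}]_n := P - eC *m P + ('X - (b^*)%:P) *: T.
have evC l : map_mx (horner_eval l) eC = e.
  by apply/matrixP => i j; rewrite !mxE /horner_eval hornerC.
have evT l : (l - b) *: pvalue T l = e *m pvalue P l.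
  rewrite -(evC l) -map_mxM hT; apply/matrixP => i j.
  by rewrite !mxE /= /horner_eval hornerM hornerXsubC.
have evP1 l : l != b -> pvalue P1 l = simple_element b^* (1%:M - e) l *m pvalue P l.
  move=> lb; have lb' : l - b != 0 by rewrite subr_eq0.
  have -> : pvalue P1 l = pvalue P l - e *m pvalue P l + (l - b^*) *: pvalue T l.
    rewrite /pvalue /P1 map_mxD map_mxB map_mxM evC; congr (_ + _).
    by apply/matrixP => i j; rewrite !mxE /= /horner_eval hornerM hornerXsubC.
  rewrite /simple_element conjCK opprB addrCA subrr addr0 mulmxDl mulmxBl mul1mx.
  by congr (_ + _); rewrite scalemxl -evT scalerA divfK.
have dP1 : \det P1 = k *: \prod_(b <- b^* :: rem b bs) ('X - b%:P).
  have : ('X - b%:P) * \det P1 = ('X - (b^*)%:P) * \det P.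
    apply: poly_off_finite_eq; apply: off_finite_sub (off_finite_neq b) => l lb.
    have lb' : l - b != 0 by rewrite subr_eq0.
    rewrite !hornerM !hornerE -![(\det _).[l]]/(horner_eval l _) -!det_map_mx.
    rewrite -/(pvalue P1 l) (evP1 l lb) det_mulmx.
    have -> : simple_element b^* (1%:M - e) l =
        1%:M + (((l - b^*) / (l - b) - 1) * s^-1) *: v ^t* *m v.
      rewrite /simple_element conjCK opprB addrCA subrr addr0 scalemxl -[in RHS]scalerA.
      by rewrite -/e scalerBl scale1r [RHS]addrA [RHS]addrAC.
    rewrite det_rank1 scalemxr vv !mxE eqxx mulr1n -mulrA mulVf// mulr1.
    by rewrite [1 + _]addrC subrK mulrA mulrCA divff// mulr1.
  rewrite dP (perm_big _ pbs) !big_cons /= -!scalerAr mulrCA => /esym h.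
  have Xb : 'X - b%:P != 0 :> {poly C} by rewrite polyXsubC_eq0.
  by apply: (mulfI Xb); rewrite -h -scalerAr.
pose f1 l := simple_element b^* (1%:M - e) l *m f l.
have hf1 : Gminus f1 by apply: GminusM => //; exact: Gminus_simple.
have hP1 : off_finite (fun l => q.[l] *: f1 l = pvalue P1 l).
  apply: off_finite_sub (off_finite_and hP (off_finite_neq b)) => l [e1 lb].
  by rewrite evP1// -e1 /f1 scalemxr.
have Df1 := ih _ _ _ cm hf1 q0 hP1 hq k0 dP1.
apply: (@D_ext (fun l => simple_element b (1%:M - e) l *m f1 l)); last first.
  by apply: D_mul => //; apply: simple_corank1.
apply: off_finite_sub (off_finite_and (off_finite_neq b) (off_finite_neq b^*)) => l [l1 l2].
by have [_ p2] := hp; rewrite /f1 mulmxA simple_elementK// mul1mx.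
Qed.

(** Each root of the common denominator in the upper half plane is moved to its
   conjugate by a scalar simple element. *)
Lemma generation_poles (m : nat) (rs : seq C) f P :
  count upper rs = m -> Gminus f ->
  off_finite (fun l => (\prod_(b <- rs) ('X - b%:P)).[l] *: f l = pvalue P l) -> D f.
Proof.
elim: m rs f => [|m ih] rs f cm hf hP.
  have q0 : \prod_(b <- rs) ('X - b%:P) != 0 by exact: monic_neq0 (monic_prod_XsubC _ _ _).
  have dP0 : \det P != 0.
    have [_ fu _ _] := hf.
    have [l [e1 [e2 e3]]] := off_finite_ex 0
      (off_finite_and hP (off_finite_and fu (off_finite_nroot q0))).
    apply: contraTneq e2 => dP; rewrite unitmxE unitfE negbK.
    have : \det (pvalue P l) = 0 by rewrite det_map_mx dP rmorph0.
    by rewrite -e1 detZ => /eqP; rewrite mulf_eq0 expf_eq0 (negbTE e3) andbF.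
  have [bs hbs] := closed_field_poly_normal (\det P).
  apply: (@generation_zeros (count upper bs) bs f P (\prod_(b <- rs) ('X - b%:P))
    (lead_coef (\det P))) => //.
    move=> c cu; apply: prod_XsubC_upper => // b bb; apply/negP => bu.
    by move: cm => /eqP; rewrite -leqn0 leqNgt -has_count; apply/negP; rewrite negbK; apply/hasP; exists b.
  by rewrite lead_coef_eq0.
have /hasP[b bb bu] : has upper rs by rewrite has_count cm.
have pbs := perm_to_rem bb; have hb := upper_nonreal bu.
have {}cm : count upper (b^* :: rem b rs) = m.
  have := cm; rewrite (seq.permP pbs) /= bu (negbTE (upper_conj bu)) add1n => -[<-].
  by rewrite add0n.
have h0 : hermitian_projection (0 : M) by split; rewrite ?adj0 ?mul0mx.
pose f1 l := simple_element b 0 l *m f l.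
have hf1 : Gminus f1 by apply: GminusM => //; exact: Gminus_simple.
have Df1 : D f1.
  apply: (ih _ _ cm hf1).
  apply: off_finite_sub (off_finite_and hP (off_finite_neq b^*)) => l [<- lb].
  rewrite (perm_big _ pbs) !big_cons /= !hornerM !hornerE /f1 /simple_element.
  rewrite add0r subr0 scalemxl mul1mx scalerA; congr (_ *: _).
  move: (_.[l]) lb; rewrite -(subr_eq0 l); move: (b^*) => w X lb.
  by field.
apply: (@D_ext (fun l => simple_element b^* 0 l *m f1 l)); last first.
  by apply: D_mul => //; apply: D_scalar; exact: nonreal_conjz.
apply: off_finite_sub (off_finite_and (off_finite_neq b) (off_finite_neq b^*)) => l [l1 l2].
have := @simple_elementK R n b^* 0 l l2; rewrite conjCK => /(_ l1) h.
by rewrite /f1 mulmxA h ?mul0mx// mul1mx.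
Qed.

(** Induction over generators: the rational loop group is generated by the simple
   elements of rank at most one. *)
Lemma Gminus_ind f : Gminus f -> D f.
Proof.
move=> hf; have [/rational_mapP[P [q [q0 hP]]] _ _ _] := hf.
have [rs hrs] := closed_field_poly_normal q.
have k0 : lead_coef q != 0 by rewrite lead_coef_eq0.
apply: (@generation_poles _ rs f ((lead_coef q)^-1%:P *: P) erefl hf).
apply: off_finite_sub hP => l; rewrite {1}hrs hornerZ => e.
have -> : pvalue ((lead_coef q)^-1%:P *: P) l = (lead_coef q)^-1 *: pvalue P l.
  by apply/matrixP => i j; rewrite !mxE /horner_eval hornerM hornerC.
have {}e : _ = pvalue P l := e.
by rewrite -e scalerA mulrA mulVf// mul1r.
Qed.

End Induction.

End Generation.

(** * Perturbed logistic inequalities *)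

Section ScalarAsymptotics.
Context {R : realType}.
Implicit Types (f Q e : R -> R).

Lemma rderX (m : nat) (x : R) :
  is_derive x 1 (fun s => s ^+ m.+1) (m.+1%:R * x ^+ m).
Proof.
elim: m => [|m ih].
  by apply: rder_eq (rder_id x) _; rewrite mul1r expr0.
have h := rderM (rder_id x) ih.
rewrite (_ : (fun s => s ^+ m.+2) = (fun s => s * s ^+ m.+1)); last first.
  by apply/funext => s; rewrite exprS.
by apply: rder_eq h _; rewrite exprS -[m.+2%:R]natr1; ring.
Qed.

Lemma rder_barrier (m : nat) (K x : R) : 0 < x ->
  is_derive x 1 (fun s => K / s ^+ m.+1) (- (m.+1%:R / x) * (K / x ^+ m.+1)).
Proof.
move=> x0; have xn : x ^+ m.+1 != 0 by rewrite expf_neq0 ?gt_eqF.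
have h := @rderM R (fun=> K) (fun s => (s ^+ m.+1)^-1) x _ _
  (rder_cst K x) (@rderV R (fun s => s ^+ m.+1) x _ xn (rderX m x)).
apply: rder_eq h _; rewrite mul0r add0r [x ^+ m.+1]exprS.
by field; rewrite expf_neq0 gt_eqF.
Qed.

(** The function [f x * expR (- c * x)] is nondecreasing. *)
Lemma exp_comparison f f' (c a b : R) : a <= b ->
  (forall x, a <= x <= b -> is_derive x 1 f (f' x)) ->
  (forall x, a <= x <= b -> c * f x <= f' x) ->
  f a * expR (c * (b - a)) <= f b.
Proof.
move=> ab df hf.
have h : f a * expR (- c * a) <= f b * expR (- c * b).
  apply: (@rder_ndecr R (fun s => f s * expR (- c * s))
    (fun s => f' s * expR (- c * s) + f s * (- c * expR (- c * s)))) => //.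
    by move=> x xab; exact: rderM (df x xab) (rder_expM _ _).
  move=> x xab; rewrite mulrCA mulrA -mulrDl mulr_ge0 ?expR_ge0//.
  by rewrite mulNr subr_ge0 hf.
have := ler_wpM2r (expR_ge0 (c * b)) h.
by rewrite -!mulrA -!expRD mulrBr !mulNr addNr expR0 mulr1 addrC.
Qed.

Definition rapid_right f := forall m : nat,
  exists2 K, 0 <= K & forall x, 1 <= x -> `|f x| <= K / x ^+ m.+1.

(** If [Q] ever exceeded the barrier [M / x ^ (m + 1)], the excess would grow
   exponentially from then on and force [Q] past [1]. *)
Lemma logistic_escape Q Q' e (k x1 : R) : 0 < k -> 1 <= x1 ->
  (forall x : R, is_derive x 1 Q (Q' x)) -> (forall x, 0 <= Q x <= 1) ->
  rapid_right e -> (forall x, x1 <= x -> k * Q x - e x <= Q' x) -> rapid_right Q.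
Proof.
move=> k0 x11 dQ Q01 he hQ m; have [K K0 hK] := he m.
pose M := K / k; have M0 : 0 <= M by rewrite divr_ge0// ltW.
have big x : x1 <= x -> Q x <= M / x ^+ m.+1.
  move=> x1x; rewrite leNgt; apply/negP => Qx.
  have x1' := le_trans x11 x1x.
  pose f s := Q s - M / s ^+ m.+1.
  have f0 : 0 < f x by rewrite subr_gt0.
  (* Growth at rate [k] from the value [f x] exceeds [1] at this point. *)
  pose b := x + (f x)^-1 / k.
  have xb : x <= b by rewrite lerDl divr_ge0 ?invr_ge0 ?ltW.
  have := @exp_comparison f (fun s => Q' s - - (m.+1%:R / s) * (M / s ^+ m.+1)) k x b xb.
  have le1 s : x <= s <= b -> 1 <= s by move=> /andP[xs _]; exact: le_trans xs.
  have /[swap]/[apply] : forall s, x <= s <= b -> is_derive s 1 f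
      (Q' s - - (m.+1%:R / s) * (M / s ^+ m.+1)).
    move=> s /le1 s1; have s0 := lt_le_trans ltr01 s1.
    exact: (@rderB R Q (fun s => M / s ^+ m.+1) s _ _ (dQ s) (rder_barrier m M s0)).
  have /[swap]/[apply] : forall s, x <= s <= b ->
      k * f s <= Q' s - - (m.+1%:R / s) * (M / s ^+ m.+1).
    move=> s sb; have s1 := le1 s sb; have s0 := lt_le_trans ltr01 s1.
    have xs : x1 <= s by case/andP: sb => xs _; exact: le_trans xs.
    have h1 := hQ s xs; have h2 := hK s s1.
    have h3 := le_trans (ler_norm _) h2.
    have h4 : k * (M / s ^+ m.+1) = K / s ^+ m.+1.
      by rewrite /M mulrA mulrCA divff ?mulr1// gt_eqF.
    have h5 : 0 <= m.+1%:R / s * (M / s ^+ m.+1).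
      by rewrite !mulr_ge0 ?invr_ge0 ?exprn_ge0// ltW.
    rewrite /f mulrBr h4 mulNr opprK; lra.
  have -> : k * (b - x) = (f x)^-1.
    by rewrite /b addrC addKr mulrC divfK// gt_eqF.
  move=> hb; have := expR_ge1Dx (f x)^-1 => hexp.
  have : f x * (1 + (f x)^-1) <= f b.
    by apply: le_trans hb; rewrite ler_wpM2l// ltW.
  rewrite mulrDr mulr1 divff ?gt_eqF// leNgt => /negP; apply.
  have Mb : 0 <= M / b ^+ m.+1.
    by rewrite divr_ge0// exprn_ge0// (le_trans _ xb)// (le_trans _ x1').
  have /andP[_ Qb] := Q01 b.
  have : f b <= 1 by rewrite /f; lra.
  lra.
have x10 : 0 <= x1 by exact: le_trans x11.
exists (M + x1 ^+ m.+1); first by rewrite addr_ge0// exprn_ge0.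
move=> x x1'; have xp : 0 < x ^+ m.+1 by rewrite exprn_gt0// (lt_le_trans ltr01).
have /andP[Q0 Q1] := Q01 x; rewrite ger0_norm// mulrDl.
have [xx1|/ltW xx1] := leP x1 x.
  apply: le_trans (big x xx1) _; rewrite lerDl.
  exact: divr_ge0 (exprn_ge0 _ x10) (ltW xp).
apply: (le_trans Q1); apply: le_trans (_ : x1 ^+ m.+1 / x ^+ m.+1 <= _); last first.
  by rewrite lerDr divr_ge0// ltW.
by rewrite ler_pdivlMr// mul1r lerXn2r ?nnegrE// (le_trans _ x1').
Qed.

(** Once the barrier [M / x ^ (m + 1)] decreases slower than the exponential of
   rate [k / 2], the relaxation of rate [k] keeps [Q] below it. *)
Lemma logistic_settle Q Q' e (k x1 : R) : 0 < k -> 1 <= x1 ->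
  (forall x : R, is_derive x 1 Q (Q' x)) -> (forall x, 0 <= Q x <= 1) ->
  rapid_right e -> (forall x, x1 <= x -> Q' x <= - k * Q x + e x) -> rapid_right Q.
Proof.
move=> k0 x11 dQ Q01 he hQ m; have [K K0 hK] := he m.
(* Beyond [x4] the barrier has logarithmic derivative at least [- k / 2]. *)
pose x4 := x1 + m.+1%:R / (k / 2).
have k2 : 0 < k / 2 by rewrite divr_gt0.
have x14 : x1 <= x4 by rewrite lerDl divr_ge0// ltW.
have x41 : 1 <= x4 by exact: le_trans x14.
have x40 : 0 <= x4 by exact: le_trans x41.
pose M := K / (k / 2) + x4 ^+ m.+1.
have M0 : 0 <= M by rewrite addr_ge0 ?exprn_ge0// divr_ge0// ltW.
have small x : 1 <= x -> x <= x4 -> Q x <= M / x ^+ m.+1.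
  move=> x1' xx4; have xp : 0 < x ^+ m.+1 by rewrite exprn_gt0// (lt_le_trans ltr01).
  have /andP[_ Q1] := Q01 x; apply: (le_trans Q1); rewrite ler_pdivlMr// mul1r.
  apply: le_trans (_ : x4 ^+ m.+1 <= _); last by rewrite lerDr divr_ge0// ltW.
  by rewrite lerXn2r ?nnegrE// (le_trans _ x1').
exists M => // x x1'; have /andP[Q0 _] := Q01 x; rewrite ger0_norm//.
have [xx4|/ltW x4x] := leP x x4; first exact: small.
have := @exp_comparison (fun s => M / s ^+ m.+1 - Q s)
  (fun s => - (m.+1%:R / s) * (M / s ^+ m.+1) - Q' s) (- k) x4 x x4x.
have le1 s : x4 <= s <= x -> 1 <= s by move=> /andP[xs _]; exact: le_trans xs.
have /[swap]/[apply] : forall s, x4 <= s <= x ->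
    is_derive s 1 (fun s => M / s ^+ m.+1 - Q s)
    (- (m.+1%:R / s) * (M / s ^+ m.+1) - Q' s).
  move=> s /le1 s1; have s0 := lt_le_trans ltr01 s1.
  exact: (@rderB R (fun s => M / s ^+ m.+1) Q s _ _ (rder_barrier m M s0) (dQ s)).
have /[swap]/[apply] : forall s, x4 <= s <= x ->
    - k * (M / s ^+ m.+1 - Q s) <= - (m.+1%:R / s) * (M / s ^+ m.+1) - Q' s.
  move=> s sb; have s1 := le1 s sb; have s0 := lt_le_trans ltr01 s1.
  have /andP[xs _] := sb.
  have h1 := hQ s (le_trans x14 xs); have h3 := le_trans (ler_norm _) (hK s s1).
  have sp : 0 < s ^+ m.+1 by rewrite exprn_gt0.
  have h5 : m.+1%:R / s <= k / 2.
    rewrite ler_pdivrMr// mulrC -ler_pdivrMr//; apply: le_trans xs.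
    by rewrite /x4 lerDr (le_trans _ x11).
  have h6 : 0 <= M / s ^+ m.+1 by rewrite divr_ge0// ltW.
  have h7 := ler_wpM2r h6 h5.
  have h8 : K / s ^+ m.+1 <= k / 2 * (M / s ^+ m.+1).
    rewrite mulrA ler_pM2r ?invr_gt0// /M mulrDr mulrCA divff ?gt_eqF// mulr1.
    by rewrite lerDl mulr_ge0 ?exprn_ge0// ltW.
  lra.
move=> h; rewrite -subr_ge0; apply: le_trans h; rewrite mulr_ge0 ?expR_ge0//.
by rewrite subr_ge0 small.
Qed.

(** A perturbed logistic inequality leaves only the two rest points as limits,
   and they are reached at the rate of the perturbation: once [Q - K / x], which
   is monotone, has passed one half, [Q] is attracted by [1]; if it never does,
   [Q] can only stay below one half by decaying. *)
Lemma logistic_dichotomy Q Q' e (k : R) : 0 < k ->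
  (forall x : R, is_derive x 1 Q (Q' x)) -> (forall x, 0 <= Q x <= 1) ->
  rapid_right e -> (forall x, 1 <= x -> k * (Q x * (1 - Q x)) - e x <= Q' x) ->
  rapid_right Q \/ rapid_right (fun x => 1 - Q x).
Proof.
move=> k0 dQ Q01 he hQ; have [K K0 hK] := he 1%N.
pose H s := Q s - K / s ^+ 1.
have mono x y : 1 <= x -> x <= y -> H x <= H y.
  move=> x1 xy; apply: (@rder_ndecr R H
    (fun s => Q' s - - (1%:R / s) * (K / s ^+ 1))) => // s /andP[xs _];
    have s1 := le_trans x1 xs; have s0 := lt_le_trans ltr01 s1.
    exact: (@rderB R Q (fun s => K / s ^+ 1) s _ _ (dQ s) (rder_barrier 0 K s0)).
  have := hQ s s1; have := le_trans (ler_norm _) (hK s s1).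
  have /andP[Q0 Q1] := Q01 s.
  have : 0 <= k * (Q s * (1 - Q s)) by rewrite !mulr_ge0 ?subr_ge0// ltW.
  rewrite (_ : - (1%:R / s) * (K / s ^+ 1) = - (K / s ^+ 2)); last first.
    by field; rewrite gt_eqF.
  lra.
have [[x1 [x11 Hx1]]|hn] := pselect (exists x1, 1 <= x1 /\ 2^-1 < H x1).
  right; apply: (@logistic_settle _ (fun x => 0 - Q' x) e (k / 2) x1) => //.
  - by rewrite divr_gt0.
  - by move=> x; have /andP[Q0 Q1] := Q01 x; rewrite subr_ge0 Q1 lerBlDr lerDl.
  move=> x xx1; have x1' := le_trans x11 xx1.
  have := hQ x x1'; have := mono x1 x x11 xx1.
  have : 0 <= K / x ^+ 1 by rewrite divr_ge0// (le_trans _ x1').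
  have /andP[Q0 Q1] := Q01 x; rewrite /H => h1 h2 h3.
  have h4 : 2^-1 <= Q x by move: Hx1 h2; rewrite /H; lra.
  have : 2^-1 * (k * (1 - Q x)) <= Q x * (k * (1 - Q x)).
    by rewrite ler_wpM2r// mulr_ge0 ?subr_ge0// ltW.
  lra.
left; pose x2 := 1 + 4 * K.
have x21 : 1 <= x2 by rewrite lerDl mulr_ge0.
apply: (@logistic_escape _ Q' e (k / 4) x2) => //; first by rewrite divr_gt0.
move=> x xx2; have x1 := le_trans x21 xx2; have x0 := lt_le_trans ltr01 x1.
have := hQ x x1; have /andP[Q0 Q1] := Q01 x.
have : H x <= 2^-1 by rewrite leNgt; apply/negP => h; apply: hn; exists x.
have : K / x ^+ 1 <= 4^-1.
  by rewrite ler_pdivrMr// expr1; move: xx2; rewrite /x2; lra.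
rewrite /H => h1 h2 h3; have h4 : Q x <= 3 / 4 by lra.
have : 4^-1 * (k * Q x) <= (1 - Q x) * (k * Q x).
  by rewrite ler_wpM2r ?mulr_ge0 ?(ltW k0)//; lra.
lra.
Qed.

Definition rapid f := forall m : nat, exists K, forall x, `|x ^+ m * f x| <= K.

Lemma rapid_rightP f : rapid f -> rapid_right f /\ rapid_right (fun x => f (- x)).
Proof.
move=> hf; split=> m; have [K hK] := hf m.+1; exists `|K| => // x x1;
  have x0 := lt_le_trans ltr01 x1; rewrite ler_pdivlMr ?exprn_gt0// mulrC.
  by have := hK x; rewrite normrM normrX (gtr0_norm x0) => /le_trans; apply; exact: ler_norm.
by have := hK (- x); rewrite normrM normrX normrN (gtr0_norm x0) => /le_trans; apply;
  exact: ler_norm.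
Qed.

Lemma rapid_of_right f c : (forall x, `|f x| <= c) ->
  rapid_right f -> rapid_right (fun x => f (- x)) -> rapid f.
Proof.
move=> bf h1 h2 m; have [K K0 hK] := h1 m; have [L L0 hL] := h2 m.
have c0 : 0 <= c := le_trans (normr_ge0 _) (bf 0).
exists (c + K + L) => x; rewrite normrM normrX.
have [x1|x1] := leP `|x| 1.
  apply: le_trans (_ : `|f x| <= _).
    by rewrite ler_piMl// exprn_ile1.
  by apply: le_trans (bf x) _; rewrite -addrA lerDl addr_ge0.
have xp : 0 < `|x| ^+ m by rewrite exprn_gt0// (lt_trans ltr01).
have lem (g : R -> R) (J y : R) : 0 <= J -> `|y| = `|x| -> 1 <= y ->
    (forall x, 1 <= x -> `|g x| <= J / x ^+ m.+1) -> `|x| ^+ m * `|g y| <= J.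
  move=> J0 yx y1 hg; have y0 := lt_le_trans ltr01 y1.
  rewrite -yx (ger0_norm (ltW y0)).
  apply: le_trans (ler_wpM2l _ (hg y y1)) _; first by rewrite exprn_ge0// ltW.
  rewrite mulrCA exprSr invfM (mulrA (y ^+ m)) divff ?expf_neq0 ?gt_eqF// mul1r.
  by rewrite ler_piMr// invf_le1.
have [x0|/ltW x0] := leP 0 x.
  apply: le_trans (lem f K x K0 erefl _ hK) _.
    by move: x1; rewrite ger0_norm// => /ltW.
  by rewrite -addrA addrCA lerDl addr_ge0.
have := lem (fun x => f (- x)) L (- x) L0; rewrite normrN opprK => h.
apply: le_trans (h erefl _ hL) _; last by rewrite lerDr addr_ge0.
by move: x1; rewrite ler0_norm// => /ltW.
Qed.

Lemma logistic_rapid_right Q Q' e (k : R) : 0 < k ->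
  (forall x : R, is_derive x 1 Q (Q' x)) -> (forall x, 0 <= Q x <= 1) ->
  rapid_right e -> (forall x, k * (Q x * (1 - Q x)) - e x <= Q' x) ->
  rapid_right (fun x => Q x * (1 - Q x)).
Proof.
move=> k0 dQ Q01 he hQ.
have [|h|h] := logistic_dichotomy k0 dQ Q01 he; first by move=> x _; exact: hQ.
  move=> m; have [K K0 hK] := h m; exists K => // x x1; apply: le_trans (hK x x1).
  have /andP[Q0 Q1] := Q01 x; rewrite normrM ler_piMr//.
  by rewrite ger0_norm ?subr_ge0// lerBlDr lerDl.
move=> m; have [K K0 hK] := h m; exists K => // x x1; apply: le_trans (hK x x1).
by have /andP[Q0 Q1] := Q01 x; rewrite normrM ler_piMl// ger0_norm.
Qed.

Lemma logistic_rapid_rightN Q Q' e (k : R) : 0 < k ->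
  (forall x : R, is_derive x 1 Q (Q' x)) -> (forall x, 0 <= Q x <= 1) ->
  rapid_right e -> (forall x, Q' x <= e x - k * (Q x * (1 - Q x))) ->
  rapid_right (fun x => Q x * (1 - Q x)).
Proof.
move=> k0 dQ Q01 he hQ.
have -> : (fun x => Q x * (1 - Q x)) = (fun x => (1 - Q x) * (1 - (1 - Q x))).
  by apply/funext => x; rewrite subKr mulrC.
apply: (@logistic_rapid_right _ (fun x => 0 - Q' x) e k k0) => //.
- by move=> x; have /andP[Q0 Q1] := Q01 x; rewrite subr_ge0 Q1 lerBlDr lerDl.
- move=> x; have := hQ x; rewrite subKr (mulrC (1 - Q x)); lra.
Qed.

(** Passing to [1 - Q], or reversing the direction of the line, changes the sign
   of [s] and keeps [Q * (1 - Q)]. *)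
Lemma logistic_rapid Q Q' T e (s d : R) : s != 0 -> 0 < d ->
  (forall x : R, is_derive x 1 Q (Q' x)) -> (forall x, 0 <= Q x <= 1) ->
  rapid e -> (forall x, `|Q' x - s * T x| <= e x) ->
  (forall x, d * (Q x * (1 - Q x)) <= T x) ->
  rapid (fun x => Q x * (1 - Q x)).
Proof.
move=> s0 d0 dQ Q01 /rapid_rightP[e1 e2] hQ hT.
have sd : 0 < `|s| * d by rewrite mulr_gt0// normr_gt0.
have dQr (x : R) : is_derive x 1 (fun x => Q (- x)) (- Q' (- x)).
  exact: rder_reflect.
have h x : Q' x <= s * T x + e x /\ s * T x - e x <= Q' x.
  by have := hQ x; rewrite ler_norml => /andP[? ?]; split; lra.
apply: (@rapid_of_right _ 1).
- move=> x; have /andP[Q0 Q1] := Q01 x.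
  have P0 : 0 <= 1 - Q x by rewrite subr_ge0.
  by rewrite ger0_norm ?mulr_ge0// mulr_ile1// lerBlDr lerDl.
- have [sp|sn] := ltP 0 s.
    apply: (logistic_rapid_right sd dQ Q01 e1) => x; rewrite (gtr0_norm sp).
    have [_] := h x; have := ler_wpM2l (ltW sp) (hT x); lra.
  apply: (logistic_rapid_rightN sd dQ Q01 e1) => x; rewrite (ler0_norm sn).
  have [+ _] := h x; have := ler_wnM2l sn (hT x); lra.
- have [sp|sn] := ltP 0 s.
    apply: (logistic_rapid_rightN sd dQr (fun x => Q01 (- x)) e2) => x.
    rewrite (gtr0_norm sp).
    have [_] := h (- x); have := ler_wpM2l (ltW sp) (hT (- x)); lra.
  apply: (logistic_rapid_right sd dQr (fun x => Q01 (- x)) e2) => x.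
  rewrite (ler0_norm sn).
  have [+ _] := h (- x); have := ler_wnM2l sn (hT (- x)); lra.
Qed.

End ScalarAsymptotics.

(** * Rapid decay *)

Section RapidDecay.
Context {R : realType}.
Local Notation C := R[i].
Implicit Types f g : R -> R.

Lemma rapid_le f g : rapid g -> (forall x, `|f x| <= g x) -> rapid f.
Proof.
move=> hg fg m; have [K hK] := hg m; exists K => x; apply: le_trans (hK x).
by rewrite !normrM ler_wpM2l// (le_trans (fg x))// ler_norm.
Qed.

Lemma rapidD f g : rapid f -> rapid g -> rapid (fun x => f x + g x).
Proof.
move=> hf hg m; have [K hK] := hf m; have [L hL] := hg m.
by exists (K + L) => x; rewrite mulrDr (le_trans (ler_normD _ _))// lerD.
Qed.

Lemma rapidZ c f : rapid f -> rapid (fun x => c * f x).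
Proof.
move=> hf m; have [K hK] := hf m; exists (`|c| * K) => x.
by rewrite mulrCA normrM ler_wpM2l.
Qed.

Lemma rapid_norm f : rapid f -> rapid (fun x => `|f x|).
Proof.
move=> hf m; have [K hK] := hf m; exists K => x.
by rewrite normrM normr_id -normrM.
Qed.

Lemma rapid_sum (I : Type) (r : seq I) (P : pred I) (f : I -> R -> R) :
  (forall i, rapid (f i)) -> rapid (fun x => \sum_(i <- r | P i) f i x).
Proof.
move=> hf; elim: r => [|i r ih].
  by move=> m; exists 0 => x; rewrite big_nil mulr0 normr0.
under eq_fun do rewrite big_cons.
by case: (P i) => //; exact: rapidD.
Qed.

(** Since [|t| <= 1 + t ^ 2], square roots of rapidly decreasing functions are
   rapidly decreasing. *)
Lemma rapid_sqr f : rapid (fun x => f x ^+ 2) -> rapid f.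
Proof.
move=> hf m; have [K hK] := hf (2 * m)%N; exists (1 + K) => x.
have le_sqr (t : R) : `|t| <= 1 + t ^+ 2.
  rewrite -real_normK ?num_real//; have := sqr_ge0 (`|t| - 2^-1); lra.
apply: le_trans (le_sqr _) _; rewrite lerD2l (le_trans (ler_norm _))//.
by rewrite exprMn -exprM mulnC.
Qed.

Lemma rder_sum (I : Type) (r : seq I) (P : pred I) (f : I -> R -> R) (x : R) d :
  (forall i, is_derive x 1 (f i) (d i)) ->
  is_derive x 1 (fun s => \sum_(i <- r | P i) f i s) (\sum_(i <- r | P i) d i).
Proof.
move=> df; elim: r => [|i r ih].
  by under eq_fun do rewrite big_nil; rewrite big_nil; exact: rder_cst.
under eq_fun do rewrite big_cons; rewrite big_cons.
by case: (P i) => //; exact: rderD.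
Qed.

(** The replicator equation with fitnesses [alpha]: in the total mass of the
   indices of fitness at most [alpha j] it is a logistic equation, so two
   indices of different fitness cannot coexist at infinity. *)
Lemma replicator_rapid (n : nat) (alpha : 'I_n -> R) (q r : 'I_n -> R -> R)
    (e : R -> R) (s : R) : s != 0 -> rapid e ->
  (forall i x, 0 <= q i x) -> (forall i x, q i x * (\sum_k q k x) = q i x) ->
  (forall i (x : R), is_derive x 1 (q i)
     (s * (\sum_k (alpha k - alpha i) * (q i x * q k x)) + r i x)) ->
  (forall i x, `|r i x| <= e x) ->
  forall j k, alpha j < alpha k -> rapid (fun x => q j x * q k x).
Proof.
move=> s0 re q0 qtau dq hr j k jk.
pose low := [pred i | alpha i <= alpha j].
pose Q x := \sum_(i | low i) q i x.
pose Qc x := \sum_(i | ~~ low i) q i x.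
have QQc x : \sum_i q i x = Q x + Qc x by rewrite (bigID low).
have Q0 x : 0 <= Q x by apply: sumr_ge0 => i _.
have Qc0 x : 0 <= Qc x by apply: sumr_ge0 => i _.
have Qtau x : Q x * (Q x + Qc x) = Q x.
  by rewrite -QQc /Q mulr_suml; apply: eq_bigr => i _.
have QE x : Q x * Qc x = Q x * (1 - Q x).
  by have := Qtau x; lra.
have Q1 x : Q x <= 1.
  have [h|h] := eqVneq (Q x) 0; first by rewrite h.
  have := Qtau x; rewrite -{3}[Q x]mulr1 => /(mulfI h) <-; by rewrite lerDl.
have jlow : low j by rewrite /= lexx.
have klow : ~~ low k by rewrite /= -ltNge.
have qj x : q j x <= Q x by rewrite /Q (bigD1 j)//= lerDl sumr_ge0.
have qk x : q k x <= Qc x by rewrite /Qc (bigD1 k)//= lerDl sumr_ge0.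
suff hQ : rapid (fun x => Q x * (1 - Q x)).
  apply: rapid_le hQ _ => x; rewrite ger0_norm ?mulr_ge0// -QE.
  by rewrite ler_pM.
(* The least fitness above that of [j] leaves a gap [d] to all of [low]. *)
pose top := [arg min_(i < k | ~~ low i) alpha i]%O.
have [topl topm] : ~~ low top /\ forall i, ~~ low i -> alpha top <= alpha i.
  by rewrite /top; case: Order.TotalTheory.arg_minP.
pose d := alpha top - alpha j.
have d0 : 0 < d by rewrite subr_gt0; move: topl; rewrite /= -ltNge.
pose T x := \sum_(i | low i) \sum_(k | ~~ low k) (alpha k - alpha i) * (q i x * q k x).
pose Q' x := \sum_(i | low i)
  (s * (\sum_k (alpha k - alpha i) * (q i x * q k x)) + r i x).
(* The exchanges inside [low] cancel. *)
have anti x : \sum_(i | low i) \sum_(k | low k) (alpha k - alpha i) * (q i x * q k x) = 0.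
  set S := LHS; have : S = - S.
    rewrite {1}/S exchange_big /= /S -sumrN; apply: eq_bigr => i _.
    rewrite -sumrN; apply: eq_bigr => l _.
    by rewrite -mulNr opprB (mulrC (q i x)).
  by move=> h; clearbody S; lra.
have Q'E x : Q' x = s * T x + \sum_(i | low i) r i x.
  rewrite /Q' big_split /= -mulr_sumr; congr (s * _ + _).
  transitivity (\sum_(i | low i) (\sum_(k | low k) (alpha k - alpha i) * (q i x * q k x)
    + \sum_(k | ~~ low k) (alpha k - alpha i) * (q i x * q k x))).
    by apply: eq_bigr => i _; rewrite [LHS](bigID low).
  by rewrite big_split /= anti add0r.
apply: (@logistic_rapid R Q Q' T (fun x => n%:R * e x) s d) => //.
- by move=> x; apply: rder_sum => i.
- by move=> x; rewrite Q0 Q1.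
- exact: rapidZ.
- move=> x; rewrite Q'E addrC addKr.
  apply: le_trans (ler_norm_sum _ _ _) _.
  apply: le_trans (_ : \sum_(i < n) `|r i x| <= _).
    by rewrite [leRHS](bigID low) /= lerDl sumr_ge0.
  apply: le_trans (ler_sum _ (fun i _ => hr i x)) _.
  by rewrite sumr_const card_ord mulr_natl.
- move=> x; rewrite -QE /Q mulr_suml mulr_sumr; apply: ler_sum => i il.
  rewrite mulrA /Qc mulr_sumr; apply: ler_sum => l ll.
  rewrite -mulrA ler_wpM2r ?mulr_ge0// /d lerB//; exact: topm.
Qed.

Definition mrapid (m n : nat) (F : R -> 'M[C]_(m, n)) := rapid (fun x => nm (F x)).
Definition mbounded (m n : nat) (F : R -> 'M[C]_(m, n)) :=
  exists c, forall x, nm (F x) <= c.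

Lemma mrapidP m n (F : R -> 'M[C]_(m, n)) :
  (forall i j, rapid (fun x => complex.Re (F x i j)) /\
               rapid (fun x => complex.Im (F x i j))) -> mrapid F.
Proof.
move=> hF; apply: rapid_sum => i; apply: rapid_sum => j.
by have [hr hi] := hF i j; apply: rapidD; exact: rapid_norm.
Qed.

Lemma mrapid_entry m n (F : R -> 'M[C]_(m, n)) i j : mrapid F ->
  rapid (fun x => complex.Re (F x i j)) /\ rapid (fun x => complex.Im (F x i j)).
Proof.
by move=> hF; split; apply: rapid_le hF _ => x;
  apply: le_trans (l1_le_nm _ i j); [exact: Re_le_l1|exact: Im_le_l1].
Qed.

Lemma mrapidD m n (F G : R -> 'M[C]_(m, n)) :
  mrapid F -> mrapid G -> mrapid (fun x => F x + G x).
Proof.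
move=> hF hG; apply: rapid_le (rapidD hF hG) _ => x.
by rewrite ger0_norm ?nm_ge0// nmD.
Qed.

Lemma mrapidMl m n k (F : R -> 'M[C]_(m, n)) (G : R -> 'M[C]_(n, k)) :
  mrapid F -> mbounded G -> mrapid (fun x => F x *m G x).
Proof.
move=> hF [c hc]; apply: rapid_le (rapidZ c hF) _ => x.
rewrite ger0_norm ?nm_ge0// mulrC (le_trans (nmM _ _))// ler_wpM2l ?nm_ge0//.
Qed.

Lemma mrapidMr m n k (F : R -> 'M[C]_(m, n)) (G : R -> 'M[C]_(n, k)) :
  mbounded F -> mrapid G -> mrapid (fun x => F x *m G x).
Proof.
move=> [c hc] hG; apply: rapid_le (rapidZ c hG) _ => x.
rewrite ger0_norm ?nm_ge0// (le_trans (nmM _ _))// ler_wpM2r ?nm_ge0//.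
Qed.

Lemma mrapid_bounded m n (F : R -> 'M[C]_(m, n)) : mrapid F -> mbounded F.
Proof.
move=> /(_ 0%N)[c hc]; exists c => x; apply: le_trans (hc x).
by rewrite expr0 mul1r ler_norm.
Qed.

Fixpoint tame (n : nat) (P : (R -> 'M[C]_n) -> Prop) (k : nat) (F : R -> 'M[C]_n) :=
  P F /\ (if k is k'.+1 then exists2 D, forall x, mder F x (D x) & tame P k' D else True).

Section Tame.
Context {n : nat}.
Implicit Types (P : (R -> 'M[C]_n) -> Prop) (F G : R -> 'M[C]_n).

Lemma tame0 P k F : tame P k F -> P F.
Proof. by case: k => [|k] []. Qed.

Lemma tameW P k F : tame P k.+1 F -> tame P k F.
Proof.
elim: k F => [|k ih] F; first by case.
by move=> [PF [D dF hD]]; split => //; exists D => //; exact: ih.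
Qed.

Lemma tame_sub P P' k F : (forall F, P F -> P' F) -> tame P k F -> tame P' k F.
Proof.
move=> PP; elim: k F => [|k ih] F; first by move=> [/PP].
by move=> [/PP h [D dF hD]]; split => //; exists D => //; exact: ih.
Qed.

Lemma tameD P k F G : (forall F G, P F -> P G -> P (fun x => F x + G x)) ->
  tame P k F -> tame P k G -> tame P k (fun x => F x + G x).
Proof.
move=> PD; elim: k F G => [|k ih] F G.
  by move=> [pF _] [pG _]; split => //; exact: PD.
move=> [pF [D dF hD]] [pG [D' dG hD']]; split; first exact: PD.
by exists (fun x => D x + D' x); [move=> x; exact: mderD|exact: ih].
Qed.

Lemma tameM P P' P'' k F G : (forall F G, P'' F -> P'' G -> P'' (fun x => F x + G x)) ->
  (forall F G, P F -> P' G -> P'' (fun x => F x *m G x)) ->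
  tame P k F -> tame P' k G -> tame P'' k (fun x => F x *m G x).
Proof.
move=> PD PM; elim: k F G => [|k ih] F G.
  by move=> [pF _] [pG _]; split => //; exact: PM.
move=> hF hG; have [pF [D dF hD]] := hF; have [pG [D' dG hD']] := hG.
split; first exact: PM.
exists (fun x => D x *m G x + F x *m D' x); first by move=> x; exact: mderM.
by apply: tameD => //; apply: ih => //; exact: tameW.
Qed.

Notation BM := (tame (@mbounded n n)).
Notation RM := (tame (@mrapid n n)).

Lemma BM_cst k (A : 'M[C]_n) : BM k (fun=> A).
Proof.
elim: k A => [|k ih] A /=; split => //; try by exists (nm A).
by exists (fun=> 0) => // x; exact: mder_cst.
Qed.

Lemma RMD k F G : RM k F -> RM k G -> RM k (fun x => F x + G x).
Proof. by apply: tameD => ? ? ? ?; exact: mrapidD. Qed.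

Lemma RMMl k F G : RM k F -> BM k G -> RM k (fun x => F x *m G x).
Proof. by apply: tameM => ? ? ? ?; [exact: mrapidD|exact: mrapidMl]. Qed.

Lemma RMMr k F G : BM k F -> RM k G -> RM k (fun x => F x *m G x).
Proof. by apply: tameM => ? ? ? ?; [exact: mrapidD|exact: mrapidMr]. Qed.

Lemma RMZ k c F : RM k F -> RM k (fun x => c *: F x).
Proof.
move=> hF; rewrite (_ : (fun x => _) = fun x => c%:M *m F x).
  by apply: RMMr => //; exact: BM_cst.
by apply/funext => x; rewrite mul_scalar_mx.
Qed.

Lemma RMB k F G : RM k F -> RM k G -> RM k (fun x => F x - G x).
Proof.
move=> hF /(RMZ (-1)) hG; rewrite (_ : (fun x => _) = fun x => F x + -1 *: G x).
  exact: RMD.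
by apply/funext => x; rewrite scaleN1r.
Qed.

Lemma schwartz_derive F : schwartz F ->
  (forall x, mder F x (mx_derive F x)) /\ schwartz (mx_derive F).
Proof.
have entries i j : re_entry (mx_derive F) i j = derive1 (re_entry F i j) /\
    im_entry (mx_derive F) i j = derive1 (im_entry F i j).
  by split; apply/funext => x; rewrite /re_entry /im_entry mxE.
move=> hF; split.
  move=> x; apply: mderW => i j; have [[hr _] [hi _]] := hF i j.
  by split; [exact: (hr 0%N)|exact: (hi 0%N)].
move=> i j; have [-> ->] := entries i j; have [[h1 h2] [h3 h4]] := hF i j.
split; split=> [m x|k m].
- by rewrite -derive1Sn; exact: h1.
- by have [K hK] := h2 k m.+1; exists K => x; rewrite -derive1Sn.
- by rewrite -derive1Sn; exact: h3.
- by have [K hK] := h4 k m.+1; exists K => x; rewrite -derive1Sn.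
Qed.

Lemma schwartz_rapid F : schwartz F -> forall k, RM k F.
Proof.
have base G : schwartz G -> mrapid G.
  move=> hG; apply: mrapidP => i j; have [[_ hr] [_ hi]] := hG i j.
  by split=> m; [exact: (hr m 0%N)|exact: (hi m 0%N)].
move=> hF k; elim: k F hF => [|k ih] F hF; first by split => //; exact: base.
have [dF hD] := schwartz_derive hF.
by split; [exact: base|exists (mx_derive F) => //; exact: ih].
Qed.

Lemma rapid_schwartz F : (forall k, RM k F) -> schwartz F.
Proof.
have step F' : (forall k, RM k F') ->
    (forall x, mder F' x (mx_derive F' x)) /\ forall k, RM k (mx_derive F').
  move=> hF; have h k : (forall x, mder F' x (mx_derive F' x)) /\ RM k (mx_derive F').
    have [_ [D dF hD]] := hF k.+1.
    have e : D = mx_derive F'.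
      by apply/funext => x; have /mderE[_] := dF x.
    by rewrite -e.
  by split=> [|k]; have [] := h 0%N => // ? _; have [] := h k.
have main m : forall F, (forall k, RM k F) -> forall i j,
    ((forall x, derivable (derive1n m (re_entry F i j)) x 1) /\
     rapid (derive1n m (re_entry F i j))) /\
    ((forall x, derivable (derive1n m (im_entry F i j)) x 1) /\
     rapid (derive1n m (im_entry F i j))).
  elim: m => [|m ih] {}F hF i j.
    have [dF _] := step F hF.
    have [hr hi] := mrapid_entry i j (tame0 (hF 0%N)).
    split; split => // x; have [h1 h2] := dF x i j; first by case: h1.
    by case: h2.
  have [_ hD] := step F hF.
  have -> : derive1n m.+1 (re_entry F i j) = derive1n m (re_entry (mx_derive F) i j).
    rewrite derive1Sn; congr derive1n.
    by apply/funext => x; rewrite /re_entry mxE.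
  have -> : derive1n m.+1 (im_entry F i j) = derive1n m (im_entry (mx_derive F) i j).
    rewrite derive1Sn; congr derive1n.
    by apply/funext => x; rewrite /im_entry mxE.
  exact: ih.
move=> hF i j; split; split.
- by move=> m x; have [[h _] _] := main m F hF i j.
- by move=> k m; have [[_ h] _] := main m F hF i j; exact: h.
- by move=> m x; have [_ [h _]] := main m F hF i j.
- by move=> k m; have [_ [_ h]] := main m F hF i j; exact: h.
Qed.

End Tame.
End RapidDecay.

(** * Decay of the dressed potential *)

Section SchwartzDressing.
Context {R : realType} {n : nat}.
Local Notation C := R[i].
Local Notation M := 'M[C]_n.
Implicit Types (a q : M) (z : C).

Lemma comm_diagE a q i j : is_diag_mx a ->
  comm q a i j = q i j * (a j j - a i i).
Proof.
move=> /is_diag_mxP hd.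
have -> : a = diag_mx (\row_k a k k).
  apply/matrixP => k l; rewrite !mxE; have [->|kl] := eqVneq k l; first by rewrite mulr1n.
  by rewrite mulr0n hd.
by rewrite /comm mul_mx_diag mul_diag_mx !mxE !eqxx !mulr1n mulrBr [a i i * _]mulrC.
Qed.

Lemma skew_diagE a i : in_u a -> complex.Re (a i i) = 0.
Proof.
move=> /matrixP/(_ i i); rewrite !mxE => /(congr1 (@complex.Re R)).
rewrite Re_conj ReN; lra.
Qed.

Lemma hermitian_entry q i j : q ^t* = q -> q j i = (q i j)^*.
Proof. by move=> h; rewrite -{1}h !mxE. Qed.

Section FixedTime.
Variables (a : M) (z : C) (v p : R -> M).
Hypotheses (ha : in_u a) (hdiag : is_diag_mx a) (hz : z \isn't Num.real).
Hypotheses (sv : schwartz v) (hp : forall x, hermitian_projection (p x)).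
Hypothesis minors : forall x i k, p x i k * p x k i = p x i i * p x k k.
Hypothesis dp : forall x, mder p x (comm (p x) (v x) + z *: comm (p x) a
  - (z - z^*) *: (comm (p x) a *m p x)).

Let q i x := complex.Re (p x i i).
Let alpha i := complex.Im (a i i).

Let Im_pii x i : complex.Im (p x i i) = 0.
Proof.
have [ps _] := hp x; have := congr1 (@complex.Im R) (hermitian_entry i i ps).
rewrite Im_conj; lra.
Qed.

Let aE i : a i i = (0 +i* alpha i)%C.
Proof. by apply/cplxP; [exact: skew_diagE|]. Qed.

Let norm_entry x i k : complex.Re (p x i k) ^+ 2 + complex.Im (p x i k) ^+ 2 = q i x * q k x.
Proof.
have [ps _] := hp x; have := congr1 (@complex.Re R) (minors x i k).
by rewrite (hermitian_entry i k ps) !ReM Re_conj Im_conj !Im_pii -/(q i x) -/(q k x); lra.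
Qed.

Let q_trace i x : q i x * (\sum_k q k x) = q i x.
Proof.
have [ps p2] := hp x.
rewrite mulr_sumr -[RHS]/(complex.Re (p x i i)) -[in RHS]p2 mxE.
rewrite (big_morph (@complex.Re R) ReD (erefl : complex.Re (0 : C) = 0)).
apply: eq_bigr => k _; rewrite minors ReM !Im_pii; rewrite /q; lra.
Qed.

Let q_ge0 i x : 0 <= q i x.
Proof.
rewrite -q_trace mulr_sumr; apply: sumr_ge0 => k _.
by rewrite -norm_entry addr_ge0 ?sqr_ge0.
Qed.

Let p_bounded : mbounded p.
Proof. by exists ((n * n)%:R * (1 + 1)) => x; exact: proj_bounded. Qed.

Let comm_pv_rapid : mrapid (fun x => comm (p x) (v x)).
Proof.
have rv := tame0 (schwartz_rapid sv 0%N).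
have h1 := mrapidMr p_bounded rv; have h2 := mrapidMl rv p_bounded.
apply: rapid_le (rapidD h1 h2) _ => x.
by rewrite ger0_norm ?nm_ge0// nmB.
Qed.

Let q_derive i (x : R) : is_derive x 1 (q i)
  ((complex.Im z + complex.Im z) * (\sum_k (alpha k - alpha i) * (q i x * q k x))
   + complex.Re (comm (p x) (v x) i i)).
Proof.
have [h _] := dp x i i; apply: (rder_eq h).
rewrite mxDE mxNE mxDE !mxZE (comm_diagE (p x) i i hdiag) subrr !mulr0 addr0 ReD addrC; congr (_ + _).
rewrite ReN mxE.
rewrite ReM (big_morph (@complex.Re R) ReD (erefl : complex.Re (0 : C) = 0)).
rewrite ReD ReN Re_conj subrr mul0r ImD ImN Im_conj opprK sub0r opprK.
rewrite (big_morph (@complex.Im R) ImD (erefl : complex.Im (0 : C) = 0)).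
congr (_ * _); apply: eq_bigr => k _.
rewrite comm_diagE// mulrAC minors ImM ReM ImM !Im_pii !aE /= /q; ring.
Qed.

Let pjk_rapid j k : alpha j != alpha k -> rapid (fun x => q j x * q k x).
Proof.
have key := @replicator_rapid R n alpha q (fun i x => complex.Re (comm (p x) (v x) i i))
  (fun x => nm (comm (p x) (v x))) (complex.Im z + complex.Im z).
have h j' k' : alpha j' < alpha k' -> rapid (fun x => q j' x * q k' x).
  apply: key => //.
  - apply: contra hz => /eqP h; rewrite CrealE; apply/eqP/cplxP.
      exact: Re_conj.
    by rewrite Im_conj; lra.
  - by move=> i x; apply: le_trans (l1_le_nm _ i i); exact: Re_le_l1.
rewrite neq_lt => /orP[/h//|/h]; by under eq_fun do rewrite mulrC.
Qed.

(** Rank at most one turns [p i k * p k i] into [p i i * p k k], so the diagonal of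
   the equation of [p] closes up to the commutator of [p] and [v]: it is the
   replicator equation with fitnesses proportional to the eigenvalues of [a]. *)
Lemma comm_proj_rapid : mrapid (fun x => comm (p x) a).
Proof.
apply: mrapidP => j k.
have [e|ne] := eqVneq (alpha j) (alpha k).
  have z0 x : comm (p x) a j k = 0 by rewrite comm_diagE// !aE e subrr mulr0.
  by split=> m; exists 0 => x; rewrite z0 mulr0 normr0.
have hq := pjk_rapid ne.
have hre : rapid (fun x => complex.Re (p x j k)).
  apply: rapid_sqr; apply: rapid_le hq _ => x; rewrite -norm_entry.
  by rewrite ger0_norm ?sqr_ge0// lerDl sqr_ge0.
have him : rapid (fun x => complex.Im (p x j k)).
  apply: rapid_sqr; apply: rapid_le hq _ => x; rewrite -norm_entry.
  by rewrite ger0_norm ?sqr_ge0// lerDr sqr_ge0.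
split.
  rewrite (_ : (fun x => _) = fun x => (alpha j - alpha k) * complex.Im (p x j k)).
    exact: rapidZ.
  by apply/funext => x; rewrite comm_diagE// ReM !aE /=; ring.
rewrite (_ : (fun x => _) = fun x => (alpha k - alpha j) * complex.Re (p x j k)).
  exact: rapidZ.
by apply/funext => x; rewrite comm_diagE// ImM !aE /=; ring.
Qed.

Let flow x := comm (p x) (v x) + z *: comm (p x) a
  - (z - z^*) *: (comm (p x) a *m p x).

Let flow_tame k : tame (@mbounded R n n) k p ->
  tame (@mrapid R n n) k (fun x => comm (p x) a) -> tame (@mrapid R n n) k flow.
Proof.
move=> bp rd; have rv := schwartz_rapid sv k.
apply: RMB; last by apply: RMZ; exact: (RMMl rd bp).
apply: RMD; last by apply: RMZ; exact: rd.
by apply: RMB; [exact: (RMMr bp rv)|exact: (RMMl rv bp)].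
Qed.

(** The equation of [p] has right-hand side of the form bounded times rapidly
   decreasing, so bounds on [p] and decay of its commutator with [a] gain one
   derivative at a time. *)
Lemma proj_tame k : tame (@mbounded R n n) k p /\
  tame (@mrapid R n n) k (fun x => comm (p x) a).
Proof.
elim: k => [|k [bp rd]].
  by split; split; [exact: p_bounded| |exact: comm_proj_rapid|].
have rp := flow_tame bp rd; split; split.
- exact: p_bounded.
- exists flow; first exact: dp.
  by apply: tame_sub rp => F; exact: mrapid_bounded.
- exact: comm_proj_rapid.
- exists (fun x => flow x *m a - a *m flow x).
    by move=> x; exact: (mderB (mderMr a (dp x)) (mderMl a (dp x))).
  by apply: RMB; [exact: (RMMl rp (BM_cst k a))|exact: (RMMr (BM_cst k a) rp)].
Qed.

Lemma proj_flow_rapid : mrapid flow.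
Proof. by have [h1 h2] := proj_tame 0; exact: (tame0 (flow_tame h1 h2)). Qed.

Lemma dress_schwartz : schwartz (fun x => v x + (z - z^*) *: comm (p x) a).
Proof.
apply: rapid_schwartz => k; apply: RMD; first exact: schwartz_rapid.
by apply: RMZ; have [] := proj_tame k.
Qed.

End FixedTime.

(** A matrix of rank at most one is a column times a row. *)
Lemma rank1_minors (A : M) i j k l : (\rank A <= 1)%N ->
  A i j * A k l = A i l * A k j.
Proof.
move=> rk; have := mulmx_base A; move: (col_base A) (row_base A) rk.
case: (\rank A) => [|[|r]]// X Y _ <-.
  by rewrite !mxE !big_ord0 !mul0r.
rewrite !mxE !big_ord1; ring.
Qed.

Lemma image_proj_rank (A q : M) : (\rank (image_proj A q) <= \rank q)%N.
Proof.
rewrite /image_proj -!mulmxA; apply: leq_trans (mxrankM_maxr _ _) _.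
exact: mxrankM_maxl.
Qed.

(** A commutator with [a] is orthogonal to the commutant of [a]. *)
Lemma comm_perp a v q c : in_Ua_perp a v -> in_u (v + c *: comm q a) ->
  in_Ua_perp a (v + c *: comm q a).
Proof.
move=> [uv pv] hu; split=> // w [uw aw].
rewrite mulmxDr linearD /= (pv w (conj uw aw)) add0r.
have e : w *m a = a *m w by move: aw => /eqP; rewrite subr_eq0 => /eqP.
rewrite -scalemxAr linearZ /= /comm mulmxBr linearB /= mulmxA.
rewrite [in X in _ - X]mulmxA e -(mulmxA a) [in X in _ - X]mxtrace_mulC.
by rewrite subrr mulr0.
Qed.

End SchwartzDressing.

(** * Limits at infinity *)

Section LimitsOnTheLine.
Context {R : realType}.
Local Notation C := R[i].

(** A bounded function whose derivative is dominated by that of [K atan] is a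
   difference of bounded monotone functions. *)
Lemma cvg_of_derivative (f f' : R -> R) (c K : R) :
  (forall x : R, is_derive x 1 f (f' x)) -> (forall x, `|f x| <= c) ->
  (forall x, `|f' x| * (1 + x ^+ 2) <= K) -> cvg (f x @[x --> +oo]).
Proof.
move=> df bf bf'.
have K0 : 0 <= K.
  by apply: le_trans (bf' 0); rewrite mulr_ge0// addr_ge0// sqr_ge0.
have mono (g g' : R -> R) (d : R) : (forall x : R, is_derive x 1 g (g' x)) ->
    (forall x, 0 <= g' x) -> (forall x, g x <= d) -> cvg (g x @[x --> +oo]).
  move=> dg g0 gd; apply/cvg_ex; eexists; apply: nondecreasing_cvgr.
    by move=> x y xy; apply: (@rder_ndecr R g g' x y xy).
  by exists d => _ [x _ <-].
have datan (x : R) : is_derive x 1 (fun s => K * atan s) (K * (1 + x ^+ 2)^-1).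
  have h := @rderM R (fun=> K) (@atan R) x _ _ (rder_cst K x) (is_derive1_atan x).
  by apply: rder_eq h _; rewrite mul0r add0r.
have atan_le (x : R) : K * atan x <= K * (pi / 2).
  by rewrite ler_wpM2l// ltW// atan_ltpi2.
have h1 : cvg (f x + K * atan x @[x --> +oo]).
  apply: (mono _ (fun x => f' x + K * (1 + x ^+ 2)^-1) (c + K * (pi / 2))).
  - move=> x; have := bf' x; rewrite -ler_pdivlMr ?ltr_wpDr ?sqr_ge0//.
    by rewrite ler_norml => /andP[h _]; rewrite -lerBlDr sub0r.
  - by move=> x; rewrite lerD// (le_trans (ler_norm _)).
have h2 : cvg (K * atan x @[x --> +oo]).
  apply: (mono _ (fun x => K * (1 + x ^+ 2)^-1) (K * (pi / 2))) => // x.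
  by rewrite mulr_ge0// invr_ge0 addr_ge0// sqr_ge0.
have -> : f = fun x => (f x + K * atan x) - K * atan x.
  by apply/funext => x; rewrite addrK.
exact: is_cvgB h1 h2.
Qed.

Lemma rapid_quadratic (f : R -> R) : rapid f ->
  exists K, forall x, `|f x| * (1 + x ^+ 2) <= K.
Proof.
move=> hf; have [K hK] := hf 0%N; have [L hL] := hf 2; exists (K + L) => x.
rewrite mulrDr mulr1 lerD//; first by have := hK x; rewrite expr0 mul1r.
by have := hL x; rewrite normrM (ger0_norm (sqr_ge0 x)) mulrC.
Qed.

Lemma cvgNy_of_rapid (f f' : R -> R) (c : R) :
  (forall x : R, is_derive x 1 f (f' x)) -> (forall x, `|f x| <= c) ->
  rapid f' -> cvg (f x @[x --> -oo]).
Proof.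
move=> df bf /rapid_quadratic [K hK].
have : cvg ((f \o -%R) x @[x --> +oo]).
  apply: (@cvg_of_derivative _ (fun x => - f' (- x)) c K).
  - by move=> x; exact: rder_reflect.
  - by move=> x; exact: bf.
  - by move=> x; have := hK (- x); rewrite normrN sqrrN.
move=> /cvg_ex[l hl]; apply/cvg_ex; exists l; exact/cvgNy_compNP.
Qed.

Lemma rapid_cvgNy0 (f : R -> R) : rapid f -> f x @[x --> -oo] --> (0 : R).
Proof.
move=> /(_ 1%N)[K hK]; apply/cvgrPdist_le => e e0.
near=> x.
rewrite sub0r normrN.
have x0 : x < 0 by near: x; exact: nbhs_ninfty_lt.
have xK : x <= - (`|K| / e) by near: x; apply: nbhs_ninfty_le; rewrite realN num_real.
have := hK x; rewrite expr1 normrM ltr0_norm// => h.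
have {}h : `|f x| <= K / (- x) by rewrite ler_pdivlMr ?oppr_gt0// mulrC.
apply: (le_trans h); rewrite ler_pdivrMr ?oppr_gt0//.
apply: le_trans (ler_norm K) _; rewrite mulrC -ler_pdivrMr//.
by rewrite lerNr.
Unshelve. all: by end_near. Qed.

(** Limits of antiderivatives of uniformly bounded functions that tend to [0]
   pointwise are constant, by dominated convergence. *)
Lemma bounded_derivatives_limit (f f' : nat -> R -> R) (l : R -> R) (c : R) :
  (forall k (t : R), is_derive t 1 (f k) (f' k t)) ->
  (forall k t, {for t, continuous (f' k)}) ->
  (forall k t, `|f' k t| <= c) ->
  (forall t, f' k t @[k --> \oo] --> (0 : R)) ->
  (forall t, f k t @[k --> \oo] --> l t) -> forall s t, l s = l t.
Proof.
move=> df cf' bf' f0 fl s t.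
wlog : s t / s < t.
  by move=> h; have [/h//|/h//|->//] := ltgtP s t.
move=> st; pose mu := @lebesgue_measure R.
have ftc k : (\int[mu]_(x in `[s, t]) (f' k x)%:E = (f k t)%:E - (f k s)%:E)%E.
  apply: continuous_FTC2 => //.
  - by apply: continuous_subspaceT => x; exact: cf'.
  - split; first by move=> x _; have [] := df k x.
      by apply: cvg_at_right_filter; exact: rder_cts (df k s).
    by apply: cvg_at_left_filter; exact: rder_cts (df k t).
  - by move=> x _; rewrite derive1E; have [] := df k x.
have h1 k : measurable_fun `[s, t] (EFin \o f' k).
  apply/measurable_EFinP; apply: measurable_funTS.
  by apply: continuous_measurable_fun => x; exact: cf'.
have h2 : {ae mu, forall x, `[s, t]%classic x -> (f' k x)%:E @[k --> \oo] --> (0 : \bar R)%E}.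
  by apply: aeW => x _; apply: cvg_EFin (f0 x); exact: nearW.
have h3 : mu.-integrable `[s, t] (EFin \o cst c).
  apply: continuous_compact_integrable; first exact: segment_compact.
  by apply: continuous_subspaceT => x; exact: cst_continuous.
have h4 : {ae mu, forall x k, `[s, t]%classic x -> (`|(f' k x)%:E| <= (EFin \o cst c) x)%E}.
  by apply: aeW => x k _; rewrite lee_fin.
have [_ _] := @dominated_convergence _ _ R mu `[s, t]%classic (measurable_itv _)
  (fun k x => (f' k x)%:E) (cst 0%E) _ h1 (measurable_cst _) h2 h3 h4.
rewrite integral0.
under eq_fun do rewrite ftc -EFinB.
have h5 : (fun k => (f k t - f k s)%:E) @ \oo --> (l t - l s)%:E.
  by apply: cvg_EFin; [exact: nearW|exact: cvgB].
move=> h6; have := cvg_unique (@ereal_hausdorff R) h5 h6.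
by move=> /(_ _)/(congr1 fine) /= /eqP; rewrite subr_eq0 => /eqP ->.
Qed.

End LimitsOnTheLine.

(** * Frames *)

Lemma simple_num0_algebra (F : fieldType) (n : nat) (q : 'M[F]_n) (z w : F) :
  q *m q = q ->
  ((0 - z) *: 1%:M + (z - w) *: q) *m ((0 - w) *: 1%:M - (z - w) *: q) =
  (z * w) *: 1%:M.
Proof. by move=> q2; mxexpand; rewrite q2; mxabel; ring. Qed.

Section Frames.
Context {R : realType} {n : nat}.
Local Notation C := R[i].
Local Notation M := 'M[C]_n.
Implicit Types (a b : M) (u g : R -> R -> M).

Lemma frame_mder u g : is_frame u g ->
  forall x t, mder (g ^~ t) x (g x t *m u x t).
Proof.
move=> [sg ug gu _] x t; have [/(_ x t)[dg _] _ _] := smooth_partials sg.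
by apply: mder_eq dg _; rewrite -gu mulKVmx.
Qed.

(** Two frames differ by a left factor that does not depend on [x] and tends
   to [1]. *)
Lemma frame_pairing u g g' : (forall x t, in_u (u x t)) ->
  is_frame u g -> is_frame u g' -> forall x t, g' x t *m (g x t) ^t* = 1%:M.
Proof.
move=> uu hg hg' x t.
pose F s := g' s t *m (g s t) ^t*.
have dF s : mder F s 0.
  apply: mder_eq (mderM (frame_mder hg' s t) (mder_adj (frame_mder hg s t))) _.
  by rewrite adjM uu mulNmx mulmxN mulmxA subrr.
have Fc : F = fun=> F x.
  by apply/funext => s; rewrite (mder_const dF s) (mder_const dF x).
have [_ _ _ lg] := hg; have [_ _ _ lg'] := hg'.
have := mx_cvgM (lg' t) (mx_cvg_adj (lg t)); rewrite adj1 mulmx1 -/F Fc => /(_ _ _) lF.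
exact: (mx_cvg_unique (mx_cvg_cst (F x)) lF).
Qed.

Lemma frame_unitary u g : (forall x t, in_u (u x t)) -> is_frame u g ->
  forall x t, g x t *m (g x t) ^t* = 1%:M.
Proof. by move=> uu hg; exact: (frame_pairing uu hg hg). Qed.

Lemma frame_inv u g : (forall x t, in_u (u x t)) -> is_frame u g ->
  forall x t, invmx (g x t) = (g x t) ^t*.
Proof.
move=> uu hg x t; have [_ ug _ _] := hg.
by rewrite -[LHS]mulmx1 -(frame_unitary uu hg x t) mulKmx.
Qed.

Lemma frame_unique u g g' : (forall x t, in_u (u x t)) ->
  is_frame u g -> is_frame u g' -> g = g'.
Proof.
move=> uu hg hg'; apply/funext => x; apply/funext => t.
have h := frame_pairing uu hg hg' x t; have [_ ug _ _] := hg.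
by rewrite -[LHS]mul1mx -h -(frame_inv uu hg) mulmxKV.
Qed.

Lemma conj_by_frame b u g : (forall x t, in_u (u x t)) -> is_frame u g ->
  forall x t, conj_by b (g x t) = (g x t) ^t* *m b *m g x t.
Proof. by move=> uu hg x t; rewrite /conj_by (frame_inv uu hg). Qed.

(** [B] is smooth as [g^* b g], and its equation in [x] is that of a conjugate by a
   solution of [g_x = g u]. *)
Lemma frame_lax a b u g : in_u b -> (forall x t, in_u (u x t)) -> smooth u ->
  flow_solution a b u g -> lax a u (fun x t => conj_by b (g x t)).
Proof.
move=> hb uu su [hg flow]; have BE := conj_by_frame b uu hg.
have [sg _ _ _] := hg; split=> //.
- apply/smoothP => k; have kg := (smoothP g).1 sg k.
  rewrite (_ : (fun x t => _) = fun x t => (g x t) ^t* *m b *m g x t).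
    by apply: mCksM => //; apply: mCksM; [exact: mCks_adj|exact: mCks_cst].
  by apply/funext => x; apply/funext => t; rewrite BE.
- by move=> x t; rewrite BE /in_u !adjM adjK hb mulNmx mulmxN mulmxA.
- move=> x t; split; first exact: flow.
  have dg := frame_mder hg x t.
  have : mder ((fun x t => conj_by b (g x t)) ^~ t) x
    (comm (conj_by b (g x t)) (u x t)).
    apply: (@mder_ext _ _ _ (fun s => (g s t) ^t* *m b *m g s t)) => [s|]; first by rewrite BE.
    apply: mder_eq (mderM (mderMr b (mder_adj dg)) dg) _.
    by rewrite adjM uu BE /comm; mxring.
  by move/mderE => -[].
Qed.

Lemma frame_bounded u g : (forall x t, in_u (u x t)) -> is_frame u g ->
  forall x t, nm (g x t) <= (n * n)%:R * (1 + 1).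
Proof.
by move=> uu hg x t; apply/unitary_nm/mulmx1C; exact: (frame_unitary uu hg).
Qed.

Lemma frame_conj_cvg b u g t : (forall x t, in_u (u x t)) -> is_frame u g ->
  mx_cvg (fun x => conj_by b (g x t)) -oo%R b.
Proof.
move=> uu hg; have [_ _ _ lg] := hg.
have := mx_cvgM (mx_cvgM (mx_cvg_adj (lg t)) (mx_cvg_cst b)) (lg t).
rewrite adj1 mul1mx mulmx1 => /(_ _ _) h.
rewrite (_ : (fun x => conj_by b (g x t)) = fun x => (g x t) ^t* *m b *m g x t).
  exact: h.
by apply/funext => x; rewrite (conj_by_frame b uu hg).
Qed.

Lemma cvgNy_nat (f : R -> R) (l : R) : f x @[x --> -oo] --> l ->
  f (- k%:R) @[k --> \oo] --> l.
Proof.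
move=> /cvgNy_compNP h; exact: (cvg_comp _ _ (@cvgr_idn R) h).
Qed.

Lemma mrapid_cvg0 (F : R -> M) : mrapid F -> mx_cvg F -oo%R 0.
Proof.
move=> hF; apply: mx_cvg_parts => i j; rewrite mx0E; have [hr hi] := mrapid_entry i j hF.
  exact: rapid_cvgNy0.
exact: rapid_cvgNy0.
Qed.

Lemma mx_cvgNy_of_rapid (F D : R -> M) : (forall x, mder F x (D x)) ->
  mbounded F -> mrapid D -> exists L, mx_cvg F -oo%R L.
Proof.
move=> dF [c bF] rD.
have h (ij : 'I_n * 'I_n) : exists l : C,
    (complex.Re (F s ij.1 ij.2) @[s --> -oo%R] --> complex.Re l) /\
    (complex.Im (F s ij.1 ij.2) @[s --> -oo%R] --> complex.Im l).
  have [rr ri] := mrapid_entry ij.1 ij.2 rD.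
  have /cvg_ex[r hr] : cvg (complex.Re (F s ij.1 ij.2) @[s --> -oo%R]).
    apply: (cvgNy_of_rapid (c := c) _ _ rr) => x; first by have [] := dF x ij.1 ij.2.
    by apply: le_trans (Re_le_l1 _) _; apply: le_trans (l1_le_nm _ _ _) (bF x).
  have /cvg_ex[s hs] : cvg (complex.Im (F s ij.1 ij.2) @[s --> -oo%R]).
    apply: (cvgNy_of_rapid (c := c) _ _ ri) => x; first by have [] := dF x ij.1 ij.2.
    by apply: le_trans (Im_le_l1 _) _; apply: le_trans (l1_le_nm _ _ _) (bF x).
  by exists (r +i* s)%C.
have [l hl] := choice h; exists (\matrix_(i, j) l (i, j)).
by apply: mx_cvg_parts => i j; rewrite mxE; have [] := hl (i, j).
Qed.

Lemma simple_num0_unitary z (q : M) : hermitian_projection q ->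
  simple_num z q 0 *m (simple_num z q 0) ^t* = (z * z^*)%:M.
Proof.
move=> [qs q2]; rewrite simple_num_adj// /simple_num rmorph0.
by rewrite -!(scalemx1 n (_ - _)) -(scalemx1 n (z * _)); exact: simple_num0_algebra.
Qed.

Lemma conj_byM b (K G X : M) : K \in unitmx -> G \in unitmx -> X \in unitmx ->
  b *m K = K *m b -> conj_by b (K *m (G *m X)) = invmx X *m conj_by b G *m X.
Proof.
move=> uK uG uX bK; rewrite /conj_by.
have -> : invmx (K *m (G *m X)) = invmx X *m invmx G *m invmx K.
  have e : invmx X *m invmx G *m invmx K *m (K *m (G *m X)) = 1%:M.
    by rewrite !mulmxA mulmxKV// mulmxKV// mulVmx.
  rewrite -[RHS]mulmx1 -(@mulmxV _ _ (K *m (G *m X))) ?unitmx_mul ?uK ?uG//.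
  by rewrite (mulmxA _ _ (invmx (K *m (G *m X)))) e mul1mx.
have e : invmx K *m b *m K = b by rewrite -mulmxA bK mulKmx.
transitivity (invmx X *m invmx G *m (invmx K *m b *m K) *m G *m X).
  by rewrite !mulmxA.
by rewrite e !mulmxA.
Qed.

Section DressedFrame.
Variables (a b : M) (z : C) (u g p : R -> R -> M).
Let B x t := conj_by b (g x t).
Hypotheses (ha : in_u a) (hb : in_u b) (hz : z \isn't Num.real).
Hypothesis hab : forall y, in_Ua a y -> comm b y = 0.
Hypotheses (su : smooth u) (uu : forall x t, in_u (u x t)).
Hypothesis hg : flow_solution a b u g.
Hypothesis hp : forall x t, hermitian_projection (p x t).
Hypothesis dp : partials p
  (fun x t => proj_flow ((z *: a + u x t) ^t*) (p x t))
  (fun x t => proj_flow ((z^-1 *: B x t) ^t*) (p x t)).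
Hypothesis rcomm : forall t, mrapid (fun x => comm (p x t) a).
Hypothesis rpx : forall t,
  mrapid (fun x => proj_flow ((z *: a + u x t) ^t*) (p x t)).

Let hl : lax a u B. Proof. exact: frame_lax. Qed.
Let z0 : z != 0. Proof. exact: nonreal_neq0. Qed.
Let frame : is_frame u g. Proof. by case: hg. Qed.
Let uB x t : in_u (B x t). Proof. by case: hl. Qed.

Let p_limit t : exists L, mx_cvg (p ^~ t) -oo%R L.
Proof.
apply: mx_cvgNy_of_rapid (rpx t) => [x|]; first by have [] := dp x t.
by exists ((n * n)%:R * (1 + 1)) => x; exact: proj_bounded.
Qed.

(** The commutator of [p] with [a] vanishes in the limit [L], so the skew matrix
   [i L] commutes with [a], hence with [b]. *)
Let limit_proj t L : mx_cvg (p ^~ t) -oo%R L ->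
  [/\ L ^t* = L, L *m L = L, comm L a = 0 & comm b L = 0].
Proof.
move=> hL.
have Ls : L ^t* = L.
  apply: mx_cvg_unique (mx_cvg_adj hL) _; under eq_fun do rewrite (hp _ _).1.
  exact: hL.
have L2 : L *m L = L.
  apply: mx_cvg_unique (mx_cvgM hL hL) _; under eq_fun do rewrite (hp _ _).2.
  exact: hL.
have La : comm L a = 0.
  apply: mx_cvg_unique (mrapid_cvg0 (rcomm t)); apply: mx_cvgB.
    exact: mx_cvgM hL (mx_cvg_cst a).
  exact: mx_cvgM (mx_cvg_cst a) hL.
have /hab : in_Ua a ('i%C *: L).
  split.
    rewrite /in_u adjZ Ls -scaleNr; congr (_ *: _).
    by apply/cplxP; rewrite /= ?oppr0.
  rewrite /comm -scalemxAr -scalemxAl -scalerBr; move: La => /eqP.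
  by rewrite subr_eq0 => /eqP ->; rewrite subrr scaler0.
rewrite /comm -scalemxAr -scalemxAl -scalerBr => /eqP.
by rewrite scaler_eq0 => /orP[/eqP[]/eqP|/eqP ->]//; rewrite oner_eq0.
Qed.

(** [p_t] is bounded and tends to [0] pointwise, as [B] tends to [b] and [b]
   commutes with the limit of [p]. The convergence need not be uniform in [t]. *)
Let limit_const s t L L' : mx_cvg (p ^~ s) -oo%R L -> mx_cvg (p ^~ t) -oo%R L' ->
  L = L'.
Proof.
have [Pinf hP] := choice p_limit.
suff h s' t' : Pinf s' = Pinf t'.
  move=> hL hL'; rewrite (mx_cvg_unique hL (hP s)) (h s t).
  exact: mx_cvg_unique (hP t) hL'.
have sp : smooth p by exact: (dress_proj_smooth hl hp dp).
have [pp _ spt] := smooth_partials sp.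
have [ppt _ _] := smooth_partials spt.
have dtE x r : dt p x r = tflow z z^* (B x r) (p x r).
  rewrite -(proj_flow_t (p x r) z0 (uB x r)).
  by have [_ /mderE[]] := dp x r.
pose k1 : R := (n * n)%:R * (1 + 1).
have k10 : 0 <= k1 by rewrite mulr_ge0.
have bp x r : nm (p x r) <= k1 by exact: proj_bounded.
have bB x r : nm (B x r) <= k1 * nm b * k1.
  rewrite /B (conj_by_frame b uu frame).
  apply: le_trans (nmM _ _) _; apply: ler_pM; rewrite ?nm_ge0//; last exact: frame_bounded uu frame _ _.
  apply: le_trans (nmM _ _) _; apply: ler_pM; rewrite ?nm_ge0// nm_adj.
  exact: frame_bounded uu frame _ _.
have [c bt] : exists c, forall x r, nm (dt p x r) <= c.
  pose k2 := k1 * nm b * k1.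
  have k20 : 0 <= k2 by rewrite !mulr_ge0// nm_ge0.
  exists (l1 (z * z^*)^-1 * (l1 (z - z^*) * (k1 * k2 * k1) + l1 z * (k2 * k1)
    + l1 z^* * (k1 * k2))) => x r.
  have h1 : nm (B x r *m p x r) <= k2 * k1.
    by apply: le_trans (nmM _ _) _; apply: ler_pM; rewrite ?nm_ge0.
  have h2 : nm (p x r *m B x r) <= k1 * k2.
    by apply: le_trans (nmM _ _) _; apply: ler_pM; rewrite ?nm_ge0.
  have h3 : nm (p x r *m B x r *m p x r) <= k1 * k2 * k1.
    by apply: le_trans (nmM _ _) _; apply: ler_pM; rewrite ?nm_ge0.
  rewrite dtE; apply: le_trans (nmZ _ _) _; rewrite ler_wpM2l ?l1_ge0//.
  apply: le_trans (nmD _ _) _; apply: lerD; last first.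
    by apply: le_trans (nmZ _ _) _; rewrite ler_wpM2l ?l1_ge0.
  apply: le_trans (nmB _ _) _; apply: lerD;
    by apply: le_trans (nmZ _ _) _; rewrite ler_wpM2l ?l1_ge0.
have lt r : mx_cvg (fun x => dt p x r) -oo%R 0.
  under eq_fun do rewrite dtE.
  have [_ P2 _ bP] := limit_proj (hP r).
  have <- : tflow z z^* b (Pinf r) = 0.
    have e : b *m Pinf r = Pinf r *m b by apply/eqP; rewrite -subr_eq0; apply/eqP.
    by rewrite /tflow -e -mulmxA P2 -scalerBl -scalerDl [z - _ - z]addrAC subrr sub0r addNr scale0r scaler0.
  have cB : mx_cvg (fun x => B x r) -oo%R b by apply: frame_conj_cvg frame.
  exact: (mx_cvgZ _ (mx_cvgD (mx_cvgB
    (mx_cvgZ _ (mx_cvgM (mx_cvgM (hP r) cB) (hP r)))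
    (mx_cvgZ z (mx_cvgM cB (hP r)))) (mx_cvgZ z^* (mx_cvgM (hP r) cB)))).
apply/matrixP => i j; apply/cplxP.
  apply: (@bounded_derivatives_limit R (fun k r => complex.Re (p (- k%:R) r i j))
    (fun k r => complex.Re (dt p (- k%:R) r i j)) (fun r => complex.Re (Pinf r i j)) c).
  - by move=> k r; have [_ /(_ i j)[]] := pp (- k%:R) r.
  - move=> k r; have [_ /(_ i j)[h _]] := ppt (- k%:R) r; exact: rder_cts h.
  - move=> k r; apply: le_trans (Re_le_l1 _) _; exact: le_trans (l1_le_nm _ _ _) (bt _ _).
  - move=> r; have [h _] := mx_cvg_entry (lt r) i j; move: h; rewrite mx0E; exact: cvgNy_nat.
  - by move=> r; have [h _] := mx_cvg_entry (hP r) i j; exact: cvgNy_nat h.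
apply: (@bounded_derivatives_limit R (fun k r => complex.Im (p (- k%:R) r i j))
  (fun k r => complex.Im (dt p (- k%:R) r i j)) (fun r => complex.Im (Pinf r i j)) c).
- by move=> k r; have [_ /(_ i j)[]] := pp (- k%:R) r.
- move=> k r; have [_ /(_ i j)[_ h]] := ppt (- k%:R) r; exact: rder_cts h.
- move=> k r; apply: le_trans (Im_le_l1 _) _; exact: le_trans (l1_le_nm _ _ _) (bt _ _).
- move=> r; have [_ h] := mx_cvg_entry (lt r) i j; move: h; rewrite mx0E; exact: cvgNy_nat.
- by move=> r; have [_ h] := mx_cvg_entry (hP r) i j; exact: cvgNy_nat h.
Qed.

(** With [N] the value of [simple_num] at [0], the product [g *m N^*] solves the
   equation in [x] of a frame of the dressed potential. Its limit at minus infinity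
   does not depend on [t] and commutes with [b], so dividing by it from the left
   normalizes the frame without changing the conjugate of [b]. *)
Lemma dress_frame : exists g', is_frame (dress_u a z u p) g' /\
  forall x t, conj_by b (g' x t) = dress_B z B p x t.
Proof.
have [L hL0] := p_limit 0.
have hL t : mx_cvg (p ^~ t) -oo%R L.
  by have [L' hL'] := p_limit t; rewrite (limit_const hL0 hL').
have [Ls L2 _ bL] := limit_proj hL0.
have zz : z * z^* != 0 by rewrite mulf_neq0 ?conjC_eq0.
pose N (q : M) := simple_num z q 0.
have NN q : hermitian_projection q -> N q *m (N q) ^t* = (z * z^*)%:M.
  exact: simple_num0_unitary.
have NI q : hermitian_projection q -> (N q) ^t* \in unitmx /\
    invmx ((N q) ^t*) = (z * z^*)^-1 *: N q.
  move=> hq; have e : ((z * z^*)^-1 *: N q) *m (N q) ^t* = 1%:M.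
    by rewrite -scalemxAl NN// scale_scalar_mx mulVf.
  have [_ un] := mulmx1_unit e; split => //.
  by rewrite -[RHS]mulmx1 -(mulmxV un) mulmxA e mul1mx.
have hLp : hermitian_projection L by [].
have [uL _] := NI L hLp; pose K := invmx ((N L) ^t*).
have [sg ug gu lg] := frame.
have sp : smooth p by exact: (dress_proj_smooth hl hp dp).
pose g' x t := K *m (g x t *m (N (p x t)) ^t*).
have ug' x t : g' x t \in unitmx.
  by rewrite !unitmx_mul unitmx_inv uL ug (NI _ (hp x t)).1.
have sg' : smooth g'.
  apply/smoothP => k; apply: mCksM; first exact: mCks_cst.
  apply: mCksM; first exact: (smoothP g).1.
  apply: mCks_adj; apply: mCksD; first exact: mCks_cst.
  by apply: mCksZ; exact: (smoothP p).1.
exists g'; split; first split.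
- exact: sg'.
- exact: ug'.
- move=> x t.
  have dN := simple_num_dx ha hl hp dp 0 x t.
  rewrite scale0r !add0r in dN.
  have : mder (g' ^~ t) x (g' x t *m dress_u a z u p x t).
    apply: mder_eq (mderMl K (mderM (frame_mder frame x t) (mder_adj dN))) _.
    rewrite adjB !adjM uu (dress_u_skew z ha hl hp x t) /g' -!mulmxA -mulmxDr.
    by congr (_ *m _); rewrite -/(N (p x t)); mxring.
  by move=> /mderE[_ e]; rewrite /dx e (mulKmx (ug' x t)).
- move=> t.
  have lN : mx_cvg (fun x => (N (p x t)) ^t*) -oo%R ((N L) ^t*).
    apply/mx_cvg_adj/mx_cvgD; [exact: mx_cvg_cst|exact: (mx_cvgZ _ (hL t))].
  have e : K *m (1%:M *m (N L) ^t*) = 1%:M by rewrite mul1mx (mulVmx uL).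
  rewrite -[1%:M]e; exact: (mx_cvgM (mx_cvg_cst K) (mx_cvgM (lg t) lN)).
move=> x t.
have [uN iN] := NI _ (hp x t).
have bN : b *m (N L) ^t* = (N L) ^t* *m b.
  have e : b *m L = L *m b by apply/eqP; rewrite -subr_eq0; apply/eqP.
  rewrite /N simple_num_adj// mulmxBr mulmxBl -scalemxAr -scalemxAl e.
  by rewrite mul_mx_scalar mul_scalar_mx.
have bK : b *m K = K *m b.
  by rewrite -[b *m K](mulKmx uL) [(N L)^t* *m _]mulmxA -bN -mulmxA (mulmxV uL) mulmx1.
have uK : K \in unitmx by rewrite unitmx_inv.
rewrite (conj_byM uK (ug x t) uN bK) iN -/(B x t) /dress_B.
by rewrite -!scalemxAl.
Qed.

End DressedFrame.
End Frames.

(** * The dressing action *)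

Lemma comm_flow_algebra (F : fieldType) (n : nat) (a v q : 'M[F]_n) (z : F) :
  (z *: a + v) *m q - q *m (z *: a + v) =
  - ((q *m v - v *m q) + z *: (q *m a - a *m q)).
Proof. by mxring. Qed.

Section Action.
Context {R : realType} {n : nat}.
Local Notation C := R[i].
Local Notation M := 'M[C]_n.
Variables (a b : M).
Hypotheses (ha : in_u a) (hdiag : is_diag_mx a) (hb : in_u b).
Implicit Types (u B g : R -> R -> M) (E : R -> R -> C -> M) (f h : C -> M).

Lemma wave_Gplus u B E x t : lax a u B -> wave a u B E -> Gplus (E x t).
Proof.
move=> hl hE; have [hol _ _] := hE; split; first exact: hol.
  by move=> l l0; exact: (wave_unit x t ha hl hE l0).
by move=> l l0; exact: (wave_unitary x t ha hl hE l0).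
Qed.

Definition intertwines f E E' ft := forall x t,
  off_finite (fun l => f l *m E x t l = E' x t l *m ft x t l).

(** Dressing by one simple element, at the level of the wave functions. *)
Lemma simple_intertwines u B E (z : C) (p : M) : z \isn't Num.real -> lax a u B ->
  wave a u B E -> hermitian_projection p ->
  let pt := dress_proj z E p in
  exists2 E', wave a (dress_u a z u pt) (dress_B z B pt) E' &
    intertwines (simple_element z p) E E' (fun x t => simple_element z (pt x t)).
Proof.
move=> hz hl hE hp pt.
have hpt := dress_proj_hermitian ha hz hl hE hp.
have dpt := dress_proj_partials ha hz hl hE hp.
have [E' hE'] := wave_exists ha (dress_lax ha hz hl hpt dpt).
exists E' => // x t.
apply: off_finite_sub (off_finite_and (off_finite_neq 0) (off_finite_neq z^*)) => l [l0 lz].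
rewrite !simple_elementE// -scalemxAl -scalemxAr; congr (_ *: _).
rewrite -(simple_num_intertwine ha hz hl hpt dpt x t hE hE' l0).
by rewrite /pt (dress_proj00 _ hE hp).
Qed.

(** The conditions of [flow_space] that are not part of [lax], with [B] the
   conjugate of [b] by a frame. *)
Definition potential u B := [/\ forall x t, in_Ua_perp a (u x t),
  forall t, schwartz (u ^~ t) &
  exists2 g, flow_solution a b u g & forall x t, B x t = conj_by b (g x t)].

(** Stated for every wave function, including those without a frame, so that it is
   stable under products also for scalar [a], where dressing keeps [u] but need
   not keep the frame. *)
Definition dressable f := forall u B E, lax a u B -> wave a u B E ->
  exists u' B' E' ft,
    [/\ lax a u' B' /\ wave a u' B' E', forall x t, Gminus (ft x t),
        intertwines f E E' ft, is_scalar_mx a -> u' = u &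
        (forall y, in_Ua a y -> comm b y = 0) -> potential u B -> potential u' B'].

Lemma dressable_ext f h : off_finite (fun l => f l = h l) -> dressable f -> dressable h.
Proof.
move=> fh df u B E hl hE; have [u' [B' [E' [ft [h1 h2 h3 h4 h5]]]]] := df u B E hl hE.
exists u', B', E', ft; split=> // x t.
by apply: off_finite_sub (off_finite_and fh (h3 x t)) => l [<-].
Qed.

Lemma dressable1 : dressable (fun=> 1%:M).
Proof.
move=> u B E hl hE; exists u, B, E, (fun _ _ _ => 1%:M); split=> // x t.
  exact: Gminus1.
by apply: off_finite_all => l; rewrite mul1mx mulmx1.
Qed.

Lemma intertwinesM f h E E' E'' ft ht : intertwines f E' E'' ft ->
  intertwines h E E' ht ->
  intertwines (fun l => f l *m h l) E E'' (fun x t l => ft x t l *m ht x t l).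
Proof.
move=> hf hh x t; apply: off_finite_sub (off_finite_and (hf x t) (hh x t)) => l [e1 e2].
by rewrite -mulmxA e2 mulmxA e1 mulmxA.
Qed.

Lemma dressableM f h : dressable f -> dressable h -> dressable (fun l => f l *m h l).
Proof.
move=> df dh u B E hl hE.
have [u1 [B1 [E1 [h1 [[hl1 hE1] g1 i1 s1 p1]]]]] := dh u B E hl hE.
have [u2 [B2 [E2 [h2 [[hl2 hE2] g2 i2 s2 p2]]]]] := df u1 B1 E1 hl1 hE1.
exists u2, B2, E2, (fun x t l => h2 x t l *m h1 x t l); split=> //.
- by move=> x t; exact: GminusM.
- exact: intertwinesM i2 i1.
- by move=> sa; rewrite s2// s1.
- by move=> ab hp; apply: p2 => //; exact: p1.
Qed.

Lemma dressable_simple z p : z \isn't Num.real -> hermitian_projection p ->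
  (\rank p <= 1)%N -> dressable (simple_element z p).
Proof.
move=> hz hp rp u B E hl hE.
have [E' hE' hi] := simple_intertwines hz hl hE hp.
pose pt := dress_proj z E p.
have hpt : forall x t, hermitian_projection (pt x t) := dress_proj_hermitian ha hz hl hE hp.
have dpt := dress_proj_partials ha hz hl hE hp.
have hl' := dress_lax ha hz hl hpt dpt.
exists (dress_u a z u pt), (dress_B z B pt), E', (fun x t => simple_element z (pt x t)).
split=> //.
- by move=> x t; exact: Gminus_simple.
- move=> /is_scalar_mxP[c ac]; apply/funext => x; apply/funext => t.
  by rewrite /dress_u /comm ac scalar_mxC subrr scaler0 addr0.
move=> ab [pu su [g hg BE]].
have {BE} BE : B = fun x t => conj_by b (g x t).
  by apply/funext => x; apply/funext => t.
have [smu _ uu _ _] := hl.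
have minors x t i k : pt x t i k * pt x t k i = pt x t i i * pt x t k k.
  by apply: rank1_minors; apply: leq_trans rp; exact: image_proj_rank.
have dpx t x : mder (pt ^~ t) x (comm (pt x t) (u x t) + z *: comm (pt x t) a
    - (z - z^*) *: (comm (pt x t) a *m pt x t)).
  have [d _] := dpt x t; apply: mder_eq d _.
  by have [_ p2] := hpt x t; exact: proj_flow_x.
split.
- by move=> x t; apply: comm_perp; [exact: pu|exact: (dress_u_skew z ha hl hpt x t)].
- move=> t; exact: (dress_schwartz ha hdiag hz (su t) (fun x => hpt x t)
    (fun x => minors x t) (dpx t)).
have rc t := comm_proj_rapid ha hdiag hz (su t) (fun x => hpt x t)
    (fun x => minors x t) (dpx t).
have rf t : mrapid (fun x => proj_flow ((z *: a + u x t) ^t*) (pt x t)).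
  rewrite (_ : (fun x => _) = fun x => comm (pt x t) (u x t) + z *: comm (pt x t) a
    - (z - z^*) *: (comm (pt x t) a *m pt x t)).
    exact: (proj_flow_rapid ha hdiag hz (su t) (fun x => hpt x t)
      (fun x => minors x t) (dpx t)).
  by apply/funext => x; have [_ p2] := hpt x t; exact: proj_flow_x.
rewrite BE in dpt.
have [g' [fg' Bg']] := dress_frame ha hb hz ab smu uu hg hpt dpt rc rf.
exists g'; last by move=> x t; rewrite Bg' BE.
split => // x t; rewrite Bg' -BE.
by have [_ _ _ _ /(_ x t)[]] := hl'.
Qed.

Lemma Gminus_dressable f : Gminus f -> dressable f.
Proof.
apply: Gminus_ind.
- exact: dressable_ext.
- exact: dressable1.
- exact: dressableM.
- exact: dressable_simple.
Qed.

Lemma wave_dressing f u g E u' B' E' ft : flow_solution a b u g ->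
  wave a u (fun x t => conj_by b (g x t)) E -> lax a u' B' -> wave a u' B' E' ->
  (forall x t, Gminus (ft x t)) -> intertwines f E E' ft -> dressing a b f u u'.
Proof.
move=> hg hE hl' hE' hft hi; exists g, E, E', ft; split=> //.
- exact/trivialization_wave.
- by move=> x t; split; [exact: (wave_Gplus x t hl' hE')|exact: hft|exact: hi].
move=> l x t l0; have [_ dE' _] := hE'; have [/mderE[d e] _] := dE' l l0 x t.
by split=> //; rewrite /dx e mulKmx//; exact: (wave_unit x t ha hl' hE' l0).
Qed.

(** Frame and trivialization are unique, and so is the factorization; at [l = 1]
   the connection determines the potential. *)
Lemma dressing_unique f u u1 u2 : (forall x t, in_u (u x t)) -> smooth u ->
  dressing a b f u u1 -> dressing a b f u u2 -> u1 = u2.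
Proof.
move=> uu su [g1 [E1 [F1 [f1 [hg1 hE1 fac1 d1]]]]] [g2 [E2 [F2 [f2 [hg2 hE2 fac2 d2]]]]].
have eg : g2 = g1 by exact: (frame_unique uu (proj1 hg2) (proj1 hg1)).
have hl := frame_lax hb uu su hg1.
move: hE1 hE2; rewrite eg => /trivialization_wave hE1 /trivialization_wave hE2.
have eF l x t : l != 0 -> F1 x t l = F2 x t l.
  have [P1 M1 e1] := fac1 x t; have [P2 M2 e2] := fac2 x t.
  apply: (factorization_unique P1 P2 M1 M2).
  apply: off_finite_sub (off_finite_and (off_finite_neq 0) (off_finite_and e1 e2)).
  by move=> k [k0 [<- <-]]; rewrite (wave_unique x t ha hl hE1 hE2 k0).
apply/funext => x; apply/funext => t.
have one0 : (1 : C) != 0 := oner_neq0 _.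
have [_ h1] := d1 1 x t one0; have [_ h2] := d2 1 x t one0.
apply: (addrI (1 *: a)); rewrite -h1 -h2 (eF 1 x t one0); congr (_ *m _).
by congr (mx_derive _ x); apply/funext => s; exact: eF.
Qed.

(** Dressing is a partial function; where it is undefined, the action is
   extended by the identity. *)
Definition dressing_action f u : R -> R -> M :=
  xget u [set u' | dressing a b f u u'].

Lemma dressing_actionE f u u' : (forall x t, in_u (u x t)) -> smooth u ->
  dressing a b f u u' -> dressing_action f u = u'.
Proof.
move=> uu su hd; rewrite /dressing_action; case: xgetP => [v _ hv|/(_ u')//].
exact: dressing_unique hv hd.
Qed.

Lemma flow_space_skew u : flow_space a b u ->
  (forall x t, in_u (u x t)) /\ smooth u.
Proof. by move=> [pu su _ _]; split=> // x t; have [] := pu x t. Qed.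

Lemma flow_space_wave u g : flow_space a b u -> flow_solution a b u g ->
  lax a u (fun x t => conj_by b (g x t)) /\
  exists E, wave a u (fun x t => conj_by b (g x t)) E.
Proof.
move=> /flow_space_skew[uu su] hg; have hl := frame_lax hb uu su hg.
by split=> //; exact: wave_exists.
Qed.

Lemma dressing_flow_space f u : Gminus f -> flow_space a b u ->
  exists u', [/\ dressing a b f u u', is_scalar_mx a -> u' = u &
    (forall y, in_Ua a y -> comm b y = 0) -> flow_space a b u'].
Proof.
move=> hf hu; have [pu su schu [g hg]] := hu.
have [hl [E hE]] := flow_space_wave hu hg.
have [u' [B' [E' [ft [[hl' hE'] hft hi hs hpot]]]]] := Gminus_dressable hf hl hE.
exists u'; split=> //; first exact: wave_dressing hg hE hl' hE' hft hi.
move=> ab; have [|pu' schu' [g' hg' _]] := hpot ab; first by split=> //; exists g.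
by split=> //; [case: hl'|exists g'].
Qed.

Lemma dressing_actionP f u : Gminus f -> flow_space a b u ->
  forall u', dressing a b f u u' <-> u' = dressing_action f u.
Proof.
move=> hf hu u'; have [uu su] := flow_space_skew hu.
have [v [hv _ _]] := dressing_flow_space hf hu.
rewrite (dressing_actionE uu su hv); split=> [hu'|->//].
exact: dressing_unique hu' hv.
Qed.

Lemma dressing_action_flow_space f u : b_compatible a b -> Gminus f ->
  flow_space a b u -> flow_space a b (dressing_action f u).
Proof.
move=> hc hf hu; have [uu su] := flow_space_skew hu.
have [v [hv sv cv]] := dressing_flow_space hf hu.
rewrite (dressing_actionE uu su hv); case: hc => [sa|ab]; last exact: cv.
by rewrite sv.
Qed.

Lemma dressing_action1 u : flow_space a b u -> dressing_action (fun=> 1%:M) u = u.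
Proof.
move=> hu; have [uu su] := flow_space_skew hu; have [_ _ _ [g hg]] := hu.
have [hl [E hE]] := flow_space_wave hu hg.
apply: dressing_actionE => //; apply: (wave_dressing hg hE hl hE (ft := fun _ _ _ => 1%:M)).
  by move=> x t; exact: Gminus1.
by move=> x t; apply: off_finite_all => l; rewrite mul1mx mulmx1.
Qed.

(** The wave function produced by [h] is the trivialization of the dressed
   potential, so two factorizations compose. *)
Lemma dressing_actionM f h u : b_compatible a b -> Gminus f -> Gminus h ->
  flow_space a b u ->
  dressing_action (fun l => f l *m h l) u = dressing_action f (dressing_action h u).
Proof.
move=> hc hf hh hu; have [uu su] := flow_space_skew hu.
case: hc => [sa|ab].
  have triv k : Gminus k -> dressing_action k u = u.
    move=> hk; have [v [hv sv _]] := dressing_flow_space hk hu.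
    by rewrite (dressing_actionE uu su hv) sv.
  by rewrite (triv h hh) (triv f hf) triv//; exact: GminusM.
have [pu _ schu [g hg]] := hu.
have [hl [E hE]] := flow_space_wave hu hg.
have [u1 [B1 [E1 [h1 [[hl1 hE1] hh1 i1 _ p1]]]]] := Gminus_dressable hh hl hE.
have [|_ _ [g1 hg1 BE1]] := p1 ab; first by split=> //; exists g.
have {BE1} BE1 : B1 = fun x t => conj_by b (g1 x t).
  by apply/funext => x; apply/funext => t.
have [u2 [B2 [E2 [f2 [[hl2 hE2] hf2 i2 _ _]]]]] := Gminus_dressable hf hl1 hE1.
have [su1 _ uu1 _ _] := hl1.
rewrite (dressing_actionE uu su (wave_dressing hg hE hl1 hE1 hh1 i1)).
rewrite BE1 in hE1.
rewrite (dressing_actionE uu1 su1 (wave_dressing hg1 hE1 hl2 hE2 hf2 i2)).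
apply: dressing_actionE => //.
apply: (wave_dressing hg hE hl2 hE2 (ft := fun x t l => f2 x t l *m h1 x t l)).
  by move=> x t; exact: GminusM.
exact: intertwinesM i2 i1.
Qed.

Section ProjectionSystem.
Variables (u g : R -> R -> M) (E : R -> R -> C -> M) (z : C) (p : M).
Let B x t := conj_by b (g x t).
Hypotheses (hl : lax a u B) (hE : wave a u B E).
Hypotheses (hz : z \isn't Num.real) (hp : hermitian_projection p).

Let z0 : z != 0. Proof. exact: nonreal_neq0. Qed.
Let uu x t : in_u (u x t). Proof. by case: hl. Qed.
Let uB x t : in_u (B x t). Proof. by case: hl. Qed.

Let flow_xE q x t : hermitian_projection q ->
  proj_flow ((z *: a + u x t) ^t*) q + comm (z *: a + u x t) q =
  (z^* - z) *: (comm q a *m q).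
Proof.
move=> [_ q2]; rewrite proj_flow_x// -[z^* - z]opprB scaleNr.
suff -> : comm (z *: a + u x t) q = - (comm q (u x t) + z *: comm q a).
  by rewrite addrAC subrr sub0r.
exact: comm_flow_algebra.
Qed.

Let flow_tE q x t : proj_flow ((z^-1 *: B x t) ^t*) q =
  (`|z| ^+ 2)^-1 *: ((z - z^*) *: (q *m B x t *m q)
    - z *: (B x t *m q) + z^* *: (q *m B x t)).
Proof. by rewrite (proj_flow_t q z0 (uB x t)) normCK. Qed.

(** The system of the statement is the flow of projections induced by the adjoint
   of [E] at [z]. *)
Lemma projection_systemP q : projection_system a b z u g p q <->
  [/\ forall x t, hermitian_projection (q x t), q 0 0 = p &
    partials q (fun x t => proj_flow ((z *: a + u x t) ^t*) (q x t))
               (fun x t => proj_flow ((z^-1 *: B x t) ^t*) (q x t))].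
Proof.
split=> [[dq ex et hq q0]|[hq q0 dq]].
  split=> // x t; have [d1 d2] := dq x t; split.
    apply/mderE; split=> //; apply: (addIr (comm (z *: a + u x t) (q x t))).
    by rewrite flow_xE//; exact: ex.
  by apply/mderE; split=> //; rewrite flow_tE; exact: et.
split=> //.
- by move=> x t; have [/mderE[] + _ /mderE[]] := dq x t.
- move=> x t; have [/mderE[_ e] _] := dq x t.
  by rewrite /dx e flow_xE.
- move=> x t; have [_ /mderE[_ e]] := dq x t.
  by rewrite /dt e flow_tE.
Qed.

Lemma dress_proj_system : projection_system a b z u g p (dress_proj z E p).
Proof.
apply/projection_systemP; split.
- exact: (dress_proj_hermitian ha hz hl hE hp).
- exact: (dress_proj00 _ hE hp).
- exact: (dress_proj_partials ha hz hl hE hp).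
Qed.

Lemma dress_proj_system_unique q : projection_system a b z u g p q ->
  q = dress_proj z E p.
Proof.
move=> /projection_systemP[hq q0 dq]; apply/funext => x; apply/funext => t.
exact: (dress_proj_unique ha hz hl hE hp hq q0 dq).
Qed.

End ProjectionSystem.

Lemma dressing_action_simple u g E (z : C) (p : M) : flow_space a b u ->
  flow_solution a b u g -> wave a u (fun x t => conj_by b (g x t)) E ->
  z \isn't Num.real -> hermitian_projection p ->
  dressing_action (simple_element z p) u = dress_u a z u (dress_proj z E p).
Proof.
move=> hu hg hE hz hp; have [uu su] := flow_space_skew hu.
have hl := frame_lax hb uu su hg.
have hpt := dress_proj_hermitian ha hz hl hE hp.
have dpt := dress_proj_partials ha hz hl hE hp.
have [E' hE' hi] := simple_intertwines hz hl hE hp.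
apply: dressing_actionE => //.
apply: (wave_dressing hg hE (dress_lax ha hz hl hpt dpt) hE' _ hi) => x t.
exact: Gminus_simple.
Qed.

End Action.

Theorem mainTheorem8 (R : realType) (n : nat) (a b : 'M[R[i]]_n)
    (ha : in_u a) (hdiag : is_diag_mx a) (hb : in_u b) (hab : comm a b = 0) :
  exists act : (R[i] -> 'M[R[i]]_n) -> (R -> R -> 'M[R[i]]_n) ->
               (R -> R -> 'M[R[i]]_n),
    [/\ (forall f u, Gminus f -> flow_space a b u ->
           forall ut, dressing a b f u ut <-> ut = act f u),
        (b_compatible a b ->
           [/\ forall f u, Gminus f -> flow_space a b u ->
                 flow_space a b (act f u),
               forall u, flow_space a b u -> act (fun=> 1%:M) u = u
             & forall f h u, Gminus f -> Gminus h -> flow_space a b u ->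
                 act (fun l => f l *m h l) u = act f (act h u)])
      & (forall u g E z p,
           flow_space a b u -> flow_solution a b u g ->
           trivialization a b u g E ->
           z \isn't Num.real -> hermitian_projection p ->
           exists pt : R -> R -> 'M[R[i]]_n,
             [/\ forall x t, hermitian_projection (pt x t) /\
                   range (mulmx (pt x t) : 'cV_n -> 'cV_n)
                   = mulmx ((E x t z) ^t*)
                       @` range (mulmx p : 'cV_n -> 'cV_n),
                 act (simple_element z p) u
                 = (fun x t => u x t + (z - z^*) *: comm (pt x t) a),
                 projection_system a b z u g p pt
               & forall q, projection_system a b z u g p q -> q = pt])].
Proof.
exists (dressing_action a b); split.
- by move=> f u; exact: dressing_actionP.
- move=> hc; split.
  + by move=> f u; exact: dressing_action_flow_space.
  + by move=> u; exact: dressing_action1.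
  + by move=> f h u; exact: dressing_actionM.
move=> u g E z p hu hg /trivialization_wave hE hz hp.
have [hl _] := flow_space_wave ha hb hu hg.
exists (dress_proj z E p); split.
- move=> x t; split; first exact: (dress_proj_hermitian ha hz hl hE hp x t).
  exact: (range_image_proj (wave_adj_unit ha hz hl hE x t) hp).
- exact: (dressing_action_simple ha hb hu hg hE hz hp).
- exact: (dress_proj_system ha hl hE hz hp).
- by move=> q; exact: (dress_proj_system_unique ha hl hE hz hp).
Qed.
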